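(* Let $(\ell_n)_{n\ge 1}$ be a sequence of real numbers in $(0,1)$ decreasing to zero, such that $\sum_{n=1}^\infty \ell_n=\infty$ and $\sum_{n=1}^{\infty}(\ell_n-\ell_{n+1})\exp\left(\sum_{k=1}^n \ell_k\right)<\infty$. Suppose that there exists an integer $d\ge 1$ such that $$\int_{\mathbb{T}^d}K(t_1)\cdots K(t_d)\,K\Big(-\sum_{i=1}^d t_i\Big)\,\mathrm{d}t_1\cdots \mathrm{d}t_d<\infty .$$ Then, almost surely, the $d$-th convolution $\ast^d\mu_D$ of the Dvoretzky measure $\mu_D$ is absolutely continuous with respect to Lebesgue measure on $\mathbb{T}$.
   Context: $\mathbb{T}=\mathbb{R}/\mathbb{Z}$ is identified with $[0,1)$ and carries Lebesgue (Haar probability) measure; $\|t\|=\inf_{n\in\mathbb{Z}}|t-n|$ for $t\in\mathbb T$. $(\omega_n)_{n\ge1}$ is a sequence of independent random variables on a probability space $(\Omega,\mathcal B,\mathbb P)$, each uniformly distributed on $\mathbb{T}$. The function $K:\mathbb{T}\to[1,\infty]$ is $K(t)=\exp\left(\sum_{n=1}^\infty(\ell_n-\|t\|)_+\right)$, where $x_+=\max(x,0)$. For $t\in\mathbb{T}$ and $n\ge 1$ put $P_n(t)=\dfrac{1-\mathbf 1_{(0,\ell_n)}(t-\omega_n)}{1-\ell_n}$ (with $t-\omega_n$ taken modulo $1$ in $[0,1)$), $M_n(t)=\prod_{k=1}^n P_k(t)$, and $\mu_n(\mathrm{d}t)=M_n(t)\,\mathrm{d}t$. Almost surely, $\mu_n$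 converges weakly to a random finite measure on $\mathbb T$, denoted $\mu_D$ and called the Dvoretzky measure. For a finite measure $\mu$ on $\mathbb{T}$, the $d$-th convolution $\ast^d\mu$ denotes $\mu\ast\cdots\ast\mu$ with $d$ convolution operations, i.e. $d+1$ factors $\mu$; in particular $\ast^d\mu_n$ has density $\ast^dM_n(t)=\int_{\mathbb{T}^d}M_n(t_1)\cdots M_n(t_d)M_n(t-\sum_{i=1}^d t_i)\,\mathrm{d}t_1\cdots\mathrm{d}t_d$. *)

(* Defs.v *)
From HB Require Import structures.
From mathcomp Require Import all_boot all_order all_algebra finmap.
From mathcomp Require Import all_classical all_reals all_analysis.
From mathcomp Require Import measurable_realfun.

Set Implicit Arguments.
Unset Strict Implicit.
Unset Printing Implicit Defensive.

Import Order.TTheory GRing.Theory Num.Theory.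
Import numFieldNormedType.Exports.

Local Open Scope classical_set_scope.
Local Open Scope ring_scope.

Section circle.
Context {R : realType}.
Implicit Types t : R.

(* The circle R/Z is identified with [0, 1[; functions on the circle are
   1-periodic functions on R, and measures on the circle are measures on R
   that vanish outside [0, 1[. *)
Definition torus : set R := `[0, 1[.

Lemma measurable_torus : measurable (torus : set (measurableTypeR R)).
Proof. exact: measurable_itv. Qed.

Definition torus_lebesgue : set (measurableTypeR R) -> \bar R :=
  mrestr lebesgue_measure measurable_torus.

HB.instance Definition _ := Measure.on torus_lebesgue.

Definition mod1 t : R := t - (Num.floor t)%:~R.

Lemma measurable_mod1 : measurable_fun [set: R] mod1.
Proof.
apply: measurable_funB => //.
apply: nondecreasing_measurable => // x y xy.
by rewrite ler_int le_floor.
Qed.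

Definition tnorm t : R := inf [set `|t - n%:~R| | n in [set: int]].

Definition weak_cvg_torus
    (m_ : nat -> {measure set (measurableTypeR R) -> \bar R})
    (m : {measure set (measurableTypeR R) -> \bar R}) : Prop :=
  forall f : R -> R, continuous f -> (forall t, f (t + 1) = f t) ->
    (\int[m_ n]_(t in torus) (f t)%:E)%E @[n --> \oo] -->
    (\int[m]_(t in torus) (f t)%:E)%E.

(* [torus_integral d F] is the integral over the [d]-dimensional torus of the
   nonnegative function [F], written as an iterated integral (Tonelli); the
   points of the torus of dimension [d] are the sequences of length [d]. *)
Fixpoint torus_integral (d : nat) (F : seq R -> \bar R) : \bar R :=
  if d is d'.+1 then
    (\int[lebesgue_measure]_(t in torus)
       torus_integral d' (fun s => F (t :: s)))%E
  else F [::].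

End circle.

Section convolution.
Context {R : realType}.
Local Open Scope ereal_scope.

Definition torus_add (p : measurableTypeR R * measurableTypeR R) :
  measurableTypeR R := mod1 (p.1 + p.2 : R)%R.

Lemma measurable_torus_add : measurable_fun setT torus_add.
Proof.
by apply: measurableT_comp; [exact: measurable_mod1|exact: measurable_funD].
Qed.

Section conv.
Variables mu nu : {finite_measure set (measurableTypeR R) -> \bar R}.

Definition torus_conv : set (measurableTypeR R) -> \bar R :=
  pushforward (mu \x nu) torus_add.

Let conv0 : torus_conv set0 = 0.
Proof. by rewrite /torus_conv /pushforward preimage_set0 measure0. Qed.

Let conv_ge0 A : 0 <= torus_conv A.
Proof. by rewrite /torus_conv /pushforward measure_ge0. Qed.

Let conv_sigma_additive : semi_sigma_additive torus_conv.
Proof.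
have mpre A : measurable A -> measurable (torus_add @^-1` A).
  by move=> mA; rewrite -[X in measurable X]setTI; exact: measurable_torus_add.
move=> F mF tF mUF; rewrite /torus_conv /pushforward preimage_bigcup.
apply: measure_semi_sigma_additive.
- by move=> n; exact: mpre.
- apply/trivIsetP => /= i j _ _ ij; rewrite -preimage_setI.
  by move/trivIsetP : tF => /(_ _ _ _ _ ij) ->//; rewrite preimage_set0.
- by rewrite -preimage_bigcup; exact: mpre.
Qed.

HB.instance Definition _ := isMeasure.Build _ _ _ torus_conv
  conv0 conv_ge0 conv_sigma_additive.

Let conv_finite : fin_num_fun torus_conv.
Proof.
suff : (mu \x nu) (setT `*` setT) < +oo.
  by rewrite setXTT => ?; exact: lty_fin_num_fun.
rewrite product_measure1E// lte_mul_pinfty ?fin_num_measure//.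
by rewrite -ge0_fin_numE// fin_num_measure.
Qed.

HB.instance Definition _ := Measure_isFinite.Build _ _ _ torus_conv conv_finite.

End conv.

(* [d] convolution operations, i.e. [d.+1] factors. *)
Definition torus_conv_pow (d : nat)
    (mu : {finite_measure set (measurableTypeR R) -> \bar R}) :
    {finite_measure set (measurableTypeR R) -> \bar R} :=
  iter d (fun nu => [the {finite_measure set _ -> \bar R} of torus_conv mu nu])
       mu.

End convolution.

Definition mutually_independent d (Omega : measurableType d) (R : realType)
    (P : probability Omega R) (I : set nat) (X : nat -> {RV P >-> R}) : Prop :=
  forall (J : {fset nat}) (B : nat -> set R),
    [set` J] `<=` I -> (forall i, measurable (B i)) ->
    P (\bigcap_(i in [set` J]) X i @^-1` B i) =
    (\prod_(i <- J) P (X i @^-1` B i))%E.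

(* All the sequences below are indexed from 1: their value at 0 is never used. *)
Section dvoretzky.
Context {R : realType}.
Variable l : nat -> R.

Definition dvoretzky_kernel (t : R) : \bar R :=
  expeR (\sum_(1 <= n <oo) (Num.max (l n - tnorm t) 0)%:E)%E.

(* [x] is the sequence of the left endpoints of the arcs, i.e. a realization of
   the random sequence omega. *)
Variable x : nat -> R.

Definition dvoretzky_factor (n : nat) (t : R) : R :=
  (1 - \1_(`]0, l n[%classic) (mod1 (t - x n))) / (1 - l n).

Definition dvoretzky_density (n : nat) (t : R) : R :=
  \prod_(1 <= k < n.+1) dvoretzky_factor k t.

Lemma measurable_dvoretzky_density n :
  measurable_fun [set: R] (dvoretzky_density n).
Proof.
apply: measurable_prod => k _.
apply: measurable_funM => //; apply: measurable_funB => //.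
apply: measurableT_comp; first exact: measurable_indic.
apply: measurableT_comp; first exact: measurable_mod1.
exact: measurable_funB.
Qed.

Lemma dvoretzky_density_ge0 (l01 : forall n, (1 <= n)%N -> 0 < l n < 1) n t :
  0 <= dvoretzky_density n t.
Proof.
rewrite /dvoretzky_density big_nat; apply: prodr_ge0 => k /andP[k1 _].
have /andP[_ lk] := l01 _ k1.
by rewrite divr_ge0 ?subr_ge0 ?(ltW lk)// indicE; case: (_ \in _).
Qed.

(* The measure mu_n(dt) = M_n(t) dt on the circle; the condition on [l] makes
   the density nonnegative. *)
Definition dvoretzky_approx (l01 : forall n, (1 <= n)%N -> 0 < l n < 1)
    (n : nat) : set (measurableTypeR R) -> \bar R := fun A =>
  (\int[lebesgue_measure]_(t in A `&` torus) (dvoretzky_density n t)%:E)%E.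

Section measure.
Variable l01 : forall n, (1 <= n)%N -> 0 < l n < 1.
Variable n : nat.
Local Open Scope ereal_scope.

Let approx0 : dvoretzky_approx l01 n set0 = 0.
Proof. by rewrite /dvoretzky_approx set0I integral_set0. Qed.

Let approx_ge0 A : 0 <= dvoretzky_approx l01 n A.
Proof.
by apply: integral_ge0 => t _; rewrite lee_fin dvoretzky_density_ge0.
Qed.

Let approx_sigma_additive : semi_sigma_additive (dvoretzky_approx l01 n).
Proof.
pose g := (EFin \o dvoretzky_density n) \_ torus.
rewrite (_ : dvoretzky_approx l01 n =
             fun A => \int[lebesgue_measure]_(t in A) g t).
  apply: semi_sigma_additive_nng_induced.
    apply/(measurable_restrictT _ _).1; first exact: measurable_itv.
    apply: measurable_funTS; apply/measurable_EFinP.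
    exact: measurable_dvoretzky_density.
  by apply: erestrict_ge0 => t _; rewrite lee_fin dvoretzky_density_ge0.
by apply/funext => A; rewrite /dvoretzky_approx integral_mkcondr.
Qed.

HB.instance Definition _ := isMeasure.Build _ _ _ (dvoretzky_approx l01 n)
  approx0 approx_ge0 approx_sigma_additive.

End measure.

End dvoretzky.

(* Main.v *)
Require Import Defs.
From HB Require Import structures.
From mathcomp Require Import all_boot all_order all_algebra finmap.
From mathcomp Require Import all_classical all_reals all_analysis.
From mathcomp Require Import measurable_realfun ring lra zify.

Set Implicit Arguments.
Unset Strict Implicit.
Unset Printing Implicit Defensive.

Import Order.TTheory GRing.Theory Num.Theory.
Import numFieldNormedType.Exports.

Local Open Scope classical_set_scope.
Local Open Scope ring_scope.

(** Let [m = d + 1], so that the [d]-th convolution of the measure with density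
    [M_n] is the law of [t_1 + ... + t_m], up to normalization, when the [t_i]
    are independent with density [M_n]. The proof bounds the expectation of its
    [energy] at scale [e], the mass that the square of this convolution gives to
    the pairs of points at distance at most [e]; an energy of order [e] is what a
    square integrable density would give. The energy is an integral over
    [2 * m] points [x_i], restricted to
    [|| x_1 + ... + x_m - x_(m+1) - ... - x_(2m) || <= e].

    Moments. The arc of length [l_k] that starts at a uniform point misses
    [x_1, ..., x_q] only if its left endpoint avoids, just before each [x_i], an
    arc whose length is the minimum of [l_k] and of the gap that precedes [x_i];
    these arcs are disjoint. As
    [1 - z <= exp (- z)], the expectation of [M_n(x_1) ... M_n(x_q)] is at most a
    constant times the product over the cyclic gaps [g] of
    [exp (\sum_(k <= n) (l_k - g)_+)] ([moment_le_gaps]). The constant involves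
    [\sum_k l_k ^ 2], which is finite by [sum_sqr_bounded].

    Energy. Cut the cycle of [2d + 2] points at its widest gap; [2d + 1] gaps
    remain, among which those of even rank are [d + 1]. Single out the widest of
    these, and use as coordinates one point and the [2d + 1] gaps. The number
    of points beyond the gap singled out is odd, so that varying that gap alone
    rotates an odd number of points and moves the constrained sum with a nonzero
    integer slope: the constraint costs a factor of order [e]. The other [2d]
    gaps form two classes of [d] gaps, according to the parity of their rank, and
    the weight of each cut is at most that of the widest gap of one class. The
    integral therefore splits into the square of an integral over [d] gaps of the
    product of their weights and of the weight of the widest one
    ([integral_cut_weight], [constrained_moment_bound]). The widest gap being at
    least the mean of the gaps, a contraction of ratio [1 / d] bounds this
    integral by [d ^ d] times the integral of the hypothesis
    ([gap_weight_integral_le]). Hence the expected energy at scale [e] is at most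
    [C * e], uniformly in [n] ([expected_energy_le]).

    Absolute continuity. By Fatou's lemma, almost surely the energies at scale
    [1 / n] of the approximations, divided by the scale, have a finite lower
    limit [Z]. A nonnegative function [g] that oscillates little at scale [e] is
    close to its average on the arcs of length [e]; the inequality
    [g * D <= eta / 2 * g ^ 2 + D ^ 2 / (2 * eta)], applied to the densities
    averaged over such arcs, bounds the integral of [g] against the convolution
    of the approximations by the integral of [g ^ 2] and the energy
    ([conv_integral_le_energy]). Passing to the weak limit, the limit
    convolution [nu] satisfies
    [\int g dnu <= eta / 2 * \int g ^ 2 + Z / (2 * eta)] for every [eta > 0]. On
    tents supported near a cover of a null set by small intervals the right-hand
    side is as small as desired, so that [nu] does not charge null sets
    ([energy_absolutely_continuous]). *)

(** * Integration with a parameter *)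

Section integration_tools.
Local Open Scope ereal_scope.

(** The integral of a nonnegative function is a supremum over the simple functions
    below it, whence its monotonicity for arbitrary functions; this spares the
    measurability of the iterated integrals in most comparisons. *)
Lemma ge0_le_integral_nonmeas d (T : measurableType d) (R : realType)
    (mu : {measure set T -> \bar R}) (D : set T) (f g : T -> \bar R) :
  (forall x, D x -> 0 <= f x) -> (forall x, D x -> f x <= g x) ->
  \int[mu]_(x in D) f x <= \int[mu]_(x in D) g x.
Proof.
move=> f0 fg; have g0 x : D x -> 0 <= g x.
  by move=> Dx; apply: le_trans (fg _ Dx); exact: f0.
rewrite !ge0_integralE//; apply: le_ereal_sup => _ /= [h hf <-].
exists h => // x; apply: (le_trans (hf x)); rewrite !patchE.
by case: ifPn => //; rewrite inE; exact: fg.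
Qed.

Context {R : realType}.
Local Notation mR := (measurableTypeR R).
Local Notation lam := (@lebesgue_measure R).

Lemma measurable_fun_restrict_torus d (T : measurableType d)
    (F : T * mR -> \bar R) : measurable_fun setT F ->
  measurable_fun setT (F \_ (setT `*` (torus : set mR))).
Proof.
move=> mF; apply/(measurable_restrictT _ _).1.
  by apply: measurableX => //; exact: measurable_torus.
exact: measurable_funTS.
Qed.

(** Turns the integral on the circle into an integral on the line, where Tonelli's
    theorem applies. *)
Lemma integral_torusE d (T : measurableType d) (F : T * mR -> \bar R) t :
  \int[lam]_(x in torus) F (t, x) =
  \int[lam]_x (F \_ (setT `*` (torus : set mR))) (t, x).
Proof.
rewrite integral_mkcond; apply: eq_integral => x _.
by rewrite !patchE; congr (if _ then _ else _); apply/idP/idP;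
  rewrite !inE /=; tauto.
Qed.

Lemma measurable_integral_torus d (T : measurableType d)
    (F : T * mR -> \bar R) : measurable_fun setT F -> (forall p, 0 <= F p) ->
  measurable_fun setT (fun t => \int[lam]_(x in torus) F (t, x)).
Proof.
move=> mF F0.
under eq_fun do rewrite integral_torusE.
apply: (measurable_fun_fubini_tonelli_F (m2 := lam)).
  exact: measurable_fun_restrict_torus.
by move=> p; apply: erestrict_ge0.
Qed.

Lemma torus_tonelli d (T : measurableType d)
    (m : {sigma_finite_measure set T -> \bar R})
    (F : T * mR -> \bar R) : measurable_fun setT F -> (forall p, 0 <= F p) ->
  \int[m]_t \int[lam]_(x in torus) F (t, x) =
  \int[lam]_(x in torus) \int[m]_t F (t, x).
Proof.
move=> mF F0.
under eq_integral do rewrite integral_torusE.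
rewrite (fubini_tonelli (m1 := m) (m2 := lam)
  (F \_ (setT `*` (torus : set mR)))).
- rewrite [RHS]integral_mkcond; apply: eq_integral => x _.
  rewrite [RHS]patchE; case: ifPn => [|/negP]; rewrite inE => xt.
    by apply: eq_integral => t _; rewrite patchE ifT// inE/=.
  rewrite integral0_eq// => t _; rewrite patchE ifF//.
  by apply/negP; rewrite inE/= => -[_ /xt].
- exact: measurable_fun_restrict_torus.
- by move=> p; apply: erestrict_ge0.
Qed.

End integration_tools.

(** * Changes of variable on the circle *)

Section affine_change_of_variable.
Context {R : realType}.
Local Open Scope ereal_scope.
Local Notation mR := (measurableTypeR R).
Local Notation lam := (@lebesgue_measure R).

Definition affine (a b : R) : mR -> mR := fun x => (a * x + b)%R.

Lemma measurable_affine a b : measurable_fun setT (affine a b).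
Proof. by apply: measurable_funD => //; exact: measurable_funM. Qed.

Lemma preimage_affine_itv (a b : R) (u v : R) : (0 < a)%R ->
  affine a b @^-1` `]u, v] = (`]((u - b) / a)%R, ((v - b) / a)%R]%classic : set mR).
Proof.
move=> a0; apply/seteqP; split => x /=; rewrite /affine !in_itv/=;
by rewrite ltr_pdivrMr// ler_pdivlMr// ltrBlDr lerBrDr [(x * a)%R]mulrC.
Qed.

(** Written as a scaled push-forward, so that the change of variables formula for
    push-forwards applies to it. *)
Definition affine_image (a b : R) (a0 : (0 <= a)%R) : {measure set mR -> \bar R}.
Proof.
unshelve refine (mscale (NngNum a0) (pushforward lam (affine a b))).
exact: measurable_affine.
Defined.

(** Both sides are measures that agree on the half-open intervals. *)
Lemma lebesgue_measure_affine (a b : R) (A : set mR) : (0 < a)%R -> measurable A ->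
  lam A = a%:E * lam (affine a b @^-1` A).
Proof.
move=> a0 mA.
transitivity (affine_image b (ltW a0) A); last by [].
apply: lebesgue_measure_unique A mA.
move=> _ [[u v] _ <-]; transitivity (a%:E * lam (affine a b @^-1` `]u, v])); last by [].
rewrite preimage_affine_itv// !lebesgue_measure_itv/= !lte_fin.
rewrite ltr_pM2r ?invr_gt0// ltrD2r; case: ifPn => _; last by rewrite mule0.
rewrite -!EFinD -EFinM -mulrBl; congr EFin.
by rewrite opprB addrA subrK mulrCA mulfV ?mulr1// gt_eqF.
Qed.

Lemma ge0_integral_affine (a b : R) (D : set mR) (f : mR -> \bar R) :
  (0 < a)%R -> measurable D -> measurable_fun D f ->
  (forall x, D x -> 0 <= f x) ->
  \int[lam]_(x in D) f x =
  a%:E * \int[lam]_(x in affine a b @^-1` D) f (affine a b x).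
Proof.
move=> a0 mD mf f0.
transitivity (\int[affine_image b (ltW a0)]_(x in D) f x).
  apply: eq_measure_integral => A mA _; exact: lebesgue_measure_affine.
rewrite ge0_integral_mscale//= (ge0_integral_pushforward (measurable_affine a b))//.
by move=> x; rewrite inE => /f0.
Qed.

End affine_change_of_variable.

Section circle_integrals.
Context {R : realType}.
Local Notation mR := (measurableTypeR R).
Local Notation lam := (@lebesgue_measure R).
Implicit Types (t x y e : R).

Lemma mod1_torus t : (torus : set R) (mod1 t).
Proof.
rewrite /torus/= in_itv/= /mod1 subr_ge0 ltrBlDl floor_le/=.
by rewrite -intrD1 floorD1_gt.
Qed.

Lemma mod1_ge0 t : 0 <= mod1 t.
Proof. by have := mod1_torus t; rewrite /torus/= in_itv/= => /andP[]. Qed.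

Lemma mod1_lt1 t : mod1 t < 1.
Proof. by have := mod1_torus t; rewrite /torus/= in_itv/= => /andP[]. Qed.

Lemma mod1_unique t u (z : int) : 0 <= u < 1 -> t = u + z%:~R -> mod1 t = u.
Proof.
move=> u01 ->; rewrite /mod1 (_ : Num.floor _ = z) ?addrK//.
by apply: floor_def; rewrite intrD /=; lra.
Qed.

Lemma mod1Dz t (z : int) : mod1 (t + z%:~R) = mod1 t.
Proof.
apply: (@mod1_unique _ _ (Num.floor t + z)); first by rewrite mod1_ge0 mod1_lt1.
by rewrite /mod1 intrD addrA subrK.
Qed.

Lemma mod1_id t : 0 <= t < 1 -> mod1 t = t.
Proof. by move=> t01; apply: (@mod1_unique _ _ 0) => //; rewrite addr0. Qed.

Lemma mod1Dl y t : mod1 (mod1 y + t) = mod1 (y + t).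
Proof.
by rewrite {2}/mod1 addrAC -mulrNz mod1Dz.
Qed.

Lemma preimage_translate_co (c u v : R) :
  affine 1 c @^-1` (`[u, v[%classic : set mR) = `[(u - c)%R, (v - c)%R[%classic.
Proof.
apply/seteqP; split => x /=; rewrite /affine !in_itv/= mul1r; lra.
Qed.

Lemma preimage_scale_co (a v : R) : 0 < a ->
  affine a 0 @^-1` (`[0, v[%classic : set mR) = `[0%R, (v / a)%R[%classic.
Proof.
move=> a0; apply/seteqP; split => x /=; rewrite /affine !in_itv/= addr0;
  by rewrite ltr_pdivlMr// pmulr_rge0// [a * x]mulrC.
Qed.

Local Open Scope ereal_scope.

(** The circle is cut where the translation by [mod1 y] goes once around; it is a
    translation of the line on each of the two pieces. *)
Lemma torus_translation (F : mR -> \bar R) y : measurable_fun setT F ->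
  (forall t, 0 <= F t) ->
  \int[lam]_(t in torus) F (mod1 (y + t)) = \int[lam]_(t in torus) F t.
Proof.
move=> mF F0; have [c cE] : exists c, c = mod1 y by exists (mod1 y).
have c0 : (0 <= c)%R by rewrite cE mod1_ge0.
have c1 : (c < 1)%R by rewrite cE mod1_lt1.
have itvU (a : R) : (0 <= a <= 1)%R -> (torus : set R) = `[0%R, a[ `|` `[a, 1%R[.
  move=> a01; apply/seteqP; split=> x; rewrite /torus/= !in_itv/=.
    by move=> x01; case: (ltP x a) => xa; [left|right]; lra.
  by case; lra.
have mG : measurable_fun setT (fun t => F (mod1 (y + t))).
  apply: measurableT_comp => //; apply: measurableT_comp; first exact: measurable_mod1.
  exact: measurable_funD.
have dis (a : R) : [disjoint `[0%R, a[ & `[a, 1%R[%classic].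
  apply/disj_setPLR => x /=; rewrite !in_itv/= => ? ?; lra.
rewrite [in LHS](itvU (1 - c)%R); last lra.
rewrite ge0_integral_setU//=; last exact: measurable_funTS.
rewrite [in RHS](itvU c); last lra.
rewrite ge0_integral_setU//=; last exact: measurable_funTS.
rewrite addeC; congr (_ + _).
- rewrite [RHS](@ge0_integral_affine _ 1 (c - 1)%R)//; last exact: measurable_funTS.
  rewrite preimage_translate_co mul1e.
  rewrite (_ : (0 - (c - 1))%R = (1 - c)%R); last by lra.
  rewrite (_ : (c - (c - 1))%R = 1%R); last by lra.
  apply: eq_integral => t; rewrite inE/= in_itv/= => t1.
  rewrite /affine mul1r -mod1Dl -cE; congr F.
  by apply: (@mod1_unique _ _ 1); [lra|rewrite /=; lra].
- rewrite [RHS](@ge0_integral_affine _ 1 c)//; last exact: measurable_funTS.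
  rewrite preimage_translate_co mul1e subrr.
  apply: eq_integral => t; rewrite inE/= in_itv/= => t1.
  rewrite /affine mul1r -mod1Dl -cE; congr F.
  by rewrite mod1_id; lra.
Qed.

Lemma torus_scaling (F : mR -> \bar R) (r : R) : measurable_fun setT F ->
  (forall t, 0 <= F t) -> (0 < r <= 1)%R ->
  r%:E * \int[lam]_(t in torus) F (r * t)%R <= \int[lam]_(t in torus) F t.
Proof.
move=> mF F0 /andP[r0 r1].
apply: (@le_trans _ _ (\int[lam]_(t in `[0%R, r[) F t)).
  rewrite [leRHS](@ge0_integral_affine _ r 0)//; last exact: measurable_funTS.
  rewrite preimage_scale_co// divff ?gt_eqF// lee_pmul2l ?lte_fin// /torus.
  by under [leRHS]eq_integral do rewrite /affine addr0.
apply: ge0_subset_integral => //; [exact: measurable_torus|exact: measurable_funTS|].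
by move=> x /=; rewrite /torus/= !in_itv/=; lra.
Qed.

Lemma lebesgue_torus : lam torus = 1.
Proof. by rewrite /torus lebesgue_measure_itv/= lte_fin ltr01 sube0. Qed.

End circle_integrals.

(** * Measurability and Tonelli for iterated integrals on the torus *)

Section measurability_in_finitely_many_variables.
Context {R : realType}.
Local Notation mR := (measurableTypeR R).

(** Joint measurability in a parameter and in [q] real variables, encoded along
    the recursion that defines [torus_integral]: the variables move one by one
    from the sequence to the space of parameters. *)
Fixpoint mseq (q : nat) d (T : measurableType d) d' (U : measurableType d')
    (F : T -> seq R -> U) : Prop :=
  if q is q'.+1 then
    @mseq q' _ (T * mR)%type _ U (fun p s => F p.1 (p.2 :: s))
  else measurable_fun setT (fun t => F t [::]).

Lemma eq_mseq q d (T : measurableType d) d' (U : measurableType d')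
    (F G : T -> seq R -> U) :
  (forall t s, size s = q -> F t s = G t s) -> mseq q F -> mseq q G.
Proof.
elim: q d T F G => [|q IH] d T F G FG /=.
  by rewrite (_ : (fun t => G t [::]) = (fun t => F t [::]))//;
    apply/funext => t; rewrite FG.
by apply: IH => p s sq; apply: FG; rewrite /= sq.
Qed.

Lemma mseq_reparam q d (T : measurableType d) d1 (T1 : measurableType d1)
    d' (U : measurableType d') (phi : T1 -> T) (F : T -> seq R -> U) :
  measurable_fun setT phi -> mseq q F -> mseq q (fun t => F (phi t)).
Proof.
elim: q d T d1 T1 phi F => [|q IH] d T d1 T1 phi F mphi /=.
  by move=> mF; exact: (measurableT_comp mF).
pose psi (p : T1 * mR) : T * mR := (phi p.1, p.2).
move=> mF; apply: (IH _ _ _ _ psi _ _ mF).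
by apply: measurable_fun_pair => //; exact: measurableT_comp.
Qed.

Lemma mseq_post q d (T : measurableType d) d' (U : measurableType d')
    d'' (V : measurableType d'') (h : U -> V) (F : T -> seq R -> U) :
  measurable_fun setT h -> mseq q F -> mseq q (fun t s => h (F t s)).
Proof.
elim: q d T F => [|q IH] d T F mh /= mF; last exact: IH.
exact: (measurableT_comp mh).
Qed.

Lemma mseq_pair q d (T : measurableType d) d' (U : measurableType d')
    d'' (V : measurableType d'') (F : T -> seq R -> U) (G : T -> seq R -> V) :
  mseq q F -> mseq q G -> mseq q (fun t s => (F t s, G t s)).
Proof.
elim: q d T F G => [|q IH] d T F G /= mF mG; last exact: IH.
exact: measurable_fun_pair.
Qed.

Lemma mseq_op2 q d (T : measurableType d) d1 (U1 : measurableType d1)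
    d2 (U2 : measurableType d2) d3 (U3 : measurableType d3)
    (op : U1 -> U2 -> U3) (F : T -> seq R -> U1) (G : T -> seq R -> U2) :
  measurable_fun setT (fun p : U1 * U2 => op p.1 p.2) ->
  mseq q F -> mseq q G -> mseq q (fun t s => op (F t s) (G t s)).
Proof.
move=> mop mF mG.
have H := mseq_post (h := fun p : U1 * U2 => op p.1 p.2) mop (mseq_pair mF mG).
exact H.
Qed.

Lemma mseq_param q d (T : measurableType d) d' (U : measurableType d')
    (h : T -> U) : measurable_fun setT h -> mseq q (fun t _ => h t).
Proof.
elim: q d T h => [|q IH] d T h mh //=.
by apply: (IH _ _ (h \o fst)); exact: measurableT_comp.
Qed.

Lemma mseq_nth q d (T : measurableType d) i :
  mseq q (fun (_ : T) s => nth 0 s i : mR).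
Proof.
elim: q d T i => [|q IH] d T i /=; first exact: measurable_cst.
case: i => [|i] /=; first exact: (mseq_param q measurable_snd).
exact: IH.
Qed.

(** The variables may be replaced by measurable functions of other variables. All
    the rearrangements of points and gaps used below are of this form, and each
    entry of the new sequence is simple to treat separately. *)
Lemma mseq_subst q k d (T : measurableType d) d1 (T1 : measurableType d1)
    d' (U : measurableType d') (F : T1 -> seq R -> U)
    (psi : T -> seq R -> T1) (phi : T -> seq R -> seq R) :
  mseq k F -> mseq q psi ->
  (forall t s, size s = q -> size (phi t s) = k) ->
  (forall i, mseq q (fun t s => nth 0 (phi t s) i : mR)) ->
  mseq q (fun t s => F (psi t s) (phi t s)).
Proof.
elim: k d1 T1 F psi phi => [|k IH] d1 T1 F psi phi mF mpsi sphi mphi.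
  apply: (@eq_mseq _ _ _ _ _ (fun t s => F (psi t s) [::])).
    by move=> t s /(sphi t)/size0nil ->.
  exact: (mseq_post (h := fun t => F t [::]) mF mpsi).
pose F' (p : T1 * mR) s := F p.1 (p.2 :: s).
pose psi' t s : T1 * mR := (psi t s, nth 0 (phi t s) 0).
apply: (@eq_mseq _ _ _ _ _ (fun t s => F' (psi' t s) (behead (phi t s)))).
  by move=> t s /(sphi t); rewrite /F' /psi'/=; case: (phi t s).
apply: (IH _ _ F' psi').
- exact: mF.
- by apply: mseq_pair => //; exact: mphi.
- by move=> t s /(sphi t); rewrite size_behead => ->.
- move=> i; under [X in mseq _ X]eq_fun do under eq_fun do rewrite nth_behead.
  exact: mphi.
Qed.

Lemma mseq_big q d (T : measurableType d) d' (U : measurableType d') I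
    (r : seq I) (op : U -> U -> U) (idx : U) (F : I -> T -> seq R -> U) :
  measurable_fun setT (fun p : U * U => op p.1 p.2) ->
  (forall i, mseq q (F i)) ->
  mseq q (fun t s => \big[op/idx]_(i <- r) F i t s).
Proof.
move=> mop mF; elim: r => [|i r IH].
  apply: (eq_mseq (F := fun _ _ => idx)); first by move=> *; rewrite big_nil.
  exact: mseq_param.
apply: (eq_mseq (F := fun t s => op (F i t s) (\big[op/idx]_(j <- r) F j t s))).
  by move=> *; rewrite big_cons.
exact: mseq_op2.
Qed.

Lemma mseq_big_seq q d (T : measurableType d) d' (U : measurableType d')
    (op : U -> U -> U) (idx : U) (h : T -> mR -> U) :
  measurable_fun setT (fun p : U * U => op p.1 p.2) ->
  measurable_fun setT (fun p : T * mR => h p.1 p.2) ->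
  mseq q (fun t s => \big[op/idx]_(x <- s) h t x).
Proof.
move=> mop mh.
apply: (eq_mseq (F := fun t s => \big[op/idx]_(i <- iota 0 q) h t (nth 0 s i))).
  by move=> t s <-; rewrite [RHS](big_nth 0) /index_iota subn0.
apply: mseq_big => // i.
apply: (mseq_op2 (op := h) (F := fun t _ => t) (G := fun _ s => nth 0 s i)).
- exact: mh.
- exact: (mseq_param q (@measurable_id _ T setT)).
- exact: mseq_nth.
Qed.

End measurability_in_finitely_many_variables.

Section iterated_integrals.
Context {R : realType}.
Local Notation mR := (measurableTypeR R).
Local Notation lam := (@lebesgue_measure R).
Local Open Scope ereal_scope.
Implicit Types F G : seq R -> \bar R.

Definition in_torus (s : seq R) := all (fun t : R => (0 <= t < 1)%R) s.

Lemma torusE (t : R) : torus t = (0 <= t < 1)%R :> Prop.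
Proof. by rewrite /torus/= in_itv. Qed.

Lemma torus_integralS q F : torus_integral q.+1 F =
  \int[lam]_(t in torus) torus_integral q (fun s => F (t :: s)).
Proof. by []. Qed.

Lemma le_torus_integral q F G :
  (forall s, size s = q -> in_torus s -> 0 <= F s) ->
  (forall s, size s = q -> in_torus s -> F s <= G s) ->
  torus_integral q F <= torus_integral q G /\ 0 <= torus_integral q F.
Proof.
elim: q F G => [|q IH] F G F0 FG /=; first by split; [exact: FG|exact: F0].
have {}IH t : torus t ->
  torus_integral q (fun s => F (t :: s)) <=
  torus_integral q (fun s => G (t :: s)) /\
  0 <= torus_integral q (fun s => F (t :: s)).
  rewrite torusE => tT; apply: IH => s sq sT;
  [apply: F0|apply: FG]; rewrite /= ?sq// /in_torus/= tT; exact: sT.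
split; last by apply: integral_ge0 => t /IH[].
by apply: ge0_le_integral_nonmeas => t /IH[].
Qed.

Lemma torus_integral_ge0 q F : (forall s, 0 <= F s) -> 0 <= torus_integral q F.
Proof. by move=> F0; apply: (@le_torus_integral q F F _ _).2 => //. Qed.

Lemma eq_torus_integral q F G :
  (forall s, size s = q -> in_torus s -> F s = G s) ->
  torus_integral q F = torus_integral q G.
Proof.
elim: q F G => [|q IH] F G FG /=; first exact: FG.
apply: eq_integral => t; rewrite inE torusE => tT; apply: IH => s sq sT.
by apply: FG; rewrite /= ?sq// /in_torus/= tT.
Qed.

Lemma measurable_torus_integral q d (T : measurableType d)
    (F : T -> seq R -> \bar R) : (forall t s, 0 <= F t s) -> mseq q F ->
  measurable_fun setT (fun t => torus_integral q (F t)).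
Proof.
elim: q d T F => [|q IH] d T F F0 mF //=.
apply: (measurable_integral_torus
  (F := fun p : T * mR => torus_integral q (fun s => F p.1 (p.2 :: s)))).
- exact: IH.
- by move=> p; exact: torus_integral_ge0.
Qed.

Lemma torus_integral_swap q d (T : measurableType d)
    (m : {sigma_finite_measure set T -> \bar R}) (F : T -> seq R -> \bar R) :
  (forall t s, 0 <= F t s) -> mseq q F ->
  \int[m]_t torus_integral q (F t) = torus_integral q (fun s => \int[m]_t F t s).
Proof.
elim: q F => [|q IH] F F0 mF //=.
rewrite (torus_tonelli m
  (F := fun p : T * mR => torus_integral q (fun s => F p.1 (p.2 :: s)))).
- apply: eq_integral => x _.
  rewrite IH//; apply: (mseq_reparam (phi := fun t => (t, x : mR)) _ mF).
  exact: measurable_fun_pair.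
- exact: measurable_torus_integral.
- by move=> p; exact: torus_integral_ge0.
Qed.

(** Stated apart from [torus_integral_swap] because the variable [t] ranges over
    the circle only; the indicator function of the circle reduces it to that
    case. *)
Lemma torus_integral_swap_torus q (F : mR -> seq R -> \bar R) :
  (forall t s, 0 <= F t s) -> mseq q F ->
  \int[lam]_(t in torus) torus_integral q (F t) =
  torus_integral q (fun s => \int[lam]_(t in torus) F t s).
Proof.
move=> F0 mF; rewrite integral_mkcond.
have mpt : measurable_fun setT (\1_(torus : set mR) : mR -> mR).
  exact: (measurable_indic measurable_torus).
pose G (t : mR) s := (\1_(torus : set mR) t)%:E * F t s.
have -> : ((fun t => torus_integral q (F t)) \_ (torus : set mR)) =
    (fun t => torus_integral q (G t)).
  apply/funext => t; rewrite patchE; case: ifPn => tT.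
    by apply: eq_torus_integral => s _ _; rewrite /G indicE tT mul1e.
  rewrite (@eq_torus_integral _ _ (cst 0)); last first.
    by move=> s _ _; rewrite /G indicE (negbTE tT) mul0e.
  by apply/esym; elim: q {mF} => //= q IH; under eq_integral do rewrite IH;
    rewrite integral0.
rewrite torus_integral_swap.
- apply: eq_torus_integral => s _ _; rewrite [RHS]integral_mkcond.
  apply: eq_integral => t _; rewrite patchE /G indicE.
  by case: (t \in _); rewrite ?mul1e ?mul0e.
- by move=> t s; apply: mule_ge0 => //; rewrite lee_fin indicE.
- apply: (mseq_op2 (op := fun (a b : \bar R) => a * b)) => //.
  + exact: emeasurable_funM.
  + by apply: mseq_param; exact/measurable_EFinP.
Qed.

Lemma ge0_torus_integralZl q F k : (forall s, 0 <= F s) ->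
  mseq q (fun _ : unit => F) -> 0 <= k ->
  torus_integral q (fun s => k * F s) = k * torus_integral q F.
Proof.
move=> F0 mF k0; suff H d (T : measurableType d) (t : T) (G : T -> seq R -> \bar R) :
    (forall t s, 0 <= G t s) -> mseq q G ->
    torus_integral q (fun s => k * G t s) = k * torus_integral q (G t).
  exact: (H _ _ tt (fun _ : unit => F)).
(* In the induction, the variables that have been integrated become a
   parameter, on which the function must depend measurably. *)
elim: q d T t G {F F0 mF} => [|q IH] d T t G G0 mG //=.
under eq_integral => x _.
  rewrite (IH _ _ (t, x : mR) (fun p s => G p.1 (p.2 :: s)))//.
  over.
rewrite /= ge0_integralZl//.
- exact: measurable_torus.
- apply: measurable_funTS; apply: measurable_torus_integral => //.
  apply: (mseq_reparam (phi := fun x : mR => (t, x)) _ mG).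
  exact: measurable_fun_pair.
- by move=> x _; exact: torus_integral_ge0.
Qed.

Lemma torus_integralD q F G : (forall s, 0 <= F s) -> (forall s, 0 <= G s) ->
  mseq q (fun _ : unit => F) -> mseq q (fun _ : unit => G) ->
  torus_integral q (fun s => F s + G s) =
  torus_integral q F + torus_integral q G.
Proof.
move=> F0 G0 mF mG.
suff H d (T : measurableType d) (t : T) (F1 G1 : T -> seq R -> \bar R) :
    (forall t s, 0 <= F1 t s) -> mseq q F1 ->
    (forall t s, 0 <= G1 t s) -> mseq q G1 ->
    torus_integral q (fun s => F1 t s + G1 t s) =
    torus_integral q (F1 t) + torus_integral q (G1 t).
  exact: (H _ _ tt (fun _ : unit => F) (fun _ : unit => G)).
elim: q d T t F1 G1 {F G F0 G0 mF mG} => [|q IH] d T t F1 G1 F0 mF G0 mG //=.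
under eq_integral => x _.
  rewrite (IH _ _ (t, x : mR) (fun p s => F1 p.1 (p.2 :: s))
    (fun p s => G1 p.1 (p.2 :: s)))//.
  over.
have mI (K : T -> seq R -> \bar R) : (forall t s, 0 <= K t s) -> mseq q.+1 K ->
    measurable_fun (torus : set mR)
      (fun x : mR => torus_integral q (fun s => K t (x :: s))).
  move=> K0 /= mK; apply: measurable_funTS; apply: measurable_torus_integral => //.
  apply: (mseq_reparam (phi := fun x : mR => (t, x)) _ mK).
  exact: measurable_fun_pair.
rewrite /= ge0_integralD//.
- exact: measurable_torus.
- by move=> x _; exact: torus_integral_ge0.
- exact: mI.
- by move=> x _; exact: torus_integral_ge0.
- exact: mI.
Qed.

Lemma torus_integral0 q : torus_integral q (fun=> 0) = 0 :> \bar R.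
Proof.
by elim: q => //= q IH; under eq_integral do rewrite IH; rewrite integral0.
Qed.

Lemma torus_integral_sum q (I : eqType) (r : seq I) (F : I -> seq R -> \bar R) :
  (forall i s, 0 <= F i s) -> {in r, forall i, mseq q (fun _ : unit => F i)} ->
  torus_integral q (fun s => \sum_(i <- r) F i s) =
  \sum_(i <- r) torus_integral q (F i).
Proof.
move=> F0 mF.
suff [//] : torus_integral q (fun s => \sum_(i <- r) F i s) =
    \sum_(i <- r) torus_integral q (F i) /\
    mseq q (fun (_ : unit) s => \sum_(i <- r) F i s).
elim: r mF => [|i r IH] mF.
  split; last first.
    by apply: (eq_mseq (F := fun _ _ => 0));
      [move=> t s _; rewrite big_nil|exact: mseq_param].
  by rewrite big_nil -[RHS](torus_integral0 q); apply: eq_torus_integral => s _ _;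
    rewrite big_nil.
have mFi := mF i (mem_head _ _).
have [|IH1 IH2] := IH _.
  by move=> j jr; apply: mF; rewrite in_cons jr orbT.
split.
  rewrite big_cons -IH1 -torus_integralD//.
    by apply: eq_torus_integral => s _ _; rewrite big_cons.
  by move=> s; exact: sume_ge0.
apply: (eq_mseq (F := fun _ s => F i s + \sum_(j <- r) F j s)).
  by move=> t s _; rewrite big_cons.
apply: (mseq_op2 (op := fun u v : \bar R => u + v)) => //.
exact: emeasurable_funD.
Qed.

End iterated_integrals.

(** * Rearranging the variables of an iterated integral *)

Section rearranging_iterated_integrals.
Context {R : realType}.
Local Notation mR := (measurableTypeR R).
Local Notation lam := (@lebesgue_measure R).
Local Open Scope ereal_scope.

Definition insert (i : nat) (t : R) (s : seq R) := take i s ++ t :: drop i s.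

Lemma size_insert i t s : size (insert i t s) = (size s).+1.
Proof. by rewrite size_cat/= addnS -size_cat cat_take_drop. Qed.

Lemma nth_insert i t s j : (i <= size s)%N ->
  nth 0%R (insert i t s) j = if j == i then t else nth 0%R s (unbump i j).
Proof.
move=> si; rewrite nth_cat size_take_min (minn_idPl si) /unbump.
have [ji|ij] := ltnP j i.
  by rewrite (ltn_eqF ji) nth_take// ltnNge (ltnW ji) subn0.
have [->|ne] := eqVneq j i; first by rewrite subnn.
have {ne}ij : (i < j)%N by rewrite ltn_neqAle eq_sym ne.
by rewrite ij -(ltn_predK ij) subSn ?ltnS//= ?nth_drop ?subnKC ?subn1//;
  rewrite -ltnS (ltn_predK ij).
Qed.

Lemma mseq_insert q i d (T : measurableType d) d' (U : measurableType d')
    (F : T -> seq R -> U) : (i <= q)%N -> mseq q.+1 F ->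
  mseq q (fun (p : T * mR) s => F p.1 (insert i p.2 s)).
Proof.
move=> iq mF; apply: (mseq_subst (psi := fun p _ => p.1) mF).
- exact: (mseq_param q measurable_fst).
- by move=> t s <-; rewrite size_insert.
- move=> j; apply: (eq_mseq (F := fun (p : T * mR) s =>
    if j == i then p.2 else nth 0%R s (unbump i j))).
    by move=> t s sq; rewrite nth_insert ?sq.
  case: (j == i); last exact: mseq_nth.
  exact: (mseq_param q measurable_snd).
Qed.

Let mpair d (T : measurableType d) (t : T) :
  measurable_fun setT (fun x : mR => (t, x)).
Proof. exact: measurable_fun_pair. Qed.

Let mcons q d (T : measurableType d) (t : T) d' (U : measurableType d')
  (F : T -> seq R -> U) : mseq q.+1 F ->
  mseq q (fun (x : mR) s => F t (x :: s)).
Proof. by move=> /= mF; exact: (mseq_reparam (mpair t) mF). Qed.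

(** Tonelli's theorem: the variable of any rank can be integrated first. *)
Lemma torus_integral_insert q i d (T : measurableType d) (t : T)
    (F : T -> seq R -> \bar R) : (i <= q)%N -> (forall t s, 0 <= F t s) ->
  mseq q.+1 F ->
  torus_integral q.+1 (F t) =
  torus_integral q (fun s => \int[lam]_(x in torus) F t (insert i x s)).
Proof.
elim: i q d T t F => [|i IH] q d T t F iq F0 mF.
  rewrite /= (torus_integral_swap_torus (F := fun x s => F t (x :: s)))//.
    by apply: eq_torus_integral => s _ _; rewrite /insert take0 drop0.
  exact: mcons.
case: q iq mF => // q iq mF.
rewrite [LHS]/= [RHS]/=; apply: eq_integral => x _.
exact: (IH q _ _ (t, x : mR) (fun p s => F p.1 (p.2 :: s))).
Qed.

(** Here the variable of rank [i] is integrated last. *)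
Lemma torus_integral_insert_front q i d (T : measurableType d) (t : T)
    (F : T -> seq R -> \bar R) : (i <= q)%N -> (forall t s, 0 <= F t s) ->
  mseq q.+1 F ->
  torus_integral q.+1 (F t) =
  \int[lam]_(x in torus) torus_integral q (fun s => F t (insert i x s)).
Proof.
move=> iq F0 mF; rewrite (torus_integral_insert t iq F0 mF).
rewrite (torus_integral_swap_torus (F := fun x s => F t (insert i x s)))//.
exact: (mseq_reparam (mpair t) (mseq_insert iq mF)).
Qed.

Lemma mseq_map_nth q p d (T : measurableType d) d' (U : measurableType d')
    (F : T -> seq R -> U) : mseq (size p) F ->
  mseq q (fun t s => F t (map (nth 0%R s) p)).
Proof.
move=> mF; apply: (mseq_subst (psi := fun t _ => t) mF).
- exact: (mseq_param q (@measurable_id _ T setT)).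
- by move=> t s _; rewrite size_map.
- move=> i; have [ip|pi] := ltnP i (size p); last first.
    apply: (eq_mseq (F := fun (_ : T) _ => 0%R : mR)); last exact: mseq_param.
    by move=> t s _; rewrite nth_default// size_map.
  apply: (eq_mseq (F := fun (_ : T) s => nth 0%R s (nth 0%N p i) : mR)).
    by move=> t s _; rewrite (nth_map 0%N).
  exact: mseq_nth.
Qed.

(** By induction, the variable that comes first after the permutation being brought
    to the front by [torus_integral_insert_front]. *)
Lemma torus_integral_perm q p d (T : measurableType d) (t : T)
    (F : T -> seq R -> \bar R) : perm_eq p (iota 0 q) ->
  (forall t s, 0 <= F t s) -> mseq q F ->
  torus_integral q (fun s => F t (map (nth 0%R s) p)) = torus_integral q (F t).
Proof.
elim: q p d T t F => [|q IH] p d T t F pq F0 mF.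
  by move/perm_nilP : pq => ->.
case: p pq => [/perm_size//|i p] pq.
have iq : (i <= q)%N.
  have : i \in iota 0 q.+1 by rewrite -(perm_mem pq) mem_head.
  by rewrite mem_iota.
have {}pq : perm_eq p (map (bump i) (iota 0 q)).
  rewrite -(perm_cons i); apply: (perm_trans pq); apply: uniq_perm.
  - exact: iota_uniq.
  - rewrite /= map_inj_uniq ?iota_uniq ?andbT; last exact: can_inj (bumpK i).
    by apply/mapP => -[j _]; apply/eqP; rewrite neq_bump.
  - move=> j; rewrite mem_iota/= in_cons; have [->|ji] := eqVneq j i.
      by rewrite ltnS.
    apply/idP/mapP => [jq|[k]]; last first.
      by rewrite mem_iota/= => kq ->; rewrite /bump; case: (i <= k)%N => //; lia.
    exists (unbump i j); last by rewrite unbumpKcond (negbTE ji).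
    by rewrite mem_iota/= /unbump; case: (ltnP i j) => /=; lia.
have ip : i \notin p.
  rewrite (perm_mem pq); apply/mapP => -[j _]; apply/eqP.
  by rewrite neq_bump.
have pq' : perm_eq (map (unbump i) p) (iota 0 q).
  rewrite -[iota 0 q](mapK (bumpK i)); exact: perm_map.
have sp : size (i :: p) = q.+1.
  by rewrite /= (perm_size pq) size_map size_iota.
rewrite (@torus_integral_insert_front q i d T t
  (fun t s => F t (map (nth 0%R s) (i :: p))))//; last by apply: mseq_map_nth; rewrite sp.
rewrite [RHS]/=; apply: eq_integral => x _.
rewrite -(IH (map (unbump i) p) _ _ (t, x : mR) (fun p s => F p.1 (p.2 :: s)))//.
apply: eq_torus_integral => s sq _; rewrite /= nth_insert ?sq// eqxx -map_comp.
congr (F _ (_ :: _)); apply/eq_in_map => j jp /=.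
rewrite nth_insert ?sq// ifF//; apply: contraNF ip => /eqP <-//.
Qed.

(** The points of the circle obtained from [y] by the successive jumps [s]. This
    change of coordinates replaces the points by the gaps between them. *)
Fixpoint chain (y : R) (s : seq R) : seq R :=
  if s is g :: s' then mod1 (y + g)%R :: chain (mod1 (y + g)%R) s' else [::].

Lemma size_chain y s : size (chain y s) = size s.
Proof. by elim: s y => //= g s IH y; rewrite IH. Qed.

(** Each point is the translate by the previous one of a jump that is uniform on the
    circle, so the passage from jumps to points preserves the integral. *)
Lemma torus_integral_chain q y d (T : measurableType d) (t : T)
    (F : T -> seq R -> \bar R) :
  (forall t s, 0 <= F t s) -> mseq q F ->
  torus_integral q (fun s => F t (chain y s)) = torus_integral q (F t).
Proof.
elim: q y d T t F => [|q IH] y d T t F F0 mF //=.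
rewrite -(torus_translation y (F := fun x => torus_integral q (fun s => F t (x :: s)))).
- apply: eq_integral => x _.
  exact: (IH _ _ _ (t, mod1 (y + x)%R : mR) (fun p s => F p.1 (p.2 :: s))).
- by apply: measurable_torus_integral => //; exact: mcons.
- by move=> x; exact: torus_integral_ge0.
Qed.

(** Tonelli's theorem for a product of functions of complementary sets of
    variables. It separates the two classes of gaps of a configuration, and it
    merges the square of an integral into one integral over twice as many
    variables. *)
Lemma torus_integral_mask b d (T : measurableType d) (t : T)
    (f g : T -> seq R -> \bar R) :
  (forall t s, 0 <= f t s) -> (forall t s, 0 <= g t s) ->
  mseq (count id b) f -> mseq (count negb b) g ->
  torus_integral (size b) (fun s => f t (mask b s) * g t (mask (map negb b) s)) =
  torus_integral (count id b) (f t) * torus_integral (count negb b) (g t).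
Proof.
elim: b d T t f g => [|[] b IH] d T t f g f0 g0 mf mg //=.
- have mg' : mseq (count negb b) (fun p : T * mR => g p.1).
    exact: mseq_reparam mg.
  under eq_integral => x _.
    rewrite (IH _ _ (t, x : mR) (fun p s => f p.1 (p.2 :: s)) (fun p s => g p.1 s))//.
    over.
  rewrite /= ge0_integralZr//.
  + exact: measurable_torus.
  + apply: measurable_funTS; apply: measurable_torus_integral => //.
    exact: mcons.
  + by move=> x _; exact: torus_integral_ge0.
  + exact: torus_integral_ge0.
- have mf' : mseq (count id b) (fun p : T * mR => f p.1).
    exact: mseq_reparam mf.
  under eq_integral => x _.
    rewrite (IH _ _ (t, x : mR) (fun p s => f p.1 s) (fun p s => g p.1 (p.2 :: s)))//.
    over.
  rewrite /= ge0_integralZl//.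
  + exact: measurable_torus.
  + apply: measurable_funTS; apply: measurable_torus_integral => //.
    exact: mcons.
  + by move=> x _; exact: torus_integral_ge0.
  + exact: torus_integral_ge0.
Qed.

(** A contraction maps the unit cube into itself. *)
Lemma torus_integral_scaling q (r : R) d (T : measurableType d) (t : T)
    (F : T -> seq R -> \bar R) :
  (0 < r <= 1)%R -> (forall t s, 0 <= F t s) -> mseq q F ->
  (r ^+ q)%:E * torus_integral q (fun s => F t (map ( *%R r) s)) <=
  torus_integral q (F t).
Proof.
move=> r01; elim: q d T t F => [|q IH] d T t F F0 mF /=.
  by rewrite expr0 mul1e.
have r0 : (0 <= r)%R by lra.
have mF1 : measurable_fun setT (fun x : mR => torus_integral q (fun s => F t (x :: s))).
  by apply: measurable_torus_integral => //; exact: mcons.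
have F1 x : 0 <= torus_integral q (fun s => F t (x :: s)).
  exact: torus_integral_ge0.
apply: le_trans (torus_scaling mF1 F1 r01).
rewrite exprS EFinM -muleA; apply: lee_wpmul2l; first by rewrite lee_fin.
have mrF : mseq q.+1 (fun t s => F t (map ( *%R r) s)).
  apply: (mseq_subst (psi := fun t _ => t) mF).
  - exact: (mseq_param q.+1 (@measurable_id _ T setT)).
  - by move=> _ s; rewrite size_map.
  - move=> i; apply: (eq_mseq (F := fun (_ : T) s => (r * nth 0 s i)%R : mR)).
      move=> _ s _; have [si|si] := ltnP i (size s); first by rewrite (nth_map 0%R).
      by rewrite !nth_default ?size_map// mulr0.
    apply: (@mseq_post _ q.+1 _ T _ mR _ mR ( *%R r)); last exact: mseq_nth.
    exact: measurable_funM.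
rewrite -ge0_integralZl//.
- apply: ge0_le_integral_nonmeas => x _.
    by apply: mule_ge0; [rewrite lee_fin exprn_ge0|exact: torus_integral_ge0].
  exact: (IH _ _ (t, (r * x)%R : mR) (fun p s => F p.1 (p.2 :: s))).
- exact: measurable_torus.
- apply: measurable_funTS; apply: measurable_torus_integral => //.
  by have := mcons t mrF.
- by move=> x _; exact: torus_integral_ge0.
- by rewrite lee_fin exprn_ge0.
Qed.

End rearranging_iterated_integrals.

(** * Distance to the integers *)

Section distance_to_the_integers.
Context {R : realType}.
Local Notation mR := (measurableTypeR R).
Local Notation lam := (@lebesgue_measure R).
Implicit Types (t x e : R).

Lemma tnorm_le t (n : int) : tnorm t <= `|t - n%:~R|.
Proof.
apply: ge_inf; last by exists n.
by exists 0 => _ [m _ <-].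
Qed.

Lemma tnormE t : tnorm t = Num.min (mod1 t) (1 - mod1 t).
Proof.
have m0 := mod1_ge0 t; have m1 := mod1_lt1 t.
apply/eqP; rewrite eq_le; apply/andP; split.
  rewrite le_min; apply/andP; split.
    by apply: (le_trans (tnorm_le _ (Num.floor t))); rewrite -/(mod1 t) ger0_norm.
  apply: (le_trans (tnorm_le _ (Num.floor t + 1))).
  by rewrite intrD opprD addrA -/(mod1 t) ler0_norm /=; lra.
apply: lb_le_inf; first by exists `|t - 0%:~R|, 0.
move=> _ [n _ <-].
have -> : t - n%:~R = mod1 t + (Num.floor t - n)%:~R.
  by rewrite /mod1 intrB; lra.
set k := _ - n; have [k0|k0] := leP 0 k.
  rewrite ger0_norm; last by rewrite addr_ge0// ler0z.
  by rewrite ge_min lerDl ler0z k0.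
have {}k0 : k%:~R <= -1 :> R by rewrite -[-1]/((-1)%:~R) ler_int; lia.
by rewrite ler0_norm; [rewrite ge_min; apply/orP; right; lra|lra].
Qed.

Lemma tnormDz t (z : int) : tnorm (t + z%:~R) = tnorm t.
Proof. by rewrite !tnormE mod1Dz. Qed.

Lemma tnormN t : tnorm (- t) = tnorm t.
Proof.
suff H x : tnorm (- x) <= tnorm x.
  by apply/eqP; rewrite eq_le H/= -{1}[t]opprK H.
apply: lb_le_inf; first by exists `|x - 0%:~R|, 0.
move=> _ [n _ <-]; apply: (le_trans (tnorm_le _ (- n))).
by rewrite mulrNz -opprD normrN.
Qed.

Lemma tnorm_near t e : tnorm t <= e -> exists n : int, `|t - n%:~R| <= e.
Proof.
have m0 := mod1_ge0 t; have m1 := mod1_lt1 t.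
rewrite tnormE ge_min => /orP[te|te].
  by exists (Num.floor t); rewrite -/(mod1 t) ger0_norm.
exists (Num.floor t + 1); rewrite intrD opprD addrA -/(mod1 t).
by rewrite ler0_norm /=; lra.
Qed.

Lemma measurable_tnorm : measurable_fun setT (tnorm : mR -> mR).
Proof.
rewrite (_ : tnorm = fun t => Num.min (mod1 t) (1 - mod1 t)); last first.
  by apply/funext => t; rewrite tnormE.
by apply: measurable_minr; [|apply: measurable_funB => //]; exact: measurable_mod1.
Qed.

(** Lifts to the line of the maps of the circle that rotate at constant integer
    speed [D]. *)
Definition affine_mod1 (D : int) (f : R -> R) :=
  exists B : R, forall t, exists z : int, f t = B + D%:~R * t + z%:~R.

Lemma affine_mod1N D f : affine_mod1 D f -> affine_mod1 (- D) (fun t => - f t).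
Proof.
move=> [B H]; exists (- B) => t; have [z ->] := H t; exists (- z).
by rewrite !mulrNz mulNr !opprD.
Qed.

Local Open Scope ereal_scope.

Lemma integral_bool_le (D A : set mR) (u : R -> bool) : measurable D ->
  measurable A -> (forall t, D t -> u t -> A t) ->
  \int[lam]_(t in D) ((u t)%:R)%:E <= lam A.
Proof.
move=> mD mA uA; apply: (@le_trans _ _ (\int[lam]_(t in D) (\1_A t)%:E)).
  apply: ge0_le_integral_nonmeas => t Dt; first by rewrite lee_fin.
  rewrite lee_fin indicE ler_nat; case ut : (u t) => //.
  by rewrite mem_set//; exact: uA.
by rewrite integral_indic// le_measure// ?inE//; exact: measurableI.
Qed.

(** A rotation of nonzero integer speed [D] preserves the Haar measure, which
    suggests the bound [2 * e]; the cruder factor [6] comes from counting all the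
    integers that [f] can approach while [t] runs once around the circle. *)
Lemma integral_affine_near_integer (D : int) (f : R -> R) (e : R) :
  affine_mod1 D f -> D != 0%R -> (0 < e)%R ->
  \int[lam]_(t in torus) ((tnorm (f t) <= e)%R%:R)%:E <= (6 * e)%:E.
Proof.
(* Replacing f by its opposite makes the speed positive. *)
wlog : D f / (0 < D)%R.
  move=> H aD D0 e0; case: (ltrgtP D 0%R) D0 => // D0 _; last by apply: (H D) => //; rewrite gt_eqF.
  under eq_integral do rewrite -tnormN.
  apply: (H (- D)%R (fun t => - f t)%R) => //; first by rewrite oppr_gt0.
    exact: affine_mod1N.
  by rewrite oppr_eq0 lt_eqF.
move=> D0 [B fB] _ e0.
have [e1|e1] := leP 1%R (6 * e)%R.
  apply: (@le_trans _ _ (lam torus)).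
    by apply: (integral_bool_le measurable_torus measurable_torus).
  by rewrite lebesgue_torus lee_fin.
case: D D0 fB => // D; rewrite ltz_nat => D0 fB.
have D0' : (0 < D%:R :> R)%R by rewrite ltr0n.
(* On [0, 1) the function f runs over an interval of length D, which comes
   close to at most D + 2 integers; c j / D is the time at which f meets the
   integer of index j. *)
pose c (j : nat) : R := ((Num.floor B)%:~R + j%:R - B)%R.
pose I j : set mR := `[((c j - e) / D%:R)%R, ((c j + e) / D%:R)%R]%classic.
have mI j : measurable (I j) by exact: measurable_itv.
apply: (@le_trans _ _ (lam (\big[setU/set0]_(j < D.+2) I j))).
  apply: integral_bool_le; [exact: measurable_torus|exact: bigsetU_measurable|].
  move=> t; rewrite torusE => /andP[t0 t1] te.
  have [z fz] := fB t; move: te; rewrite fz tnormDz => /tnorm_near[n ne].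
  have /andP[fl1 fl2] := floor_itv B; rewrite intrD in fl2.
  have Dt0 : (0 <= D%:R * t :> R)%R by rewrite mulr_ge0// ltW.
  have Dt1 : (D%:R * t < D%:R :> R)%R by rewrite gtr_pMr.
  move: ne; rewrite ler_norml => /andP[n1 n2].
  have nl : (Num.floor B <= n)%R.
    rewrite -ltzD1 -(ltr_int R) intrD /=; move: n1 n2; rewrite -[D%:~R]/(D%:R); lra.
  have nu : (n < Num.floor B + D.+2%:Z)%R.
    rewrite -(ltr_int R) intrD -[D.+2%:~R]/(D.+2%:R) -addn2 natrD.
    move: n1 n2; rewrite -[D%:~R]/(D%:R); lra.
  rewrite -bigcup_mkord; exists `|n - Num.floor B|%N => /=; first lia.
  have cn : c `|n - Num.floor B|%N = (n%:~R - B)%R.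
    rewrite /c -[(`|_|%N)%:R]/((`|_|%N)%:~R) gez0_abs ?subr_ge0// intrB; lra.
  rewrite /I/= in_itv/= cn ler_pdivrMr// ler_pdivlMr//.
  move: n1 n2; rewrite -[D%:~R]/(D%:R); lra.
apply: (@le_trans _ _ (\sum_(j < D.+2) lam (I j))).
  by apply: Boole_inequality => j _; exact: mI.
rewrite (eq_bigr (fun=> (2 * e / D%:R)%:E)); last first.
  move=> j _; rewrite /I lebesgue_measure_itv/= lte_fin ltr_pM2r ?invr_gt0//.
  have -> : (c j - e < c j + e)%R by lra.
  by rewrite -EFinD -mulrBl; congr EFin; congr (_ / _)%R; lra.
rewrite sumEFin lee_fin sumr_const card_ord -[(_ *+ _)%R]mulr_natr mulrAC.
rewrite ler_pdivrMr// -addn2 natrD.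
have D1 : (1 <= D%:R :> R)%R by rewrite ler1n.
nra.
Qed.

End distance_to_the_integers.

(** * Cutting a cycle of points *)

Section cutting_a_cycle_of_gaps.
Context {R : realType}.
Local Notation mR := (measurableTypeR R).
Local Notation lam := (@lebesgue_measure R).

Definition lincomb (a : seq int) (x : seq R) : R :=
  \sum_(p <- zip a x) p.1%:~R * p.2.

Definition signs (a : seq int) := all (fun z : int => `|z|%N == 1%N) a.

Lemma lincombE a x : size a = size x ->
  lincomb a x = \sum_(i <- iota 0 (size x)) (nth 0 a i)%:~R * nth 0 x i.
Proof.
move=> ax; rewrite /lincomb (big_nth (0, 0)) size_zip ax minnn /index_iota subn0.
by apply: eq_bigr => i _; rewrite nth_zip.
Qed.

Lemma lincomb_perm a x p : size a = size x -> perm_eq p (iota 0 (size x)) ->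
  lincomb (map (nth 0 a) p) (map (nth 0 x) p) = lincomb a x.
Proof.
move=> ax px; rewrite (lincombE ax) -(perm_big _ px) /lincomb zip_map big_map.
by [].
Qed.

(** A sum of signs has the parity of the number of its terms. *)
Lemma sum_signs_odd (a : seq int) : signs a -> odd (size a) ->
  \sum_(z <- a) z != 0.
Proof.
move=> sa oa; suff [k ->] : exists k : int, \sum_(z <- a) z = k *+ 2 + (size a)%:Z.
  by move: oa; lia.
elim: a sa {oa} => [|z a IH] /=; first by exists 0; rewrite big_nil.
move=> /andP[z1 /IH[k E]]; rewrite big_cons E.
have [->|->] : z = 1 \/ z = -1 by move: z1; lia.
  by exists k; lia.
by exists (k - 1); lia.
Qed.

Lemma affine_mod1_translate D (f : R -> R) (u : R) :
  affine_mod1 D f -> affine_mod1 D (fun t => u + f t).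
Proof.
move=> [B H]; exists (u + B) => t; have [z ->] := H t; exists z.
by rewrite !addrA.
Qed.

Lemma affine_mod1_jump (f : R -> R) (u : R) :
  affine_mod1 1 f -> affine_mod1 1 (fun t => mod1 (f t + u)).
Proof.
move=> [B H]; exists (B + u) => t; have [z ->] := H t.
exists (z - Num.floor (B + 1%:~R * t + z%:~R + u)).
by rewrite /mod1 intrB; ring.
Qed.

(** When the starting point moves at speed one, so do all the points of the chain. *)
Lemma affine_mod1_lincomb a s (f : R -> R) : size a = size s ->
  affine_mod1 1 f ->
  affine_mod1 (\sum_(z <- a) z) (fun t => lincomb a (chain (f t) s)).
Proof.
elim: s a f => [|g s IH] [|c a] f //= => [_ _|[sa] af].
  exists 0 => t; exists 0; rewrite /lincomb/= !big_nil; ring.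
have af' := affine_mod1_jump g af.
have [B HB] := IH a _ sa af'; have [B' HB'] := af'.
rewrite big_cons; exists (c%:~R * B' + B) => t.
have [z1 E1] := HB t; have [z2 E2] := HB' t.
exists (c * z2 + z1); rewrite /lincomb/= big_cons/= -/(lincomb _ _) E1.
by rewrite E2 !intrD !intrM; ring.
Qed.

(** Widening the jump of rank [i] while the other jumps stay fixed rotates rigidly
    the points from rank [i] on, whose coefficients add up to the speed. *)
Lemma affine_mod1_chain_insert a s i y : size a = (size s).+1 ->
  (i <= size s)%N ->
  affine_mod1 (\sum_(z <- drop i a) z)
    (fun t => lincomb a (chain y (insert i t s))).
Proof.
elim: i a s y => [|i IH] [|c a] s y //= [sa] si.
  have af : affine_mod1 1 (fun t => mod1 (t + y)).
    by apply: (@affine_mod1_jump id); exists 0 => t; exists 0; rewrite add0r mul1r addr0.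
  have [B HB] := affine_mod1_lincomb sa af; have [B' HB'] := af.
  rewrite big_cons; exists (c%:~R * B' + B) => t.
  have [z1 E1] := HB t; have [z2 E2] := HB' t.
  exists (c * z2 + z1); rewrite /insert take0 drop0 /lincomb/= big_cons/=.
  rewrite -/(lincomb _ _) [y + t]addrC E1.
  by rewrite E2 !intrD !intrM; ring.
case: s sa si => // g s sa si.
rewrite /lincomb /=; have := IH a s (mod1 (y + g)) sa si.
move=> /(affine_mod1_translate (c%:~R * mod1 (y + g))); congr affine_mod1.
by apply/funext => t; rewrite big_cons.
Qed.

Definition edges (y : seq R) : seq R :=
  pairmap (fun u v => mod1 (v - u)) (head 0 y) (behead y).

Lemma edges_chain y s : in_torus s -> edges (y :: chain y s) = s.
Proof.
rewrite /edges/=; elim: s y => //= g s IH y /andP[g01 sT].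
rewrite [X in _ :: X]IH//; congr cons.
by rewrite mod1Dl addrAC subrr add0r mod1_id.
Qed.

Definition del (i : nat) {T} (s : seq T) := take i s ++ drop i.+1 s.

Lemma del_insert i t (s : seq R) : (i <= size s)%N -> del i (insert i t s) = s.
Proof.
move=> si; rewrite /del /insert.
rewrite take_size_cat ?size_takel// drop_cat size_takel// ltnNge leqnSn/=.
by rewrite subSnn/= drop0 cat_take_drop.
Qed.

(** The combinatorial heart of the proof. Among the [2d + 1] gaps [es] of a cycle
    that has been cut open, those of even rank are one more than those of odd
    rank; the widest gap [t] of even rank is removed, and the mask [b] selects the
    gaps of odd rank among the others. That [i] is even makes odd the number of
    points beyond the gap removed, which [integral_cut_weight] uses; that both
    classes have [d] elements lets each of them pair with one of the two cuts. *)
Lemma widest_even_gap d (es : seq R) : size es = d.*2.+1 ->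
  exists i t s b, [/\ es = insert i t s, (i <= size s)%N /\ ~~ odd i,
    size b = size s, count id b = d &
    all (fun e => e <= t) (mask (map negb b) s)].
Proof.
move=> ses.
suff: exists s1 t s2 b1 b2, [/\ es = s1 ++ t :: s2, ~~ odd (size s1),
    size b1 = size s1 /\ size b2 = size s2, (count id b1 + count id b2 = d)%N &
    all (fun e => e <= t) (mask (map negb b1) s1) &&
    all (fun e => e <= t) (mask (map negb b2) s2)].
  move=> [s1 [t [s2 [b1 [b2 [-> odd1 [sb1 sb2] cb ale]]]]]].
  exists (size s1), t, (s1 ++ s2), (b1 ++ b2); split.
  - by rewrite /insert take_size_cat// drop_size_cat.
  - by rewrite size_cat leq_addr.
  - by rewrite !size_cat sb1 sb2.
  - by rewrite count_cat.
  - by rewrite map_cat mask_cat ?size_map// all_cat.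
(* Two gaps x, y are added in front: the widest gap of even rank is either x or
   the one found among the remaining gaps, whose ranks keep their parity. *)
elim: d es ses => [|d IH] es.
  case: es => // t [|//] _; exists [::], t, [::], [::], [::].
  by split.
case: es => // x [|y es]//; rewrite doubleS => -[ses].
have [s1 [t [s2 [b1 [b2 [-> odd1 [sb1 sb2] cb /andP[al1 al2]]]]]]] := IH _ ses.
have [xt|tx] := leP x t.
  exists (x :: y :: s1), t, s2, (false :: true :: b1), b2; split => //=.
  - by rewrite negbK.
  - by rewrite sb1.
  - by rewrite add0n add1n addSn cb.
  - by rewrite xt al1 al2.
exists [::], x, (y :: s1 ++ t :: s2), [::], (true :: b1 ++ false :: b2).
split => //=.
- by rewrite !size_cat/= sb1 sb2.
- by rewrite add0n add1n count_cat /= add0n cb.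
- rewrite map_cat/= mask_cat ?size_map// all_cat/= (ltW tx)/=.
  apply/andP; split.
    by apply: sub_all al1 => e /le_trans; apply; exact: ltW.
  by apply: sub_all al2 => e /le_trans; apply; exact: ltW.
Qed.

End cutting_a_cycle_of_gaps.

(** * The weight of a configuration with two cuts *)

Section gap_weights.
Context {R : realType}.
Local Notation mR := (measurableTypeR R).
Local Notation lam := (@lebesgue_measure R).

Section mseq_of_sequences.
Context d (T : measurableType d) d' (U : measurableType d').
Implicit Types F : T -> seq R -> U.

Lemma mask_map_nth b (s : seq R) : 
  mask b s = map (nth 0 s) (mask b (iota 0 (size s))).
Proof. by rewrite map_mask -[X in mask b X = _](mkseq_nth 0). Qed.

Lemma mseq_mask b F : mseq (count id b) F ->
  mseq (size b) (fun t s => F t (mask b s)).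
Proof.
move=> mF; apply: (eq_mseq (F := fun t s =>
    F t (map (nth 0 s) (mask b (iota 0 (size b)))))).
  by move=> t s sb; rewrite [in RHS]mask_map_nth sb.
by apply: mseq_map_nth; rewrite size_mask ?size_iota.
Qed.

Lemma mseq_del q i F : (i <= q)%N -> mseq q F ->
  mseq q.+1 (fun t s => F t (del i s)).
Proof.
move=> iq mF; apply: (eq_mseq (F := fun t s =>
    F t (map (nth 0 s) (del i (iota 0 q.+1))))).
  move=> t s sq; rewrite /del map_cat map_take map_drop -sq -/(mkseq _ _).
  by rewrite mkseq_nth.
apply: mseq_map_nth; rewrite /del size_cat size_take_min size_drop size_iota.
by rewrite (_ : (_ + _)%N = q)//; lia.
Qed.

Lemma mseq_edges q F : mseq q F -> mseq q.+1 (fun t s => F t (edges s)).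
Proof.
move=> mF; apply: (mseq_subst (psi := fun t _ => t) mF).
- exact: (mseq_param q.+1 (@measurable_id _ T setT)).
- by move=> t s sq; rewrite size_pairmap size_behead sq.
- move=> i; have [iq|qi] := ltnP i q; last first.
    apply: (eq_mseq (F := fun (_ : T) _ => 0 : mR)); last exact: mseq_param.
    by move=> t s sq; rewrite nth_default// size_pairmap size_behead sq.
  apply: (eq_mseq (F := fun (_ : T) s => mod1 (nth 0 s i.+1 - nth 0 s i) : mR)).
    move=> t [//|x s] [sq]; rewrite /edges/= (nth_pairmap 0)//=; by rewrite sq.
  apply: (mseq_op2 (op := fun u v : mR => mod1 (u - v) : mR));
    [|exact: mseq_nth..].
  by apply: measurableT_comp; [exact: measurable_mod1|exact: measurable_funB].
Qed.

Lemma mseq_chain q y F : mseq q F -> mseq q (fun t s => F t (chain y s)).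
Proof.
move=> mF; apply: (mseq_subst (psi := fun t _ => t) mF).
- exact: (mseq_param q (@measurable_id _ T setT)).
- by move=> t s; rewrite size_chain.
- move=> i; suff H d1 (T1 : measurableType d1) (h : T1 -> mR) :
      measurable_fun setT h -> mseq q (fun t s => nth 0 (chain (h t) s) i : mR).
    exact: (H _ _ (fun=> y)).
  elim: q i d1 T1 h {mF} => [|q IH] i d1 T1 h mh /=; first exact: measurable_cst.
  have mh' : measurable_fun setT (fun p : T1 * mR => mod1 (h p.1 + p.2) : mR).
    apply: measurableT_comp; first exact: measurable_mod1.
    by apply: measurable_funD => //; exact: measurableT_comp.
  case: i => [|i]; first exact: (mseq_param q mh').
  exact: (IH i _ _ _ mh').
Qed.

End mseq_of_sequences.

Lemma mseq_section q d (T : measurableType d) d' (U : measurableType d')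
    (F : T -> seq R -> U) s : size s = q -> mseq q F ->
  measurable_fun setT (F ^~ s).
Proof.
elim: s q d T F => [|x s IH] [|q] d T F //= [sq] mF.
have H := IH q _ _ (fun (p : T * mR) s => F p.1 (p.2 :: s)) sq mF.
have mx : measurable_fun setT (fun t : T => (t, x : mR)).
  exact: measurable_fun_pair.
exact: (measurableT_comp H mx).
Qed.

Lemma mseq_lincomb q a : size a = q -> mseq q (fun (_ : unit) s => lincomb a s : mR).
Proof.
move=> <-; apply: (eq_mseq (F := fun (_ : unit) s =>
    \sum_(i <- iota 0 (size a)) (nth 0 a i)%:~R * nth 0 s i : mR)).
  by move=> _ s sa; rewrite lincombE ?sa.
apply: mseq_big => [|i]; first exact: measurable_funD.
apply: (@mseq_post _ _ _ _ _ mR _ mR ( *%R (nth 0 a i)%:~R)); last exact: mseq_nth.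
exact: measurable_funM.
Qed.

Lemma mseq_near_integer q a (e : R) : size a = q ->
  mseq q (fun (_ : unit) s => (tnorm (lincomb a s) <= e)%R%:R : mR).
Proof.
move=> aq; apply: (@mseq_post _ q _ unit _ mR _ mR
    (fun x => (tnorm x <= e)%R%:R) (fun _ s => lincomb a s)); last exact: mseq_lincomb.
rewrite (_ : (fun x : mR => _) = \1_((tnorm : mR -> mR) @^-1` `]-oo, e])); last first.
  apply/funext => x; rewrite indicE; congr ((nat_of_bool _)%:R); apply/idP/idP.
    by move=> xe; rewrite mem_set//= in_itv.
  by move/set_mem; rewrite /= in_itv.
apply: measurable_indic; rewrite -[X in measurable X]setTI.
by apply: measurable_tnorm => //; exact: measurable_itv.
Qed.

Variable kappa : R -> R.
Hypothesis kappa_anti : forall x y, x <= y -> kappa y <= kappa x.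
Hypothesis kappa_ge0 : forall x, 0 <= kappa x.

(** The product of the weights of the gaps [s] with one more factor, the weight
    of the widest of them: [kappa] being nonincreasing, that weight is the least.
    The neutral value [kappa 0] bounds all the weights of nonnegative gaps. *)
Definition gap_weight (s : seq R) : R :=
  (\prod_(t <- s) kappa t) * \big[Num.min/kappa 0]_(t <- s) kappa t.

Lemma gap_weight_ge0 s : 0 <= gap_weight s.
Proof.
apply: mulr_ge0; first by apply: prodr_ge0.
by elim/big_rec: _ => // t x _ x0; rewrite le_min x0 kappa_ge0.
Qed.

Lemma measurable_kappa : measurable_fun setT (kappa : mR -> mR).
Proof. by apply: nonincreasing_measurable => // x y _ _; exact: kappa_anti. Qed.

Lemma mseq_gap_weight q : mseq q (fun (_ : unit) s => gap_weight s : mR).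
Proof.
have mk : measurable_fun setT (fun p : unit * mR => kappa p.2 : mR).
  exact: (measurableT_comp measurable_kappa measurable_snd).
apply: (mseq_op2 (op := fun u v : mR => u * v : mR)).
- exact: measurable_funM.
- by apply: mseq_big_seq => //; exact: measurable_funM.
- by apply: mseq_big_seq => //; exact: measurable_minr.
Qed.

(** The bound used for a configuration [y] cut at the gap that closes the cycle and
    at the gap of rank [i], when the mask [b] gives the two classes of remaining
    gaps, under the constraint with coefficients [a] at scale [e]. *)
Definition cut_weight (a : seq int) (e : R) (i : nat) (b : bitseq) (y : seq R) : R :=
  gap_weight (mask b (del i (edges y))) *
  gap_weight (mask (map negb b) (del i (edges y))) *
  (tnorm (lincomb a y) <= e)%R%:R.

Lemma cut_weight_ge0 a e i b y : 0 <= cut_weight a e i b y.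
Proof. by apply: mulr_ge0 => //; apply: mulr_ge0; exact: gap_weight_ge0. Qed.

Section cut.
Variables (d : nat) (a : seq int) (e : R) (i : nat) (b : bitseq).
Hypotheses (sa : size a = d.*2.+2) (siga : signs a) (e0 : 0 < e).
Hypotheses (id2 : (i <= d.*2)%N) (ei : ~~ odd i).
Hypotheses (sb : size b = d.*2) (cb : count id b = d).

Let cnb : count negb b = d.
Proof.
have := count_predC id b; rewrite cb sb (eq_count (a2 := negb))//; lia.
Qed.

Lemma mseq_cut_weight :
  mseq d.*2.+2 (fun (_ : unit) y => (cut_weight a e i b y)%:E).
Proof.
apply: (@mseq_post _ _ _ _ _ mR _ _ EFin); first exact: EFin_measurable.
apply: (mseq_op2 (op := fun u v : mR => u * v : mR)).
- exact: measurable_funM.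
- apply: (mseq_edges (F := fun (_ : unit) s => gap_weight (mask b (del i s)) *
    gap_weight (mask (map negb b) (del i s)) : mR)).
  apply: (mseq_del (F := fun (_ : unit) s => gap_weight (mask b s) *
    gap_weight (mask (map negb b) s) : mR)) => //.
  apply: (mseq_op2 (op := fun u v : mR => u * v : mR)).
  + exact: measurable_funM.
  + by rewrite -sb; apply: (mseq_mask (F := fun (_ : unit) s => gap_weight s : mR));
      exact: mseq_gap_weight.
  + rewrite -sb -(size_map negb).
    by apply: (mseq_mask (F := fun (_ : unit) s => gap_weight s : mR));
      exact: mseq_gap_weight.
- exact: mseq_near_integer.
Qed.

Local Open Scope ereal_scope.

(** Rotating rigidly the points on one side of the cut changes the constrained
    sum with a slope that is a sum of an odd number of signs, hence is not zero;
    the constraint costs a factor of order [e], and the two classes of remaining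
    gaps are independent. *)
Lemma integral_cut_weight :
  torus_integral d.*2.+2 (fun y => (cut_weight a e i b y)%:E) <=
  (6 * e)%:E * (torus_integral d (fun s => (gap_weight s)%:E) *
                torus_integral d (fun s => (gap_weight s)%:E)).
Proof.
set J := torus_integral d _; have J0 : 0 <= J.
  by apply: torus_integral_ge0 => s; rewrite lee_fin gap_weight_ge0.
pose f := fun (_ : unit) s => (gap_weight s)%:E.
have mf q : mseq q f.
  by apply: (@mseq_post _ _ _ _ _ mR _ _ EFin);
    [exact: EFin_measurable|exact: mseq_gap_weight].
have f0 t s : 0 <= f t s by rewrite lee_fin gap_weight_ge0.
have fJ : torus_integral d.*2 (fun s => (f tt (mask b s) * f tt (mask (map negb b) s))) =
    J * J.
  by rewrite -sb torus_integral_mask// cb cnb.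
have e60 : (0 <= 6 * e)%R by rewrite mulr_ge0// ltW.
have mc y0 : mseq d.*2.+1 (fun (_ : unit) s => (cut_weight a e i b (y0 :: s))%:E).
  have H : mseq d.*2.+1 (fun (p : unit * mR) s =>
    (cut_weight a e i b (p.2 :: s))%:E) := mseq_cut_weight.
  exact: (mseq_reparam (phi := fun _ : unit => (tt, y0 : mR)) _ H).
rewrite torus_integralS -[leRHS]mule1 -(@lebesgue_torus R) -integral_cst//; last first.
  exact: measurable_torus.
apply: ge0_le_integral_nonmeas => y0 _.
  by apply: torus_integral_ge0 => s; rewrite lee_fin cut_weight_ge0.
(* The first point is fixed and the others are described by the jumps; the jump
   of rank i, on which only the constraint depends, is integrated first. *)
rewrite -(torus_integral_chain y0 tt (F := fun _ s => (cut_weight a e i b (y0 :: s))%:E))//; last first.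
  by move=> _ s; rewrite lee_fin cut_weight_ge0.
pose F (_ : unit) s := (cut_weight a e i b (y0 :: chain y0 s))%:E.
have F0 t s : 0 <= F t s by rewrite lee_fin cut_weight_ge0.
have mF : mseq d.*2.+1 F.
  exact: (mseq_chain y0 (mc y0)).
rewrite (torus_integral_insert tt id2 F0 mF) -fJ.
rewrite -[leRHS](@ge0_torus_integralZl _ _ (fun s =>
  f tt (mask b s) * f tt (mask (map negb b) s)))//; last 2 first.
- by move=> s; exact: mule_ge0.
- apply: (mseq_op2 (op := fun u v : \bar R => u * v)).
  + exact: emeasurable_funM.
  + by rewrite -sb; apply: (mseq_mask (F := f)); exact: mf.
  + by rewrite -sb -(size_map negb); apply: (mseq_mask (F := f)); exact: mf.
have is_ s : size s = d.*2 -> (i <= size s)%N by move=> ->.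
apply: (le_torus_integral _ _).1 => s ss sT; first exact: integral_ge0.
pose u t := lincomb a (y0 :: chain y0 (insert i t s)).
have Fu t : torus t -> F tt (insert i t s) =
    f tt (mask b s) * f tt (mask (map negb b) s) * ((tnorm (u t) <= e)%R%:R)%:E.
  rewrite torusE => tT; rewrite /F /cut_weight edges_chain; last first.
    by move: sT; rewrite -{1}(cat_take_drop i s) /in_torus !all_cat/= tT.
  by rewrite del_insert ?is_// !EFinM.
have mu : measurable_fun setT (fun t : mR => (tnorm (u t) <= e)%R%:R : mR).
  have H : mseq d.*2.+1 (fun (p : unit * mR) s => (tnorm (lincomb a (p.2 :: s)) <= e)%R%:R : mR)
    := mseq_near_integer e sa.
  have {}H : mseq d.*2.+1 (fun (_ : unit) s => (tnorm (lincomb a (y0 :: s)) <= e)%R%:R : mR).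
    exact: (mseq_reparam (phi := fun _ : unit => (tt, y0 : mR)) _ H).
  have {}H := mseq_insert id2 (mseq_chain y0 H).
  have {}H := mseq_section ss H.
  have m1 : measurable_fun setT (fun t : mR => (tt, t)) by exact: measurable_fun_pair.
  exact: (measurableT_comp H m1).
under eq_integral => t; first by rewrite inE => tT; rewrite (Fu _ tT); over.
rewrite /= ge0_integralZl//; last 3 first.
- exact: measurable_torus.
- by apply: measurable_funTS; exact/measurable_EFinP.
- exact: mule_ge0.
rewrite muleC; apply: lee_wpmul2r; first exact: mule_ge0.
have [c [a' aE]] : exists c a', a = c :: a'.
  by case: (a) sa => // c a' _; exists c, a'.
move: sa siga; rewrite aE => -[sa'] /andP[_ siga'].
apply: (@integral_affine_near_integer _ (\sum_(z <- drop i a') z) u) => //.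
- have sas : size a' = (size s).+1 by rewrite sa' ss.
  have := @affine_mod1_chain_insert _ a' s i y0 sas (is_ _ s ss).
  move=> /(affine_mod1_translate (c%:~R * y0)%R); congr affine_mod1.
  by apply/funext => t; rewrite /u aE [in RHS]/lincomb /= big_cons.
- apply: sum_signs_odd.
    have : signs a' by [].
    by rewrite -{1}(cat_take_drop i a') /signs all_cat => /andP[].
  by rewrite size_drop sa'; move: ei id2; lia.
Qed.

End cut.
End gap_weights.

(** * Moments under a linear constraint *)

Section sum_over_the_cuts.
Context {R : realType}.
Local Notation mR := (measurableTypeR R).
Local Notation lam := (@lebesgue_measure R).
Variable kappa : R -> R.
Hypothesis kappa_anti : forall x y, x <= y -> kappa y <= kappa x.
Hypothesis kappa_ge0 : forall x, 0 <= kappa x.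

(** The gap that closes the cycle, which [edges] leaves out. *)
Definition last_gap (y : seq R) : R := mod1 (head 0 y - last 0 y).

(** The ways to cut a cycle of [2d + 2] points: an order of the points, the rank of
    the gap to remove, and the mask of one of the classes of remaining gaps. The
    best cut depends on the points; summing over this finite list removes the
    dependence. *)
Definition cuts (d : nat) : seq (seq nat * (nat * bitseq)) :=
  [seq c <- allpairs pair (permutations (iota 0 d.*2.+2))
    (allpairs pair (iota 0 d.*2.+1) (map val (enum {:(d.*2).-tuple bool})))
    | ~~ odd c.2.1 && (count id c.2.2 == d)].

Lemma mem_cuts d p i b : ((p, (i, b)) \in cuts d) =
  [&& perm_eq p (iota 0 d.*2.+2), (i <= d.*2)%N, ~~ odd i, size b == d.*2 &
      count id b == d].
Proof.
rewrite mem_filter; apply/idP/idP.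
  move=> /andP[/andP[oi cb] /allpairsP[[p' c] [pp cm E]]].
  have {E}[pE E] : p = p' /\ (i, b) = c by case: E.
  move: cm; rewrite -E => /allpairsP[[i1 b1] [i1d b1m E1]].
  have {E1}[iE bE] : i = i1 /\ b = b1 by case: E1.
  apply/and5P; split => //.
  - by move: pp; rewrite mem_permutations pE.
  - by move: i1d; rewrite mem_iota add0n ltnS iE.
  - by move: b1m => /mapP[t _]; rewrite bE /= => ->; rewrite size_tuple.
move=> /and5P[pp id2 oi /eqP sb cb]; apply/andP; split; first exact/andP.
apply/allpairsP; exists (p, (i, b)); split => //.
  by rewrite mem_permutations.
apply/allpairsP; exists (i, b); split => //; first by rewrite mem_iota.
apply/mapP; exists (tcast sb (in_tuple b)); first by rewrite mem_enum.
by rewrite -[val _]/(tval _) val_tcast.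
Qed.

Lemma prod_mask b (s : seq R) : size b = size s ->
  \prod_(e <- s) kappa e =
  (\prod_(e <- mask b s) kappa e) * \prod_(e <- mask (map negb b) s) kappa e.
Proof.
elim: b s => [|[] b IH] [|e s]//= => [_|[sb]|[sb]].
- by rewrite !big_nil mulr1.
- by rewrite !big_cons (IH _ sb) mulrA.
- by rewrite !big_cons (IH _ sb) mulrCA.
Qed.

Lemma prod_min_le (c : R) (s : seq R) : c <= kappa 0 ->
  (forall t, t \in s -> c <= kappa t) ->
  (\prod_(t <- s) kappa t) * c <= gap_weight kappa s.
Proof.
move=> c0 cs; apply: ler_wpM2l; first exact: prodr_ge0.
elim: s cs => [|t s IH] cs; first by rewrite big_nil.
rewrite big_cons le_min cs ?mem_head//= IH// => u us.
by apply: cs; rewrite in_cons us orbT.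
Qed.

(** The gap [last_gap y], the widest of all, provides the additional factor of the
    class of odd rank, and the gap chosen by [widest_even_gap] provides that of
    the class of even rank. *)
Lemma prod_edges_le_gap_weights d (y : seq R) : size y = d.*2.+2 ->
  all (fun e => e <= last_gap y) (edges y) ->
  exists i b, [/\ (i <= d.*2)%N, ~~ odd i, size b = d.*2, count id b = d &
    kappa (last_gap y) * \prod_(e <- edges y) kappa e <=
    gap_weight kappa (mask b (del i (edges y))) *
    gap_weight kappa (mask (map negb b) (del i (edges y)))].
Proof.
move=> sy /allP ele.
have ses : size (edges y) = d.*2.+1 by rewrite size_pairmap size_behead sy.
have e0 t : t \in edges y -> 0 <= t.
  rewrite /edges => /(nthP 0)[i]; rewrite size_pairmap => ib <-.
  by rewrite (nth_pairmap 0)// mod1_ge0.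
have [i [t [s [b [esE [si oi] sb cb /allP tmax]]]]] := widest_even_gap ses.
have ss : size s = d.*2 by apply: succn_inj; rewrite -ses esE size_insert.
exists i, b; split; rewrite -?ss//.
have memE u : (u \in edges y) = (u == t) || (u \in s).
  by rewrite esE /insert mem_cat in_cons orbCA -mem_cat cat_take_drop.
have -> : \prod_(e <- edges y) kappa e = kappa t *
    ((\prod_(e <- mask b s) kappa e) * \prod_(e <- mask (map negb b) s) kappa e).
  rewrite esE /insert big_cat big_cons/= mulrCA -big_cat/= cat_take_drop.
  by rewrite (prod_mask sb).
rewrite esE del_insert// mulrA [_ * kappa t]mulrC -mulrA.
rewrite [X in X <= _](_ : _ =
  (\prod_(e <- mask b s) kappa e * kappa (last_gap y)) *
  (\prod_(e <- mask (map negb b) s) kappa e * kappa t)); last by ring.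
apply: ler_pM.
- by rewrite mulr_ge0// prodr_ge0.
- by rewrite mulr_ge0// prodr_ge0.
- apply: prod_min_le; first by apply: kappa_anti; exact: mod1_ge0.
  move=> u /mem_mask us; apply: kappa_anti; apply: ele.
  by rewrite memE us orbT.
- apply: prod_min_le => [|u /tmax ut]; apply: kappa_anti => //.
  by apply: e0; rewrite memE eqxx.
Qed.

Local Open Scope ereal_scope.

(** The points are integrated for each cut in the order that the cut prescribes,
    which turns the constraint into one with permuted signs. *)
Lemma constrained_moment_bound (d : nat) (a : seq int) (e C : R)
    (W : seq R -> \bar R) :
  size a = d.*2.+2 -> signs a -> (0 < e)%R -> (0 <= C)%R ->
  (forall x, 0 <= W x) ->
  (forall x, size x = d.*2.+2 -> in_torus x ->
    exists p, let y := map (nth 0%R x) p in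
    [/\ perm_eq p (iota 0 d.*2.+2),
      all (fun e => (e <= last_gap y)%R) (edges y) &
      W x <= (C * (kappa (last_gap y) * \prod_(e <- edges y) kappa e)%R)%:E]) ->
  torus_integral d.*2.+2 (fun x => W x * ((tnorm (lincomb a x) <= e)%R%:R)%:E) <=
  (C * (6 * e) *+ size (cuts d))%:E *
    (torus_integral d (fun s => (gap_weight kappa s)%:E) *
     torus_integral d (fun s => (gap_weight kappa s)%:E)).
Proof.
move=> sa siga e0 C0 W0 WC.
set J := torus_integral d _.
have J0 : 0 <= J by apply: torus_integral_ge0 => s; rewrite lee_fin gap_weight_ge0.
pose Q (c : seq nat * (nat * bitseq)) := 
  (fun y => (cut_weight kappa (map (nth 0%R a) c.1) e c.2.1 c.2.2 y)%:E).
pose G (c : seq nat * (nat * bitseq)) x := C%:E * Q c (map (nth 0%R x) c.1).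
have Q0 c x : 0 <= Q c x by rewrite lee_fin cut_weight_ge0.
have G0 c x : 0 <= G c x by apply: mule_ge0.
have sigp p : perm_eq p (iota 0 d.*2.+2) ->
    size (map (nth 0%R a) p) = d.*2.+2 /\ signs (map (nth 0%R a) p).
  move=> pp; split; first by rewrite size_map (perm_size pp) size_iota.
  rewrite /signs (perm_all _ (perm_map (nth 0%R a) pp)) -sa.
  by rewrite map_nth_iota0// take_size.
have mQ c : c \in cuts d -> mseq d.*2.+2 (fun _ : unit => Q c).
  case: c => p [i b]; rewrite mem_cuts => /and5P[pp id2 oi /eqP sb /eqP cb].
  have [sp _] := sigp _ pp.
  exact: (mseq_cut_weight kappa_anti e sp id2 sb).
have mG c : c \in cuts d -> mseq d.*2.+2 (fun _ : unit => G c).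
  case: c => p [i b] cd; have := cd; rewrite mem_cuts => /and5P[pp _ _ _ _].
  apply: (mseq_op2 (op := fun u v : \bar R => u * v) (F := fun _ _ => C%:E)).
  - exact: emeasurable_funM.
  - exact: mseq_param.
  - apply: (@mseq_map_nth R d.*2.+2 p _ unit _ _ (fun _ => Q (p, (i, b)))).
    by rewrite (perm_size pp) size_iota; exact: mQ.
apply: (@le_trans _ _ (torus_integral d.*2.+2 (fun x => \sum_(c <- cuts d) G c x))).
  apply: (le_torus_integral _ _).1 => x sx xT; first exact: mule_ge0.
  have [p [pp ymax]] := WC _ sx xT; set y := map _ _ in ymax *.
  have sy : size y = d.*2.+2 by rewrite size_map (perm_size pp) size_iota.
  have [i [b [id2 oi sb cb le]]] := prod_edges_le_gap_weights sy ymax.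
  move=> Wle; apply: (@le_trans _ _ (G (p, (i, b)) x)).
    rewrite /G /Q/= /cut_weight -/y lincomb_perm ?sx ?sa// !EFinM muleA.
    apply: lee_wpmul2r => //; apply: (le_trans Wle).
    by rewrite -!EFinM lee_fin ler_wpM2l.
  have cd : (p, (i, b)) \in cuts d by rewrite mem_cuts pp id2 oi sb cb !eqxx.
  rewrite (big_rem _ cd)/= leeDl//; exact: sume_ge0.
rewrite torus_integral_sum//.
have GJ c : c \in cuts d -> torus_integral d.*2.+2 (G c) <= (C * (6 * e))%:E * (J * J).
  case: c => p [i b] cd; have := cd; rewrite mem_cuts => /and5P[pp id2 oi /eqP sb /eqP cb].
  have [sp sigq] := sigp _ pp.
  rewrite /G (torus_integral_perm tt (F := fun _ x => C%:E * Q (p, (i, b)) x) pp)//.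
  - rewrite ge0_torus_integralZl//; last exact: mQ.
    rewrite EFinM -muleA; apply: lee_wpmul2l; first by rewrite lee_fin.
    exact: integral_cut_weight.
  - by move=> _ s; exact: mule_ge0.
  - apply: (mseq_op2 (op := fun u v : \bar R => u * v) (F := fun _ _ => C%:E)).
    + exact: emeasurable_funM.
    + exact: mseq_param.
    + exact: mQ.
have K0 : (0 <= C * (6 * e))%R by rewrite !mulr_ge0// ltW.
rewrite [leLHS]big_seq; apply: (le_trans (lee_sum _ GJ)).
rewrite -big_seq.
elim: (cuts d) => [|c r IH]; first by rewrite big_nil mulr0n mul0e.
rewrite big_cons /= [(_ *+ (size r).+1)%R]mulrS EFinD ge0_muleDl ?leeD2l// lee_fin.
exact: mulrn_wge0.
Qed.

End sum_over_the_cuts.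

(** * Points avoided by a random arc *)

Section arcs_on_the_circle.
Context {R : realType}.
Local Notation mR := (measurableTypeR R).
Local Notation lam := (@lebesgue_measure R).

(** Membership of [t] in the open arc of length [r] that starts at [w]. *)
Definition hit (r w t : R) : bool := 0 < mod1 (t - w) < r.

Definition avoids (x : seq R) (r w : R) : bool := all (fun t => ~~ hit r w t) x.

Definition cyclic_gaps (y : seq R) : seq R :=
  pairmap (fun u v => mod1 (v - u)) (last 0 y) y.

Lemma measurable_hit r t : measurable_fun setT (fun w : mR => hit r w t).
Proof.
have m : measurable_fun setT (fun w : mR => mod1 (t - w) : mR).
  by apply: measurableT_comp; [exact: measurable_mod1|exact: measurable_funB].
by apply: measurable_and; [exact: measurable_fun_ltr|exact: measurable_fun_ltr].
Qed.

Lemma measurable_avoids x r : measurable_fun setT (fun w : mR => avoids x r w).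
Proof.
elim: x => [|t x IH]; first exact: measurable_cst.
by apply: measurable_and => //; apply: measurable_neg; exact: measurable_hit.
Qed.

(** An arc too short to reach back beyond the gap [(u, t)] can contain [t] only
    if it starts inside that gap. This makes disjoint the events counted in
    [sum_hit_path]. *)
Lemma hit_gap r w u t : 0 <= w < 1 -> 0 <= u -> u <= t -> t < 1 ->
  hit (Num.min r (mod1 (t - u))) w t -> u < w < t.
Proof.
move=> w01 u0 ut t1; rewrite /hit lt_min => /and3P[h0 _].
rewrite (@mod1_id _ (t - u)); last by lra.
have [wt|tw] := leP w t.
  rewrite mod1_id; last by lra.
  move: h0; rewrite mod1_id; last by lra.
  by move=> *; lra.
by rewrite (@mod1_unique _ (t - w) (t - w + 1) (-1)); [lra|lra|rewrite /=; lra].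
Qed.

Lemma le_last_path (u : R) s : path <=%R u s -> u <= last u s.
Proof. by elim: s u => //= t s IH u /andP[ut /IH]; exact: le_trans. Qed.

Lemma sum_hit_path r w u s : 0 <= w < 1 -> in_torus (u :: s) ->
  path <=%R u s ->
  (\sum_(p <- zip (pairmap (fun u v => mod1 (v - u)) u s) s)
    (hit (Num.min r p.1) w p.2 : nat) <= (u < w < last u s)%R)%N.
Proof.
move=> w01; elim: s u => [|t s IH] u uT /=; first by rewrite big_nil.
move: uT; rewrite /in_torus/= => /and3P[u01 t01 sT] /andP[ut ts].
rewrite big_cons/=; have := IH t _ ts; rewrite /in_torus/= t01 => /(_ sT).
have tl := le_last_path ts.
have h : hit (Num.min r (mod1 (t - u))) w t -> u < w < t.
  by apply: hit_gap => //; lra.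
case: hit h => [/(_ isT)/andP[uw wt]|_].
  rewrite uw (lt_le_trans wt tl) ltNge (ltW wt)/=.
  by case: (\sum_(_ <- _) _)%N.
rewrite add0n => /leq_trans; apply.
case: (ltP t w) => //= tw.
by rewrite (le_lt_trans ut tw).
Qed.

(** The first gap is the one that goes around the origin: its arc starts after the
    last point or before the first one, away from all the other gaps. *)
Lemma sum_hit_cyclic_gaps r w y : 0 <= w < 1 -> in_torus y -> sorted <=%R y ->
  (\sum_(p <- zip (cyclic_gaps y) y) (hit (Num.min r p.1) w p.2 : nat) <= 1)%N.
Proof.
case: y => [|t s] w01 yT ts; first by rewrite big_nil.
rewrite /cyclic_gaps/= big_cons/=.
apply: (leq_trans (leq_add (leqnn _) (sum_hit_path r w01 yT ts))).
have tl := le_last_path ts.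
have lT : 0 <= last t s < 1 by apply: (allP yT); exact: mem_last.
have tT : 0 <= t < 1 by apply: (allP yT); rewrite mem_head.
have [/andP[tw wl]|] := boolP (t < w < last t s); last first.
  by rewrite addn0; case: hit.
rewrite (_ : hit _ _ _ = false)//; apply/negbTE; rewrite /hit lt_min negb_and.
apply/orP; right; rewrite negb_and; apply/orP; right; rewrite -leNgt.
rewrite (@mod1_unique _ (t - w) (t - w + 1) (-1)); [|lra|rewrite /=; lra].
by rewrite (@mod1_unique _ _ (t - last t s + 1) (-1)); [lra|lra|rewrite /=; lra].
Qed.

Lemma mem_zip (S T : eqType) (s : seq S) (t : seq T) p :
  p \in zip s t -> (p.1 \in s) && (p.2 \in t).
Proof.
elim: s t => [|x s IH] [|y t]//=; rewrite !in_cons => /orP[/eqP->|/IH/andP[-> ->]].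
  by rewrite !eqxx.
by rewrite !orbT.
Qed.

Local Open Scope ereal_scope.

Lemma measurable_boolr (u : mR -> bool) : measurable_fun setT u ->
  measurable_fun setT (fun w : mR => ((u w)%:R)%:E : \bar R).
Proof.
move=> mu; apply/measurable_EFinP.
rewrite (_ : (fun w => _) = \1_(u @^-1` [set true])); last first.
  apply/funext => w; rewrite indicE; congr ((nat_of_bool _)%:R).
  by apply/idP/idP => [uw|/set_mem]; [rewrite mem_set|].
by apply: measurable_indic; rewrite -[X in measurable X]setTI; exact: mu.
Qed.

Lemma integral_hit (r t : R) : (0 <= r <= 1)%R ->
  r%:E <= \int[lam]_(w in torus) ((hit r w t)%:R)%:E.
Proof.
move=> /andP[r0 r1].
rewrite -(@torus_translation _ (fun w => ((hit r w t)%:R)%:E) (t - r)%R); last 2 first.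
- exact: (measurable_boolr (measurable_hit r t)).
- by move=> w; rewrite lee_fin.
have -> : r%:E = \int[lam]_(s in torus) (\1_(`]0%R, r[%classic : set mR) s)%:E.
  have lr : lam `]0%R, r[%classic = r%:E.
    rewrite lebesgue_measure_itv/= lte_fin; case: ifPn => [_|]; first by rewrite sube0.
    by rewrite -leNgt => r0'; congr EFin; apply/eqP; rewrite eq_le r0 r0'.
  rewrite integral_indic//; last exact: measurable_torus.
  rewrite -[LHS]lr; congr (lam _).
  by apply/seteqP; split => s /=; rewrite /torus/= !in_itv/=; [|case]; lra.
apply: ge0_le_integral_nonmeas => s _; first by rewrite lee_fin.
rewrite lee_fin indicE ler_nat; case: (boolP (s \in _)) => // /set_mem/=.
rewrite in_itv/= => s0r; rewrite /hit.
have -> : mod1 (t - mod1 (t - r + s)) = (r - s)%R.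
  apply: (@mod1_unique _ _ _ (Num.floor (t - r + s))); first lra.
  by rewrite {1}/mod1; ring.
by rewrite (_ : (0 < r - s < r)%R = true)//; lra.
Qed.

(** The starting points of the arcs that contain a given point, when the arc is
    shortened to the gap before that point, form disjoint sets of length
    [Num.min r e]; the arcs that avoid [y] start outside all of them. *)
Lemma integral_avoids_sorted (r : R) y : (0 <= r <= 1)%R -> in_torus y ->
  sorted <=%R y ->
  \int[lam]_(w in torus) ((avoids y r w)%:R)%:E +
    (\sum_(e <- cyclic_gaps y) Num.min r e)%:E <= 1.
Proof.
move=> r01 yT ys.
have cg0 e : e \in cyclic_gaps y -> (0 <= e < 1)%R.
  move=> /(nthP 0%R)[i]; rewrite size_pairmap => iy <-.
  by rewrite (nth_pairmap 0%R)// mod1_ge0 mod1_lt1.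
rewrite -[leRHS](@lebesgue_torus R) -[leRHS]mul1e -integral_cst; last first.
  exact: measurable_torus.
pose h (p : R * R) (w : mR) : \bar R := ((hit (Num.min r p.1) w p.2)%:R)%:E.
have mh p : measurable_fun torus (h p).
  by apply: measurable_funTS; exact: measurable_boolr (measurable_hit _ _).
have h0 p w : 0 <= h p w by rewrite lee_fin.
apply: (@le_trans _ _ (\int[lam]_(w in torus) (((avoids y r w)%:R)%:E +
    \sum_(p <- zip (cyclic_gaps y) y) h p w))); last first.
  apply: ge0_le_integral_nonmeas => w.
    by move=> _; rewrite adde_ge0// ?lee_fin// sume_ge0.
  rewrite torusE => w01; rewrite sumEFin -EFinD lee_fin -natr_sum -natrD.
  rewrite (ler_nat _ _ 1%N).
  case: (boolP (avoids y r w)) => [av|_] /=; last first.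
    by rewrite add0n; exact: sum_hit_cyclic_gaps.
  rewrite big1_seq ?addn0// => -[e t] /andP[_ /mem_zip/andP[_ ty]].
  have /allP/(_ t ty) := av; rewrite /hit => htf.
  apply/eqP; rewrite eqb0; apply/negP => H; move/negP: htf; apply.
  by move: H; rewrite /hit lt_min => /and3P[-> -> _].
rewrite ge0_integralD//; last 4 first.
- exact: measurable_torus.
- by apply: measurable_funTS; exact: measurable_boolr (measurable_avoids _ _).
- by move=> w _; exact: sume_ge0.
- by apply: emeasurable_sum => p; exact: mh.
rewrite leeD2l// ge0_integral_sum//; last exact: measurable_torus.
rewrite -sumEFin (_ : \sum_(e <- cyclic_gaps y) _ =
    \sum_(p <- zip (cyclic_gaps y) y) (Num.min r p.1)%:E); last first.
  rewrite -[X in \sum_(_ <- X) _ = _](@unzip1_zip _ _ (cyclic_gaps y) y).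
    by rewrite big_map.
  by rewrite size_pairmap.
rewrite big_seq [leRHS]big_seq; apply: lee_sum => -[e t] /mem_zip/andP[/cg0 e01 _].
apply: integral_hit; rewrite /= le_min ge_min.
by case/andP: r01 => -> ->; case/andP: e01 => ->.
Qed.

End arcs_on_the_circle.

(** * Cyclic gaps and the weights of the gaps *)

Section gaps_in_cyclic_order.
Context {R : realType}.

Lemma cyclic_gaps_rot i (y : seq R) : cyclic_gaps (rot i y) = rot i (cyclic_gaps y).
Proof.
have [iy|yi] := leqP (size y) i.
  by rewrite !rot_oversize// size_pairmap.
rewrite /rot -[in RHS](cat_take_drop i y) /cyclic_gaps !pairmap_cat.
have st : size (take i y) = i by rewrite size_takel// ltnW.
rewrite take_size_cat ?drop_size_cat ?size_pairmap//.
case: (drop i y) (size_drop i y) => [|u s _]; first by move=> /= /eqP; lia.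
case: (take i y) => [|v s'] /=; first by rewrite !cats0.
by rewrite !last_cat/=.
Qed.

Lemma exists_max (s : seq R) : s != [::] ->
  exists2 e, e \in s & all (fun u => u <= e) s.
Proof.
elim: s => //= t [|u s] IH _; first by exists t; rewrite ?mem_head//= lexx.
have [//|e es em] := IH; have [te|et] := leP t e.
  by exists e; [rewrite in_cons es orbT|rewrite /= te].
exists t; [by rewrite mem_head|rewrite /= lexx /=].
by apply: sub_all em => v /le_trans; apply; exact: ltW.
Qed.

(** Sort the points and rotate the list so that its widest gap closes the cycle. *)
Lemma cut_at_widest_gap (x : seq R) : x != [::] ->
  exists p, let z := map (nth 0 x) p in
    [/\ perm_eq p (iota 0 (size x)), all (fun e => e <= last_gap z) (edges z) &
      perm_eq (cyclic_gaps (sort <=%R x)) (last_gap z :: edges z)].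
Proof.
move=> x0; set y := sort _ x.
have sy : size y = size x by rewrite size_sort.
have [|e eg emax] := @exists_max (cyclic_gaps y).
  by rewrite -size_eq0 size_pairmap sy size_eq0.
pose i := index e (cyclic_gaps y).
have : perm_eq (rot i y) x by rewrite perm_rot; exact/permPl/perm_sort.
move=> /(perm_iotaP 0)[p pp zE]; exists p; move=> z.
have cz : cyclic_gaps z = last_gap z :: edges z.
  rewrite /z -zE; have : size (rot i y) != 0%N by rewrite size_rot sy size_eq0.
  by case: (rot i y).
have cz' : cyclic_gaps z = rot i (cyclic_gaps y) by rewrite -cyclic_gaps_rot zE.
split => //; last by rewrite -cz cz' perm_sym perm_rot.
have : head 0 (cyclic_gaps z) = e by rewrite cz' (rot_index eg).
rewrite cz/= => ->; have : all (fun u => u <= e) (cyclic_gaps z).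
  by rewrite cz' (perm_all _ (permEl (perm_rot _ _))).
by rewrite cz/= => /andP[].
Qed.

End gaps_in_cyclic_order.

Section weights.
Context {R : realType}.
Variable l : nat -> R.
Hypothesis l01 : forall n, (1 <= n)%N -> 0 < l n < 1.
Hypothesis l_decr : forall n, (1 <= n)%N -> l n.+1 <= l n.

(** A finite approximation of [dvoretzky_kernel] from below, as a nonincreasing
    function of the distance. *)
Definition kernel_approx (n : nat) (u : R) : R :=
  expR (\sum_(1 <= k < n.+1) Num.max (l k - u) 0).

Lemma kernel_approx_ge0 n u : 0 <= kernel_approx n u.
Proof. exact: expR_ge0. Qed.

Lemma kernel_approx_anti n u v : u <= v -> kernel_approx n v <= kernel_approx n u.
Proof.
move=> uv; rewrite ler_expR; apply: ler_sum => k _.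
rewrite ge_max le_max [X in _ && X]le_max lexx orbT andbT.
by rewrite lerD2l lerN2 uv.
Qed.

Lemma l_le1 k : (1 <= k)%N -> l k <= l 1%N.
Proof.
elim: k => // -[|k] IH _ //; apply: le_trans (IH _) => //; exact: l_decr.
Qed.

(** Here [a] is the probability that an arc of length [l k] avoids the points with
    gaps [g]. The inequality [a <= exp (- \sum_e min (l k) e)] is combined with
    [1 / (1 - l k) <= exp (l k + c)], where [c] is quadratic in [l k], once for
    each point. *)
Lemma avoid_bound (g : seq R) (k : nat) (a : R) : (1 <= k)%N ->
  a + \sum_(e <- g) Num.min (l k) e <= 1 ->
  a / (1 - l k) ^+ size g <=
  expR ((size g)%:R * (l k ^+ 2 / (1 - l 1%N))) *
  expR (\sum_(e <- g) Num.max (l k - e) 0).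
Proof.
move=> k1 ag; have /andP[lk0 lk1] := l01 k1.
have /andP[l10 l11] := @l01 1%N isT; have lkl1 := l_le1 k1.
have pk : 0 < 1 - l k by rewrite subr_gt0.
have inv_le : (1 - l k)^-1 <= expR (l k + l k ^+ 2 / (1 - l 1%N)).
  apply: le_trans (expR_ge1Dx _).
  apply: (@le_trans _ _ (1 + (l k + l k ^+ 2 / (1 - l k)))).
    by rewrite le_eqVlt; apply/orP; left; apply/eqP; field; rewrite gt_eqF.
  rewrite lerD2l lerD2l ler_wpM2l ?sqr_ge0// lef_pV2 ?posrE ?subr_gt0//.
  by rewrite lerD2l lerN2.
have minE e : Num.max (l k - e) 0 = l k - Num.min (l k) e.
  by have [h|h] := leP (l k) e; [rewrite max_r; lra|rewrite max_l; lra].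
have -> : \sum_(e <- g) Num.max (l k - e) 0 =
    (size g)%:R * l k - \sum_(e <- g) Num.min (l k) e.
  under eq_bigr do rewrite minE.
  by rewrite big_split/= sumrN big_const_seq count_predT iter_addr_0 mulr_natl.
set S := \sum_(e <- g) _ in ag *; set c := _ / (1 - l 1%N) in inv_le *.
have -> : expR ((size g)%:R * c) * expR ((size g)%:R * l k - S) =
    expR (- S) * expR (l k + c) ^+ size g.
  by rewrite -expRM_natl -!expRD; congr expR; ring.
rewrite -exprVn; apply: (@le_trans _ _ (expR (- S) * (1 - l k)^-1 ^+ size g)).
  rewrite ler_wpM2r ?exprn_ge0 ?invr_ge0 ?(ltW pk)//.
  by apply: le_trans (expR_ge1Dx _); lra.
rewrite ler_wpM2l ?expR_ge0// lerXn2r ?nnegrE ?invr_ge0 ?(ltW pk) ?expR_ge0//.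
Qed.

(** The summability of [(l n - l n.+1) * exp (l 1 + ... + l n)] forces
    [l n * exp (l 1 + ... + l n)] to be bounded, so that [\sum_k l k ^+ 2] is
    dominated by the integral of [exp (- s)]. *)
Lemma sum_sqr_bounded :
  l n @[n --> \oo] --> 0 ->
  (\sum_(1 <= n <oo)
      ((l n - l n.+1) * expR (\sum_(1 <= k < n.+1) l k))%:E < +oo)%E ->
  exists2 B : R, 0 <= B & forall n, \sum_(1 <= k < n.+1) l k ^+ 2 <= B.
Proof.
move=> l0 lsum; pose S n := \sum_(1 <= k < n.+1) l k.
pose u n := (l n - l n.+1) * expR (S n).
have u0 n : (1 <= n)%N -> 0 <= u n.
  by move=> n1; rewrite mulr_ge0 ?expR_ge0// subr_ge0 l_decr.
have S_le m n : (m <= n)%N -> S m <= S n.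
  move=> mn; rewrite /S (@big_cat_nat _ _ _ m.+1 1 n.+1)//= lerDl.
  rewrite big_nat_cond sumr_ge0// => k; rewrite andbT => /andP[mk _].
  by have /andP[/ltW] := l01 (leq_trans (ltn0Sn m) mk).
have [A A0 uA] : exists2 A, 0 <= A & forall M, \sum_(1 <= n < M) u n <= A.
  have s0 : (0 <= \sum_(1 <= n <oo) (u n)%:E)%E.
    by apply: nneseries_ge0 => n n1 _; rewrite lee_fin u0.
  exists (fine (\sum_(1 <= n <oo) (u n)%:E)%E); first exact: fine_ge0.
  move=> M; rewrite -lee_fin fineK; last by rewrite ge0_fin_numE.
  by rewrite -sumEFin; apply: nneseries_lim_ge => n n1 _; rewrite lee_fin u0.
(* Write l N as the sum of the differences l k - l k.+1 for k >= N. *)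
have lA N : (1 <= N)%N -> l N * expR (S N) <= A.
  move=> N1.
  have H M : (N <= M)%N -> (l N - l M) * expR (S N) <= A.
    move=> NM; apply: le_trans (uA M).
    rewrite (@big_cat_nat _ _ _ N)//= -[leLHS]add0r; apply: lerD.
      by rewrite big_nat_cond sumr_ge0// => k; rewrite andbT => /andP[/u0].
    rewrite -opprB -(telescope_sumr _ NM) -sumrN mulr_suml.
    apply: ler_sum_nat => k /andP[Nk _]; rewrite opprB /u ler_wpM2l ?ler_expR ?S_le//.
    by rewrite subr_ge0 l_decr// (leq_trans N1).
  have cvgl : (l N - l M) * expR (S N) @[M --> \oo] --> (l N - 0) * expR (S N).
    by apply: cvgMr_tmp; apply: cvgB => //; exact: cvg_cst.
  rewrite -[l N]subr0; apply: (cvgr_to_le cvgl).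
  by near=> M; apply: H; near: M; exists N.
have Ssucc n : S n.+1 = S n + l n.+1 by rewrite /S big_nat_recr.
exists A => // n.
suff : \sum_(1 <= k < n.+1) l k ^+ 2 <= A * (1 - expR (- S n)).
  move=> /le_trans; apply; rewrite ler_piMr// gerBl ?expR_ge0//.
(* The induction compares a Riemann sum of exp (- s), over the subdivision by
   the S n, with the integral. *)
elim: n => [|n IH].
  by rewrite big_geq// /S big_geq// oppr0 expR0 subrr mulr0.
rewrite big_nat_recr//=; apply: (le_trans (lerD IH (lexx _))).
have /andP[ln0 _] := @l01 n.+1 isT.
have lle : l n.+1 <= A * expR (- S n.+1).
  by rewrite expRN ler_pdivlMr ?expR_gt0// lA.
have : l n.+1 ^+ 2 <= A * (expR (- S n.+1) * l n.+1).
  by rewrite expr2 mulrA ler_wpM2r// ltW.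
move=> /(lerD (lexx (A * (1 - expR (- S n)))))/le_trans; apply.
rewrite -mulrDr ler_wpM2l//.
have -> : expR (- S n) = expR (- S n.+1) * expR (l n.+1).
  by rewrite -expRD Ssucc; congr expR; ring.
have := expR_ge1Dx (l n.+1); have := expR_gt0 (- S n.+1).
set p := expR (- S n.+1); set v := expR (l n.+1) => p0 v1.
nra.
Unshelve. all: by end_near. Qed.

End weights.

(** * Moments of the random densities *)

Section moments_of_the_density.
Context {R : realType}.
Local Notation mR := (measurableTypeR R).
Local Notation lam := (@lebesgue_measure R).
Variable l : nat -> R.
Hypothesis l01 : forall n, (1 <= n)%N -> 0 < l n < 1.
Hypothesis l_decr : forall n, (1 <= n)%N -> l n.+1 <= l n.

Lemma dvoretzky_factorE (x : nat -> R) k t :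
  dvoretzky_factor l x k t = (~~ hit (l k) (x k) t)%:R / (1 - l k).
Proof.
rewrite /dvoretzky_factor indicE; congr (_ / _).
have -> : (mod1 (t - x k) \in `]0, (l k)[%classic) = hit (l k) (x k) t.
  by apply/idP/idP => [/set_mem|h]; rewrite /hit ?mem_set//= in_itv.
by case: hit; rewrite ?subrr// subr0.
Qed.

Lemma prod_bool I (r : seq I) (b : I -> bool) :
  \prod_(i <- r) (b i)%:R = (all b r)%:R :> R.
Proof.
elim: r => [|i r IH]; first by rewrite big_nil.
by rewrite big_cons IH /=; case: (b i); rewrite ?mul1r ?mul0r.
Qed.

(** Exchanging the products over the points and over the arcs puts together the
    factors that depend on the same arc. *)
Lemma prod_density_avoids (x : nat -> R) n (s : seq R) :
  \prod_(t <- s) dvoretzky_density l x n t =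
  (\prod_(1 <= k < n.+1) (avoids s (l k) (x k))%:R) *
  \prod_(1 <= k < n.+1) ((1 - l k) ^+ size s)^-1.
Proof.
rewrite exchange_big -big_split; apply: eq_bigr => k _ /=.
under eq_bigr do rewrite dvoretzky_factorE.
rewrite big_split/= prod_bool; congr (_ * _).
by rewrite big_const_seq count_predT iter_mulr_1 exprVn.
Qed.

Context dO (Omega : measurableType dO) (P : probability Omega R).
Variable omega : nat -> {RV P >-> R}.
Hypothesis omega_indep : mutually_independent [set n | (1 <= n)%N] omega.
Hypothesis omega_unif : forall n, (1 <= n)%N -> forall A : set R, measurable A ->
  distribution P (omega n) A = torus_lebesgue A.

Let avoid_set s k : set mR := [set w | avoids s (l k) w].

Let measurable_avoid_set s k : measurable (avoid_set s k).
Proof.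
rewrite -[X in measurable X]setTI.
exact: (measurable_avoids s (l k) measurableT (Y := [set true])).
Qed.

Let measurable_avoid_event s k : measurable (omega k @^-1` avoid_set s k).
Proof.
rewrite -[X in measurable X]setTI.
have m : measurable_fun setT (omega k) by exact: measurable_funPT.
exact: (m measurableT _ (measurable_avoid_set s k)).
Qed.

Let avoid_prob s k : R := fine (P (omega k @^-1` avoid_set s k)).

Lemma avoid_prob_le s k : (1 <= k)%N -> in_torus s ->
  avoid_prob s k + \sum_(e <- cyclic_gaps (sort <=%R s)) Num.min (l k) e <= 1.
Proof.
move=> k1 sT; have /andP[lk0 lk1] := l01 k1.
have := @integral_avoids_sorted _ (l k) (sort <=%R s).
rewrite (ltW lk0) (ltW lk1) => /(_ isT).
rewrite /in_torus all_sort => /(_ sT (sort_sorted le_total _)).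
suff -> : (\int[lam]_(w in torus) ((avoids (sort <=%R s) (l k) w)%:R)%:E =
    (avoid_prob s k)%:E)%E by rewrite -EFinD lee_fin.
rewrite /avoid_prob fineK ?fin_num_measure//.
rewrite -[RHS]/(distribution P (omega k) (avoid_set s k)) omega_unif//; last first.
  exact: measurable_avoid_set.
rewrite /torus_lebesgue /mrestr -integral_indic//; last exact: measurable_torus.
apply: eq_integral => w _; rewrite indicE; congr ((nat_of_bool _)%:R%:E).
have -> : avoids (sort <=%R s) (l k) w = avoids s (l k) w.
  by rewrite /avoids all_sort.
by apply/idP/idP => [h|/set_mem//]; exact: mem_set.
Qed.

Lemma expectation_prod_density n (s : seq R) :
  (\int[P]_w (\prod_(t <- s) dvoretzky_density l (omega ^~ w) n t)%:E =
   (\prod_(1 <= k < n.+1) (avoid_prob s k / (1 - l k) ^+ size s))%:E)%E.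
Proof.
pose J := [fset k in index_iota 1 n.+1]%fset.
pose A := \bigcap_(k in [set` J]) (omega k @^-1` avoid_set s k).
have mA : measurable A.
  apply: fin_bigcap_measurable => [|k _]; first exact: finite_fset.
  exact: measurable_avoid_event.
set c := \prod_(1 <= k < n.+1) ((1 - l k) ^+ size s)^-1.
under eq_integral => w _.
  rewrite prod_density_avoids -/c prod_bool mulrC.
  rewrite (_ : all _ _ = (w \in A)); last first.
    apply/allP/idP => [H|/set_mem H k kn].
      by apply/mem_set => k /=; rewrite !inE => /H.
    by apply: (H k); rewrite /= !inE.
  rewrite -[((w \in A)%:R)]/(\1_A w) EFinM.
  over.
have c0 : 0 <= c.
  rewrite /c big_nat_cond prodr_ge0// => k; rewrite andbT => /andP[k1 _].
  by rewrite invr_ge0 exprn_ge0// subr_ge0 ltW//; case/andP: (l01 k1).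
rewrite /= ge0_integralZl//; last first.
  by apply/measurable_EFinP; exact: measurable_indic.
have PA : P A = (\prod_(i <- J) P (omega i @^-1` avoid_set s i))%E.
  apply: omega_indep => [k /=|k]; last exact: measurable_avoid_set.
  by rewrite !inE mem_index_iota => /andP[].
rewrite integral_indic// setIT [X in (_ * X)%E]PA.
rewrite (perm_big (index_iota 1 n.+1)); last first.
  apply: uniq_perm; [exact: fset_uniq|exact: iota_uniq|].
  by move=> k; rewrite !inE.
rewrite (eq_bigr (fun k => (avoid_prob s k)%:E)); last first.
  by move=> k _; rewrite fineK// fin_num_measure.
by rewrite prodEFin -EFinM mulrC /c -big_split.
Qed.

(** By independence the moment is a product over the arcs, to each of which
    [avoid_bound] applies; exchanging the sums over the arcs and over the gaps
    yields one weight for each gap. *)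
Lemma moment_le_gaps n (s : seq R) (B : R) : s != [::] -> in_torus s ->
  (\sum_(1 <= k < n.+1) l k ^+ 2 <= B) ->
  exists p, let z := map (nth 0 s) p in
    [/\ perm_eq p (iota 0 (size s)), all (fun e => e <= last_gap z) (edges z) &
    (\int[P]_w (\prod_(t <- s) dvoretzky_density l (omega ^~ w) n t)%:E <=
     (expR ((size s)%:R * (B / (1 - l 1%N))) * (kernel_approx l n (last_gap z) *
        \prod_(e <- edges z) kernel_approx l n e))%:E)%E].
Proof.
move=> s0 sT lB; have [p [pp zmax gz]] := cut_at_widest_gap s0.
exists p; split => //; move: gz; set z := map _ _ => gz.
rewrite expectation_prod_density lee_fin.
set g := cyclic_gaps _ in gz.
have sg : size g = size s by rewrite size_pairmap size_sort.
have -> : kernel_approx l n (last_gap z) * \prod_(e <- edges z) kernel_approx l n e =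
    \prod_(e <- g) kernel_approx l n e by rewrite (perm_big _ gz)/= big_cons.
have -> : \prod_(e <- g) kernel_approx l n e =
    \prod_(1 <= k < n.+1) expR (\sum_(e <- g) Num.max (l k - e) 0).
  by rewrite /kernel_approx -!expR_sum exchange_big.
have /andP[l10 l11] := @l01 1%N isT.
apply: (@le_trans _ _ (\prod_(1 <= k < n.+1)
   (expR ((size g)%:R * (l k ^+ 2 / (1 - l 1%N))) *
    expR (\sum_(e <- g) Num.max (l k - e) 0)))).
  rewrite big_nat_cond [leRHS]big_nat_cond; apply: ler_prod => k.
  rewrite andbT => /andP[k1 _]; have /andP[lk0 lk1] := l01 k1.
  apply/andP; split; last first.
    by rewrite -sg; apply: avoid_bound => //; exact: avoid_prob_le.
  by rewrite mulr_ge0 ?fine_ge0// invr_ge0 exprn_ge0// subr_ge0 ltW.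
rewrite big_split/= ler_wpM2r ?prodr_ge0//.
rewrite -expR_sum ler_expR -mulr_sumr -mulr_suml sg ler_wpM2l//.
by rewrite ler_wpM2r// invr_ge0 subr_ge0 ltW.
Qed.

End moments_of_the_density.

(** * The integral of the kernel *)

Section kernel_integral.
Context {R : realType}.
Local Notation mR := (measurableTypeR R).
Local Notation lam := (@lebesgue_measure R).
Variable l : nat -> R.
Local Open Scope ereal_scope.

Lemma kernel_approx_le n (t u : R) : (tnorm t <= u)%R ->
  (kernel_approx l n u)%:E <= dvoretzky_kernel l t.
Proof.
move=> tu; rewrite /dvoretzky_kernel /kernel_approx.
rewrite -[(expR _)%:E]/(expeR (_)%:E) ler_expeR.
apply: (@le_trans _ _ (\sum_(1 <= k < n.+1) (Num.max (l k - tnorm t) 0)%:E)).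
  rewrite sumEFin lee_fin; apply: ler_sum => k _.
  rewrite ge_max le_max [X in _ && X]le_max lexx orbT andbT.
  by rewrite lerD2l lerN2 tu.
by apply: nneseries_lim_ge => k _ _; rewrite lee_fin le_max lexx orbT.
Qed.

Lemma tnorm_le_norm (t : R) : (tnorm t <= `|t|)%R.
Proof. by have := tnorm_le t 0; rewrite subr0. Qed.

(** The widest gap is at least the mean of the gaps, which is the sum of the gaps
    scaled by [1 / d], and each gap is at least its scaled value. *)
Lemma gap_weight_le_kernels n d (s : seq R) : (1 <= d)%N -> size s = d ->
  in_torus s ->
  (gap_weight (kernel_approx l n) s <=
   (\prod_(t <- map ( *%R d%:R^-1) s) kernel_approx l n t) *
     kernel_approx l n (\sum_(t <- map ( *%R d%:R^-1) s) t))%R.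
Proof.
move=> d1 sd sT; have d0 : (0 < d%:R :> R)%R by rewrite ltr0n.
have ds1 (t : R) : (0 <= t -> d%:R^-1 * t <= t)%R.
  move=> t0; apply: ler_piMl => //; by rewrite invf_le1// ler1n.
rewrite !big_map -mulr_sumr /gap_weight; apply: ler_pM.
- by apply: prodr_ge0 => t _; exact: kernel_approx_ge0.
- by elim/big_rec : _ => [|t x _ x0]; rewrite ?le_min ?kernel_approx_ge0.
- rewrite big_seq [leRHS]big_seq; apply: ler_prod => t ts.
  rewrite kernel_approx_ge0; apply: kernel_approx_anti; apply: ds1.
  by have /andP[] := allP sT _ ts.
- have s0 : s != [::] by rewrite -size_eq0 sd -lt0n.
  have [e es /allP emax] := exists_max s0.
  apply: (@le_trans _ _ (kernel_approx l n e)).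
    elim: (s) es => // t r IH; rewrite in_cons big_cons ge_min.
    by case/orP => [/eqP ->|/IH ->]; rewrite ?lexx ?orbT.
  apply: kernel_approx_anti; rewrite ler_pdivrMl//.
  apply: (@le_trans _ _ (\sum_(t <- s) e)%R).
    by rewrite big_seq [leRHS]big_seq; apply: ler_sum => t /emax.
  by rewrite big_const_seq count_predT iter_addr_0 sd mulr_natl.
Qed.

(** The Jacobian of the scaling by [1 / d] gives the factor [d ^ d]. After the
    scaling, the weight of the sum of the gaps is compared with the kernel at the
    opposite point: the distance to the integers is even and at most the sum. *)
Lemma gap_weight_integral_le n d : (1 <= d)%N ->
  torus_integral d (fun s => (gap_weight (kernel_approx l n) s)%:E) <=
  (d%:R ^+ d)%:E * torus_integral d (fun s =>
      (\prod_(t <- s) dvoretzky_kernel l t)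
        * dvoretzky_kernel l (- \sum_(t <- s) t)%R).
Proof.
move=> d1; set K := (X in _ <= _ * X).
have d0 : (0 < d%:R :> R)%R by rewrite ltr0n.
pose G (_ : unit) (s : seq R) : \bar R := ((\prod_(t <- s) kernel_approx l n t) *
  kernel_approx l n (\sum_(t <- s) t))%:E.
have G0 u s : 0 <= G u s.
  rewrite lee_fin mulr_ge0 ?kernel_approx_ge0// prodr_ge0// => t _.
  exact: kernel_approx_ge0.
have mk := measurable_kappa (@kernel_approx_anti R l n).
have mG : mseq d G.
  apply: (@mseq_post _ _ _ _ _ mR _ _ EFin); first exact: EFin_measurable.
  apply: (mseq_op2 (op := fun u v : mR => u * v : mR)%R).
  - exact: measurable_funM.
  - apply: mseq_big_seq; first exact: measurable_funM.
    exact: (measurableT_comp mk measurable_snd).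
  - apply: (@mseq_post _ _ _ _ _ mR _ mR (kernel_approx l n)) => //.
    by apply: mseq_big_seq; [exact: measurable_funD|exact: measurable_snd].
have prod_le s : in_torus s ->
    (\prod_(t <- s) kernel_approx l n t)%:E <= \prod_(t <- s) dvoretzky_kernel l t.
  rewrite -prodEFin; elim: s => [|t s IH]; first by rewrite !big_nil.
  rewrite /in_torus/= => /andP[t01 sT]; rewrite !big_cons.
  apply: lee_pmul; last exact: IH.
  + by rewrite lee_fin kernel_approx_ge0.
  + by rewrite prodEFin lee_fin prodr_ge0// => u _; exact: kernel_approx_ge0.
  + apply: kernel_approx_le; apply: le_trans (tnorm_le_norm _) _.
    by rewrite ger0_norm; case/andP: t01.
have GK : torus_integral d (G tt) <= K.
  apply: (le_torus_integral _ _).1 => s sd sT //.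
  have sp : (0 <= \sum_(t <- s) t)%R.
    by rewrite big_seq sumr_ge0// => t /(allP sT)/andP[].
  rewrite /G EFinM; apply: lee_pmul.
  - by rewrite lee_fin prodr_ge0// => t _; exact: kernel_approx_ge0.
  - by rewrite lee_fin kernel_approx_ge0.
  - exact: prod_le.
  - apply: kernel_approx_le; apply: le_trans (tnorm_le_norm _) _.
    by rewrite normrN ger0_norm.
have r01 : (0 < (d%:R^-1 : R) <= 1)%R.
  by rewrite invr_gt0 d0 invf_le1// ler1n.
have := torus_integral_scaling tt r01 G0 mG => /le_trans/(_ GK) H.
have -> : torus_integral d (fun s => (gap_weight (kernel_approx l n) s)%:E) =
   (d%:R ^+ d)%:E * ((d%:R^-1 ^+ d)%:E *
     torus_integral d (fun s => (gap_weight (kernel_approx l n) s)%:E)).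
  by rewrite muleA -EFinM -exprMn divff ?expr1n ?mul1e ?gt_eqF.
apply: lee_wpmul2l; first by rewrite lee_fin exprn_ge0// ltW.
apply: le_trans H; apply: lee_wpmul2l.
  by rewrite lee_fin exprn_ge0// invr_ge0 ltW.
apply: (le_torus_integral _ _).1 => s sd sT.
  by rewrite lee_fin gap_weight_ge0// => x; exact: kernel_approx_ge0.
by rewrite lee_fin gap_weight_le_kernels.
Qed.

End kernel_integral.

(** * The expected energy *)

Section energy.
Context {R : realType}.
Local Notation mR := (measurableTypeR R).
Local Notation lam := (@lebesgue_measure R).
Variable l : nat -> R.
Hypothesis l01 : forall n, (1 <= n)%N -> 0 < l n < 1.
Hypothesis l_decr : forall n, (1 <= n)%N -> l n.+1 <= l n.

(** The coefficients, in the difference of two sums of [d + 1] points, of the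
    [2 * d + 2] points. *)
Definition balanced (d : nat) : seq int := nseq d.+1 1 ++ nseq d.+1 (-1).

Lemma size_balanced d : size (balanced d) = d.*2.+2.
Proof. by rewrite size_cat !size_nseq addnn doubleS. Qed.

Lemma signs_balanced d : signs (balanced d).
Proof. by rewrite /signs all_cat !all_nseq. Qed.

Local Open Scope ereal_scope.

(** The mass given by the square of the [d]-th convolution of the measure with
    density [dvoretzky_density] to the pairs of points at distance at most
    [e]. *)
Definition energy (d : nat) (x : nat -> R) (n : nat) (e : R) : \bar R :=
  torus_integral d.*2.+2 (fun s =>
    (\prod_(t <- s) dvoretzky_density l x n t)%R%:E *
    ((tnorm (lincomb (balanced d) s) <= e)%R%:R)%:E).

Context dO (Omega : measurableType dO) (P : probability Omega R).
Variable omega : nat -> {RV P >-> R}.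

Let density_ge0 x n (s : seq R) :
  (0 <= \prod_(t <- s) dvoretzky_density l x n t)%R.
Proof. by apply: prodr_ge0 => t _; exact: dvoretzky_density_ge0. Qed.

Lemma measurable_density_joint n :
  measurable_fun setT (fun p : Omega * mR =>
    dvoretzky_density l (omega ^~ p.1) n p.2 : mR).
Proof.
apply: measurable_prod => k _.
apply: measurable_funM => //; apply: measurable_funB => //.
apply: measurableT_comp; first exact: measurable_indic.
apply: measurableT_comp; first exact: measurable_mod1.
apply: measurable_funB => //.
apply: measurableT_comp => //; exact: measurable_funPT.
Qed.

Lemma mseq_energy d n e : mseq d.*2.+2 (fun (w : Omega) s =>
  (\prod_(t <- s) dvoretzky_density l (omega ^~ w) n t)%R%:E *
    ((tnorm (lincomb (balanced d) s) <= e)%R%:R)%:E).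
Proof.
apply: (mseq_op2 (op := fun u v : \bar R => u * v)).
- exact: emeasurable_funM.
- apply: (@mseq_post _ _ _ _ _ mR _ _ EFin); first exact: EFin_measurable.
  apply: mseq_big_seq; first exact: measurable_funM.
  exact: measurable_density_joint.
- apply: (@mseq_post _ _ _ _ _ mR _ _ EFin); first exact: EFin_measurable.
  have H := @mseq_near_integer R _ _ e (size_balanced d).
  by apply: (mseq_reparam (phi := fun _ : Omega => tt) _ H).
Qed.

Lemma measurable_energy d n e :
  measurable_fun setT (fun w => energy d (omega ^~ w) n e).
Proof.
apply: measurable_torus_integral; last exact: mseq_energy.
by move=> w s; rewrite mule_ge0// lee_fin// density_ge0.
Qed.

Lemma energy_ge0 d x n e : 0 <= energy d x n e.
Proof.
by apply: torus_integral_ge0 => s; rewrite mule_ge0// lee_fin// density_ge0.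
Qed.

Hypothesis omega_indep : mutually_independent [set n | (1 <= n)%N] omega.
Hypothesis omega_unif : forall n, (1 <= n)%N -> forall A : set R, measurable A ->
  distribution P (omega n) A = torus_lebesgue A.
Hypothesis l_cvg0 : l n @[n --> \oo] --> 0%R.
Hypothesis l_exp_sum : \sum_(1 <= n <oo)
      ((l n - l n.+1) * expR (\sum_(1 <= k < n.+1) l k))%R%:E < +oo.
Variable d : nat.
Hypothesis d_ge1 : (1 <= d)%N.
Hypothesis K_int : torus_integral d (fun s =>
      (\prod_(t <- s) dvoretzky_kernel l t)
        * dvoretzky_kernel l (- \sum_(t <- s) t)%R) < +oo.

(** The expectation enters the iterated integral, where [moment_le_gaps] provides
    the hypothesis of [constrained_moment_bound]. *)
Lemma expected_energy_le : exists2 C : R, (0 <= C)%R &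
  forall n e, (0 < e)%R -> \int[P]_w energy d (omega ^~ w) n e <= (C * e)%:E.
Proof.
have [B B0 lB] := sum_sqr_bounded l01 l_decr l_cvg0 l_exp_sum.
pose C0 := expR (d.*2.+2%:R * (B / (1 - l 1%N))).
have := K_int; set K := torus_integral d _ => Koo.
have K0 : 0 <= K.
  apply: torus_integral_ge0 => s; apply: mule_ge0; last exact: expeR_ge0.
  elim: s => [|t s IH]; first by rewrite big_nil.
  by rewrite big_cons mule_ge0// expeR_ge0.
have Kfin : K = (fine K)%:E by rewrite fineK// ge0_fin_numE.
pose JM := (d%:R ^+ d * fine K)%R.
have J_le n : torus_integral d (fun s => (gap_weight (kernel_approx l n) s)%:E) <= JM%:E.
  by rewrite /JM EFinM -Kfin; exact: gap_weight_integral_le.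
exists ((C0 * 6 *+ size (cuts d)) * (JM * JM))%R.
  have JM0 : (0 <= JM)%R by rewrite mulr_ge0 ?exprn_ge0// fine_ge0.
  apply: mulr_ge0; last exact: mulr_ge0.
  by apply: mulrn_wge0; apply: mulr_ge0 => //; exact: expR_ge0.
move=> n e e0.
rewrite (torus_integral_swap _ (F := fun w s => _ * _)); last 2 first.
- by move=> w s; rewrite mule_ge0// lee_fin// density_ge0.
- exact: mseq_energy.
pose W s := \int[P]_w (\prod_(t <- s) dvoretzky_density l (omega ^~ w) n t)%R%:E.
have mden (s : seq R) : measurable_fun setT (fun w =>
    (\prod_(t <- s) dvoretzky_density l (omega ^~ w) n t)%R%:E).
  apply/measurable_EFinP; apply: measurable_prod => t _.
  have mt : measurable_fun setT (fun w : Omega => (w, t : mR)).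
    exact: measurable_fun_pair.
  exact: (measurableT_comp (measurable_density_joint n) mt).
have W0 s : 0 <= W s by apply: integral_ge0 => w _; rewrite lee_fin density_ge0.
rewrite (@eq_torus_integral _ _ _ (fun s => W s *
    ((tnorm (lincomb (balanced d) s) <= e)%R%:R)%:E)); last first.
  move=> s _ _; rewrite ge0_integralZr//.
  by move=> w _; rewrite lee_fin density_ge0.
apply: (le_trans (constrained_moment_bound (@kernel_approx_anti R l n)
  (@kernel_approx_ge0 R l n) (size_balanced d) (signs_balanced d) e0
  (expR_ge0 _) W0 _)) => [s ss sT|].
  have s0 : s != [::] by rewrite -size_eq0 ss.
  have [p [pp pm pW]] := moment_le_gaps l01 l_decr omega_indep omega_unif s0 sT (lB n).
  exists p; rewrite -ss; split => //; rewrite ss in pW; exact: pW.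
set J := torus_integral d _.
have J0 : 0 <= J.
  apply: torus_integral_ge0 => s; rewrite lee_fin gap_weight_ge0// => t.
  exact: kernel_approx_ge0.
apply: (@le_trans _ _ ((C0 * (6 * e) *+ size (cuts d))%:E * (JM%:E * JM%:E))).
  apply: lee_wpmul2l; first by rewrite lee_fin mulrn_wge0// !mulr_ge0 ?expR_ge0// ltW.
  by apply: lee_pmul => //; exact: J_le.
rewrite -!EFinM lee_fin le_eqVlt; apply/orP; left; apply/eqP.
by rewrite [(C0 * (6 * e))%R]mulrA -mulrnAl mulrAC.
Qed.

End energy.

(** * Integration against a density *)

Section integration_against_a_density.
Local Open Scope ereal_scope.
Context d (T : measurableType d) (R : realType).
Variables (mu m : {measure set T -> \bar R}) (g : T -> R).
Hypothesis g0 : forall x, (0 <= g x)%R.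
Hypothesis mg : measurable_fun setT g.
Hypothesis mE : forall A, measurable A -> m A = \int[mu]_(x in A) (g x)%:E.

Import HBNNSimple.

Let integral_density_nnsfun (f : {nnsfun T >-> R}) :
  \int[m]_x (f x)%:E = \int[mu]_x ((f x)%:E * (g x)%:E).
Proof.
under [LHS]eq_integral do rewrite fimfunE -fsumEFin//.
rewrite [LHS]ge0_integral_fsum//; last 2 first.
- by move=> r; exact/measurable_EFinP/measurableT_comp.
- by move=> r x _; rewrite nnfun_muleindic_ge0.
under [RHS]eq_integral.
  move=> x _; rewrite fimfunE -fsumEFin// ge0_mule_fsuml; last first.
    by move=> r; rewrite nnfun_muleindic_ge0.
  over.
rewrite [RHS]ge0_integral_fsum//; last 2 first.
- move=> r; apply: emeasurable_funM; last exact/measurable_EFinP.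
  by apply/measurable_EFinP; exact: measurableT_comp.
- by move=> r x _; apply: mule_ge0; rewrite ?nnfun_muleindic_ge0 ?lee_fin.
apply: eq_fsbigr => r _; rewrite integralZl_indic_nnsfun// integral_indic// setIT.
rewrite mE// integral_mkcond.
have [r0|r0] := leP 0%R r.
  rewrite -ge0_integralZl//.
  - apply: eq_integral => x _; rewrite patchE indicE.
    by case: (_ \in _); rewrite ?mulr1 ?mulr0 ?mul0e ?mule0.
  - apply/(measurable_restrictT _ _).1 => //.
    by apply: measurable_funTS; exact/measurable_EFinP.
  - by move=> x _; apply: erestrict_ge0 => y _; rewrite lee_fin.
rewrite preimage_nnfun0// integral0_eq => [|x _].
  by rewrite mule0 integral0_eq// => x _; rewrite indic0 mulr0 mul0e.
by rewrite patchE in_set0.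
Qed.

(** From simple functions to nonnegative ones by monotone convergence. *)
Lemma ge0_integral_density (f : T -> \bar R) : measurable_fun setT f ->
  (forall x, 0 <= f x) ->
  \int[m]_x f x = \int[mu]_x (f x * (g x)%:E).
Proof.
move=> mf f0; pose f_ := nnsfun_approx measurableT mf.
transitivity (limn (fun n => \int[m]_x (f_ n x)%:E)).
  rewrite -monotone_convergence//=.
  - apply: eq_integral => x _; apply/esym/cvg_lim => //.
    exact: cvg_nnsfun_approx.
  - by move=> n; exact/measurable_EFinP/measurable_funTS.
  - by move=> n x _; rewrite lee_fin.
  - by move=> x _ a b ab; rewrite lee_fin; exact/lefP/nd_nnsfun_approx.
transitivity (limn (fun n => \int[mu]_x ((f_ n x)%:E * (g x)%:E))).
  by congr (limn _); apply/funext => n; exact: integral_density_nnsfun.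
rewrite -monotone_convergence//=.
- apply: eq_integral => x _; apply/cvg_lim => //.
  apply: cvgeZr => //; exact: cvg_nnsfun_approx.
- move=> n; apply: emeasurable_funM; exact/measurable_EFinP/measurable_funTS.
- by move=> n x _; rewrite mule_ge0// lee_fin.
- move=> x _ a b ab; apply: lee_wpmul2r; rewrite lee_fin//.
  exact/lefP/nd_nnsfun_approx.
Qed.

End integration_against_a_density.

(** * Test functions on the circle *)

Section test_functions.
Context {R : realType}.
Local Notation mR := (measurableTypeR R).
Local Notation lam := (@lebesgue_measure R).

(** Nonnegative continuous functions on the circle. The uniform continuity is
    required in the form in which it is used, and passes directly to the
    functions [smoothing]; one inequality suffices since [x] and [y] play
    symmetric roles. *)
Record test_function (g : R -> R) : Prop := TestFunction {
  test_ge0 : forall x, 0 <= g x;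
  test_periodic : forall x, g (x + 1) = g x;
  test_bounded : exists2 B, 0 <= B & forall x, g x <= B;
  test_uniform : forall e, 0 < e ->
    exists2 r, 0 < r & forall x y, `|x - y| < r -> g x <= g y + e }.

Implicit Types g : R -> R.

Lemma test_translate g a : test_function g -> test_function (fun y => g (a + y)).
Proof.
move=> [g0 gp [B B0 gB] gu]; split => //.
- by move=> x; rewrite addrA gp.
- by exists B.
- move=> e /gu[r r0 H]; exists r => // x y xy; apply: H.
  by rewrite opprD addrACA subrr add0r.
Qed.

Lemma test_periodicz g (z : int) x : test_function g -> g (x + z%:~R) = g x.
Proof.
move=> tg; have gN (n : nat) y : g (y + n%:R) = g y.
  elim: n y => [|n IH] y; first by rewrite addr0.
  by rewrite -natr1 addrA test_periodic.
case: z => n; first exact: gN.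
by rewrite NegzE mulrNz -[LHS](gN n.+1) subrK.
Qed.

Lemma test_mod1 g x : test_function g -> g (mod1 x) = g x.
Proof. by move=> tg; rewrite /mod1 -mulrNz test_periodicz. Qed.

Lemma test_continuous g : test_function g -> continuous g.
Proof.
move=> tg x; apply/cvgrPdist_le => e e0.
have [r r0 H] := test_uniform tg e0.
apply/nbhs_ballP; exists r => // y; rewrite /ball/= => xy.
rewrite ler_norml; apply/andP; split.
  by rewrite lerBrDr addrC lerBlDr; apply: H; rewrite distrC.
by rewrite lerBlDr addrC; apply: H.
Qed.

Lemma measurable_test g : test_function g -> measurable_fun setT (g : mR -> mR).
Proof. by move=> tg; apply: continuous_measurable_fun; exact: test_continuous. Qed.

Local Open Scope ereal_scope.
Implicit Types mu : {finite_measure set mR -> \bar R}.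

Let measurable_EFin_test g : test_function g ->
  measurable_fun setT (fun x : mR => (g x)%:E).
Proof. by move=> tg; apply/measurable_EFinP; exact: measurable_test. Qed.

Lemma integral_test_le_add mu g h (c : R) : test_function g -> test_function h ->
  (0 <= c)%R -> (forall y, g y <= h y + c)%R ->
  \int[mu]_y (g y)%:E <= \int[mu]_y (h y)%:E + c%:E * mu setT.
Proof.
move=> tg th c0 gh; rewrite -integral_cst// -ge0_integralD//=; last 2 first.
- by move=> y _; rewrite lee_fin test_ge0.
- exact: measurable_EFin_test.
apply: ge0_le_integral_nonmeas => y _; first by rewrite lee_fin test_ge0.
by rewrite -EFinD lee_fin.
Qed.

Lemma integral_test_fin mu g : test_function g -> \int[mu]_y (g y)%:E < +oo.
Proof.
move=> tg; have [B B0 gB] := test_bounded tg.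
apply: (@le_lt_trans _ _ (\int[mu]_y (cst B%:E y))).
  by apply: ge0_le_integral_nonmeas => y _; rewrite lee_fin ?test_ge0.
rewrite integral_cst// lte_mul_pinfty ?lee_fin//.
by rewrite -ge0_fin_numE// fin_num_measure.
Qed.

(** Integrating a test function against a convolution amounts to smoothing it with
    one factor and integrating the result against the other, by
    [integral_torus_conv]; this reduces the weak convergence of convolutions to
    that of the factors. *)
Definition smoothing mu g (a : R) : R := fine (\int[mu]_y (g (a + y)%R)%:E).

Lemma smoothingE mu g a : test_function g ->
  (smoothing mu g a)%:E = \int[mu]_y (g (a + y)%R)%:E.
Proof.
move=> tg; rewrite /smoothing fineK// ge0_fin_numE.
  exact: (integral_test_fin _ (test_translate a tg)).
by apply: integral_ge0 => y _; rewrite lee_fin test_ge0.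
Qed.

Lemma test_smoothing mu g : test_function g -> test_function (smoothing mu g).
Proof.
move=> tg.
have muT0 : (0 <= fine (mu setT))%R by exact: fine_ge0.
have muTE : mu setT = (fine (mu setT))%:E by rewrite fineK// fin_num_measure.
split.
- move=> x; apply: fine_ge0; apply: integral_ge0 => y _.
  by rewrite lee_fin test_ge0.
- move=> x; congr fine; apply: eq_integral => y _; congr EFin.
  by rewrite addrAC test_periodic.
- have [B B0 gB] := test_bounded tg; exists (B * fine (mu setT))%R.
    exact: mulr_ge0.
  move=> x; rewrite -lee_fin smoothingE// EFinM -muTE -integral_cst//.
  by apply: ge0_le_integral_nonmeas => y _; rewrite lee_fin ?test_ge0.
- move=> e e0; have e1 : (0 < e / (fine (mu setT) + 1))%R.
    by rewrite divr_gt0// ltr_wpDl.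
  have [r r0 H] := test_uniform tg e1; exists r => // x y xy.
  rewrite -lee_fin EFinD !smoothingE//.
  apply: le_trans (integral_test_le_add mu (test_translate x tg)
    (test_translate y tg) (ltW e1) _) _.
    by move=> z; apply: H; rewrite opprD addrACA subrr addr0.
  rewrite leeD2l// [X in _ * X]muTE -EFinM lee_fin.
  rewrite mulrAC ler_pdivrMr ?ltr_wpDl// ler_wpM2l ?(ltW e0)//.
  by rewrite lerDl.
Qed.

(** The measure [torus_conv mu nu], presented as a push-forward so that the change
    of variables formula applies to it. *)
Definition conv_image mu (nu : {finite_measure set mR -> \bar R}) :
  {measure set mR -> \bar R}.
Proof.
unshelve refine (pushforward (mu \x nu) (@torus_add R)).
exact: measurable_torus_add.
Defined.

Lemma integral_torus_conv mu (nu : {finite_measure set mR -> \bar R}) g :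
  test_function g ->
  \int[torus_conv mu nu]_y (g y)%:E = \int[mu]_a (smoothing nu g a)%:E.
Proof.
move=> tg; transitivity (\int[conv_image mu nu]_y (g y)%:E).
  exact: eq_measure_integral.
rewrite (ge0_integral_pushforward (@measurable_torus_add R))//; last 2 first.
- exact: measurable_EFin_test.
- by move=> y _; rewrite lee_fin test_ge0.
rewrite preimage_setT (fubini_tonelli1 (m1 := mu) (m2 := nu)); last 2 first.
- by apply: measurableT_comp (measurable_torus_add);
    exact: measurable_EFin_test.
- by move=> p; rewrite lee_fin test_ge0.
apply: eq_integral => a _; rewrite smoothingE//; apply: eq_integral => b _.
by rewrite /= /torus_add test_mod1.
Qed.

End test_functions.

(** * Convolutions of the approximations *)

Section convolutions_of_the_approximations.
Context {R : realType}.
Local Notation mR := (measurableTypeR R).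
Local Notation lam := (@lebesgue_measure R).
Variable l : nat -> R.
Hypothesis l01 : forall n, (1 <= n)%N -> 0 < l n < 1.
Variable x : nat -> R.
Implicit Types g h : R -> R.

Let M n t := dvoretzky_density l x n t.

Let M_ge0 n t : 0 <= M n t.
Proof. exact: dvoretzky_density_ge0. Qed.

Let prodM_ge0 n (s : seq R) : 0 <= \prod_(t <- s) M n t.
Proof. by apply: prodr_ge0. Qed.

Local Open Scope ereal_scope.

Let mM n : measurable_fun setT (fun t : mR => (M n t)%:E).
Proof. by apply/measurable_EFinP; exact: measurable_dvoretzky_density. Qed.

Let mseq_prodM q n d (T : measurableType d) :
  mseq q (fun (_ : T) s => (\prod_(t <- s) M n t)%R%:E).
Proof.
apply: (@mseq_post _ _ _ _ _ mR _ _ EFin); first exact: EFin_measurable.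
apply: mseq_big_seq; first exact: measurable_funM.
exact: (measurableT_comp (@measurable_dvoretzky_density R l x n) measurable_snd).
Qed.

Let mseq_sum q : mseq q (fun (_ : unit) s => (\sum_(t <- s) t)%R : mR).
Proof. by apply: mseq_big_seq; [exact: measurable_funD|exact: measurable_snd]. Qed.

Let mseq_conv q n g : test_function g ->
  mseq q (fun _ : unit => fun s => (g (\sum_(t <- s) t))%:E * (\prod_(t <- s) M n t)%R%:E).
Proof.
move=> tg; apply: (mseq_op2 (op := fun u v : \bar R => u * v)).
- exact: emeasurable_funM.
- apply: (@mseq_post _ _ _ _ _ mR _ _ (EFin \o g)) => //.
  by apply/measurable_EFinP; exact: measurable_test.
- exact: mseq_prodM.
Qed.

(** The integral of [g] against the [d]-th convolution of the measure with
    density [dvoretzky_density l x n]. *)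
Definition conv_integral d n g : \bar R := torus_integral d.+1 (fun s =>
  (g (\sum_(t <- s) t)%R)%:E * (\prod_(t <- s) dvoretzky_density l x n t)%R%:E).

Lemma conv_integralS d n g : test_function g ->
  conv_integral d.+1 n g = \int[lam]_(t in torus)
    (conv_integral d n (fun y => g (t + y)%R) * (dvoretzky_density l x n t)%:E).
Proof.
move=> tg; rewrite /conv_integral [in LHS]torus_integralS.
apply: eq_integral => t _; rewrite muleC -ge0_torus_integralZl.
- apply: eq_torus_integral => s _ _; rewrite !big_cons EFinM.
  by rewrite muleCA.
- by move=> s; rewrite mule_ge0// lee_fin ?test_ge0// prodM_ge0.
- exact: (mseq_conv _ _ (test_translate t tg)).
- by rewrite lee_fin M_ge0.
Qed.

Definition mass n : \bar R := \int[lam]_(t in torus) (dvoretzky_density l x n t)%:E.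

Let prodM_E0 n (s : seq R) : 0 <= (\prod_(t <- s) M n t)%R%:E.
Proof. by rewrite lee_fin prodM_ge0. Qed.

Lemma total_mass_le q n (b : R) : mass n <= b%:E ->
  torus_integral q (fun s => (\prod_(t <- s) dvoretzky_density l x n t)%R%:E)
    <= (b ^+ q)%:E.
Proof.
move=> nb; have mass0 : 0 <= mass n.
  by apply: integral_ge0 => t _; rewrite lee_fin M_ge0.
have b0 : (0 <= b)%R by rewrite -lee_fin (le_trans mass0).
elim: q => [|q IH]; first by rewrite /= big_nil.
rewrite torus_integralS.
set I := torus_integral q _ in IH.
have I0 : 0 <= I by exact: torus_integral_ge0.
rewrite (eq_integral (fun t : mR => (M n t)%:E * I)); last first.
  move=> t _; rewrite -(@ge0_torus_integralZl _ q _ (M n t)%:E (prodM_E0 n) (@mseq_prodM q n _ unit))//.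
    by apply: eq_torus_integral => s _ _; rewrite big_cons EFinM.
  by rewrite lee_fin M_ge0.
rewrite ge0_integralZr//; last 3 first.
- exact: measurable_torus.
- exact: measurable_funTS.
- by move=> t _; rewrite lee_fin M_ge0.
by rewrite exprS EFinM; apply: lee_pmul.
Qed.

Lemma conv_integral_le_add d n g h (c b : R) :
  test_function g -> test_function h -> (0 <= c)%R -> (forall y, g y <= h y + c)%R ->
  mass n <= b%:E ->
  conv_integral d n g <= conv_integral d n h + (c * b ^+ d.+1)%:E.
Proof.
move=> tg th c0 gh nb.
apply: (@le_trans _ _ (conv_integral d n h + c%:E * torus_integral d.+1
    (fun s => (\prod_(t <- s) dvoretzky_density l x n t)%R%:E))); last first.
  rewrite leeD2l// EFinM; apply: lee_wpmul2l; first by rewrite lee_fin.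
  exact: total_mass_le.
have cM0 s : 0 <= c%:E * (\prod_(t <- s) M n t)%R%:E.
  by rewrite mule_ge0// lee_fin// prodM_ge0.
rewrite -(@ge0_torus_integralZl _ d.+1 _ c%:E (prodM_E0 n) (@mseq_prodM d.+1 n _ unit))//.
rewrite -torus_integralD//; last 3 first.
- by move=> s; rewrite mule_ge0// lee_fin ?test_ge0// prodM_ge0.
- exact: mseq_conv.
- apply: (mseq_op2 (op := fun u v : \bar R => u * v) (F := fun _ _ => c%:E)).
  + exact: emeasurable_funM.
  + exact: mseq_param.
  + exact: mseq_prodM.
apply: (le_torus_integral _ _).1 => s _ _.
  by rewrite mule_ge0// lee_fin ?test_ge0// prodM_ge0.
rewrite -!EFinM -EFinD lee_fin -mulrDl ler_wpM2r// ?prodM_ge0//.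
Qed.

Variable mu : {finite_measure set mR -> \bar R}.
Hypothesis mu_torus : mu (~` torus) = 0.
Hypothesis mu_cvg : weak_cvg_torus (dvoretzky_approx x l01) mu.

Lemma integral_approx n g : test_function g ->
  \int[dvoretzky_approx x l01 n]_(t in torus) (g t)%:E =
  \int[lam]_(t in torus) ((g t)%:E * (dvoretzky_density l x n t)%:E).
Proof.
move=> tg; pose r : mR -> R := (M n) \_ (torus : set mR).
have r0 t : (0 <= r t)%R by rewrite /r patchE; case: ifP.
have mg : measurable_fun setT (fun t : mR => (g t)%:E).
  by apply/measurable_EFinP; exact: measurable_test.
have mr : measurable_fun setT r.
  apply/(measurable_restrictT _ _).1; first exact: measurable_torus.
  by apply: measurable_funTS; exact: measurable_dvoretzky_density.
rewrite integral_mkcond (@ge0_integral_density _ _ _ lam _ r r0 mr).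
- rewrite [RHS]integral_mkcond; apply: eq_integral => t _.
  by rewrite /r !patchE; case: ifP; rewrite ?mul0e.
- move=> A mA; transitivity (\int[lam]_(t in A `&` torus) (M n t)%:E) => //.
  rewrite integral_mkcondr.
  by apply: eq_integral => t _; rewrite /r !patchE; case: ifP.
- apply/(measurable_restrictT _ _).1; first exact: measurable_torus.
  exact: measurable_funTS.
- by move=> t; apply: erestrict_ge0 => u _; rewrite lee_fin test_ge0.
Qed.

Definition eventually_nat (Q : nat -> Prop) := exists n0, forall n, (n0 <= n)%N -> Q n.

Lemma eventually_nat_and (Q1 Q2 : nat -> Prop) :
  eventually_nat Q1 -> eventually_nat Q2 -> eventually_nat (fun n => Q1 n /\ Q2 n).
Proof.
move=> [n1 H1] [n2 H2]; exists (maxn n1 n2) => n; rewrite geq_max => /andP[n1n n2n].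
by split; [exact: H1|exact: H2].
Qed.

Lemma eventually_nat_fin k (Q : nat -> nat -> Prop) :
  (forall i, (i < k)%N -> eventually_nat (Q i)) ->
  eventually_nat (fun n => forall i, (i < k)%N -> Q i n).
Proof.
elim: k => [|k IH] H; first by exists 0%N.
have H1 := IH (fun i ik => H i (ltnW ik)).
have [n0 H2] := eventually_nat_and H1 (H k (leqnn _)).
exists n0 => n /H2[Qi Qk] i; rewrite ltnS leq_eqVlt => /orP[/eqP->//|]; exact: Qi.
Qed.

Lemma integral_mu_torus g : test_function g ->
  \int[mu]_(t in torus) (g t)%:E = \int[mu]_t (g t)%:E.
Proof.
move=> tg; rewrite [RHS](@ge0_negligible_integral _ _ _ mu setT (~` torus))//.
- by rewrite setDE setTI setCK.
- by apply: measurableC; exact: measurable_torus.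
- by apply/measurable_EFinP; exact: measurable_test.
- by move=> t _; rewrite lee_fin test_ge0.
Qed.

Lemma weak_cvg_eventually g (e : R) : test_function g -> (0 < e)%R ->
  eventually_nat (fun n =>
    \int[mu]_t (g t)%:E <= \int[lam]_(t in torus)
        ((g t)%:E * (dvoretzky_density l x n t)%:E) + e%:E /\
    \int[lam]_(t in torus) ((g t)%:E * (dvoretzky_density l x n t)%:E)
      <= \int[mu]_t (g t)%:E + e%:E).
Proof.
move=> tg e0.
have := mu_cvg (test_continuous tg) (test_periodic tg).
rewrite integral_mu_torus//.
have L0 : 0 <= \int[mu]_t (g t)%:E.
  by apply: integral_ge0 => t _; rewrite lee_fin test_ge0.
have LE : \int[mu]_t (g t)%:E = (fine (\int[mu]_t (g t)%:E))%:E.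
  by rewrite fineK// ge0_fin_numE// integral_test_fin.
rewrite LE => /fine_cvgP[[n1 _ H1]] /cvgrPdist_le/(_ _ e0)[n2 _ H2].
exists (maxn n1 n2) => n; rewrite geq_max => /andP[n1n n2n].
have f1 := H1 n n1n; have /= := H2 n n2n; rewrite ler_norml => /andP[H3 H4].
rewrite -integral_approx// -(fineK f1) -!EFinD !lee_fin; split; lra.
Qed.

Lemma test_cst (c : R) : (0 <= c)%R -> test_function (fun=> c).
Proof.
move=> c0; split => //; first by exists c.
by move=> e e0; exists 1%R => // y z _; rewrite lerDl ltW.
Qed.

Lemma mass_eventually : exists2 b : R, (0 <= b)%R & eventually_nat (fun n => mass n <= b%:E).
Proof.
have [n0 H] := weak_cvg_eventually (test_cst ler01) ltr01.
exists (fine (mu setT) + 1)%R; first by rewrite addr_ge0// fine_ge0.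
exists n0 => n /H[_]; rewrite integral_cst// mul1e.
under eq_integral do rewrite mul1e.
by rewrite EFinD fineK// fin_num_measure.
Qed.

(** The estimate is uniform in the translation [a] although the hypothesis is not:
    it is used for the finitely many translations by multiples of [1 / N], and the
    others are compared with the nearest of them, the masses being bounded. *)
Lemma smoothing_eventually d (nu : {finite_measure set mR -> \bar R}) :
  (forall g e, test_function g -> (0 < e)%R -> eventually_nat (fun n =>
     \int[nu]_y (g y)%:E <= conv_integral d n g + e%:E)) ->
  forall g e, test_function g -> (0 < e)%R -> eventually_nat (fun n =>
     forall a, torus a ->
     (smoothing nu g a)%:E <= conv_integral d n (fun y => g (a + y)%R) + e%:E).
Proof.
move=> H g e tg e0; have [b b0 mb] := mass_eventually.
have nuE : nu setT = (fine (nu setT))%:E by rewrite fineK// fin_num_measure.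
have nu0 : (0 <= fine (nu setT))%R by exact: fine_ge0.
pose K := (fine (nu setT) + b ^+ d.+1 + 1)%R.
have bd0 : (0 <= b ^+ d.+1)%R by rewrite exprn_ge0.
have K0 : (0 < K)%R by rewrite /K; lra.
have c0 : (0 < e / 2 / K)%R by rewrite !divr_gt0.
have [r r0 ur] := test_uniform tg c0.
(* Translations that differ by less than 1 / N change g by at most
   e / 2 / K, and K bounds the sum of the masses of nu and of the
   approximations. *)
pose N := (Num.truncn r^-1).+1.
have Nr : (r^-1 < N%:R)%R by rewrite truncnS_gt.
have N0 : (0 < N%:R :> R)%R by rewrite ltr0n.
have e20 : (0 < e / 2)%R by rewrite divr_gt0.
have := @eventually_nat_fin N (fun i n => \int[nu]_y (g (i%:R / N%:R + y)%R)%:E <=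
  conv_integral d n (fun y => g (i%:R / N%:R + y)%R) + (e / 2)%:E).
case/(_ (fun i _ => H _ _ (test_translate _ tg) e20)) => n1 H1.
have [n2 H2] := mb; exists (maxn n1 n2) => n.
rewrite geq_max => /andP[n1n n2n] a; rewrite torusE => /andP[a0 a1].
have aN0 : (0 <= a * N%:R)%R by rewrite mulr_ge0// ltW.
have /andP[i1 i2] := truncn_itv aN0; set i := Num.truncn _ in i1 i2.
have iN : (i < N)%N.
  by rewrite -(ltr_nat R); apply: le_lt_trans i1 _; rewrite gtr_pMl.
have ai : (`|a - i%:R / N%:R| < r)%R.
  have rN : (1 < r * N%:R)%R by rewrite -ltr_pdivrMl// mulr1.
  rewrite ger0_norm; last by rewrite subr_ge0 ler_pdivrMr.
  rewrite -(ltr_pM2r N0) mulrBl divfK ?gt_eqF//.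
  by rewrite -natr1 in i2; lra.
have ai' : (`|i%:R / N%:R - a| < r)%R by rewrite distrC.
have gi (u v : R) : (`|u - v| < r)%R ->
    (forall y, g (u + y)%R <= g (v + y)%R + e / 2 / K)%R.
  by move=> uv y; apply: ur; rewrite opprD addrACA subrr addr0.
rewrite smoothingE//.
apply: le_trans (integral_test_le_add nu (test_translate a tg)
  (test_translate (i%:R / N%:R) tg) (ltW c0) (gi _ _ ai)) _.
apply: le_trans (leeD (H1 _ n1n i iN) (lexx _)) _.
apply: le_trans (leeD (leeD (conv_integral_le_add d (test_translate (i%:R / N%:R) tg)
  (test_translate a tg) (ltW c0) (gi _ _ ai') (H2 _ n2n)) (lexx _)) (lexx _)) _.
move: (conv_integral d n (fun y => g (a + y)%R)) => CI.
rewrite nuE -!addeA; apply: leeD2l; rewrite -!EFinM -!EFinD lee_fin.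
rewrite addrCA -mulrDr.
have : (e / 2 / K * (b ^+ d.+1 + fine (nu setT)) <= e / 2)%R.
  by rewrite mulrAC ler_pdivrMr// ler_wpM2l ?(ltW e20)// /K; lra.
lra.
Qed.

(** The convolution with one more factor is integrated by smoothing the test function with the
    limit of the other factors, then comparing with the approximations first in
    the remaining factor and then in the smoothing. *)
Lemma conv_pow_eventually d g (e : R) : test_function g -> (0 < e)%R ->
  eventually_nat (fun n =>
    \int[torus_conv_pow d mu]_y (g y)%:E <= conv_integral d n g + e%:E).
Proof.
elim: d g e => [|d IH] g e tg e0.
  have [n0 H] := weak_cvg_eventually tg e0; exists n0 => n /H[+ _].
  rewrite /conv_integral /=; congr (_ <= _ + _).
  by apply: eq_integral => t _; rewrite !big_cons !big_nil addr0 mulr1.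
have tG := test_smoothing (torus_conv_pow d mu) tg.
have [b b0 mb] := mass_eventually.
have e20 : (0 < e / 2)%R by rewrite divr_gt0.
have b1 : (0 < b + 1)%R by rewrite ltr_wpDl.
have c0 : (0 < e / 2 / (b + 1))%R by rewrite divr_gt0.
have [n1 H1] := weak_cvg_eventually tG e20.
have [n2 H2] := smoothing_eventually IH tg c0.
have [n3 H3] := mb.
exists (maxn n1 (maxn n2 n3)) => n; rewrite !geq_max => /and3P[n1n n2n n3n].
rewrite integral_torus_conv//; apply: le_trans (H1 _ n1n).1 _.
rewrite conv_integralS//.
have CI0 t : 0 <= conv_integral d n (fun y => g (t + y)%R).
  by apply: torus_integral_ge0 => s; rewrite mule_ge0// lee_fin ?test_ge0// prodM_ge0.
set c := (e / 2 / (b + 1))%R in c0 H2.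
apply: (@le_trans _ _ (\int[lam]_(t in torus) (conv_integral d n (fun y => g (t + y)%R) *
   (M n t)%:E + c%:E * (M n t)%:E) + (e / 2)%:E)).
  rewrite leeD2r//; apply: ge0_le_integral_nonmeas => t tT.
    by rewrite mule_ge0// lee_fin ?M_ge0// test_ge0.
  rewrite -ge0_muleDl//; last by rewrite lee_fin ltW.
  by apply: lee_wpmul2r; [rewrite lee_fin M_ge0|exact: H2].
have mCI : measurable_fun setT (fun t : mR => conv_integral d n (fun y => g (t + y)%R)).
  apply: measurable_torus_integral.
    by move=> t s; rewrite mule_ge0// lee_fin ?test_ge0// prodM_ge0.
  apply: (mseq_op2 (op := fun u v : \bar R => u * v)).
  - exact: emeasurable_funM.
  - apply: (@mseq_post _ _ _ _ _ mR _ _ (EFin \o g)).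
      by apply/measurable_EFinP; exact: measurable_test.
    apply: (mseq_op2 (op := fun u v : mR => (u + v)%R : mR) (F := fun (t : mR) _ => t)
      (G := fun (t : mR) s => (\sum_(u <- s) u)%R : mR)).
    + exact: measurable_funD.
    + exact: (mseq_param d.+1 (@measurable_id _ mR setT)).
    + by apply: (mseq_reparam (phi := fun _ : mR => tt) _ (@mseq_sum _)).
  - exact: mseq_prodM.
rewrite ge0_integralD//; last 5 first.
- exact: measurable_torus.
- by move=> t _; rewrite mule_ge0// lee_fin M_ge0.
- by apply: measurable_funTS; exact: emeasurable_funM.
- by move=> t _; rewrite mule_ge0// lee_fin ?M_ge0// ltW.
- by apply: measurable_funTS; apply: emeasurable_funM.
rewrite -addeA leeD2l// ge0_integralZl//; last 4 first.
- exact: measurable_torus.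
- exact: measurable_funTS.
- by move=> t _; rewrite lee_fin M_ge0.
- by rewrite lee_fin ltW.
apply: (@le_trans _ _ (c%:E * b%:E + (e / 2)%:E)).
  by rewrite leeD2r//; apply: lee_wpmul2l; [rewrite lee_fin ltW|exact: H3].
rewrite -EFinM -EFinD lee_fin.
have : (c * b <= e / 2)%R.
  by rewrite /c mulrAC ler_pdivrMr// ler_wpM2l ?(ltW e20)//; lra.
lra.
Qed.

End convolutions_of_the_approximations.

(** * Energy bounds the convolution *)

Section energy_controls_the_convolution.
Context {R : realType}.
Local Notation mR := (measurableTypeR R).
Local Notation lam := (@lebesgue_measure R).
Local Open Scope ereal_scope.

(** Whether [y] lies in the arc of length [e] that starts at [S]; the density of a
    measure averaged over such arcs replaces the measure below. *)
Definition right_near (e y S : R) : bool := (mod1 (y - S) < e)%R.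

Lemma measurable_right_near d (T : measurableType d) e (f h : T -> mR) :
  measurable_fun setT f -> measurable_fun setT h ->
  measurable_fun setT (fun p : T => ((right_near e (f p) (h p))%:R)%:E : \bar R).
Proof.
move=> mf mh.
have m1 : measurable_fun setT (fun p => mod1 (f p - h p) : mR).
  by apply: measurableT_comp; [exact: measurable_mod1|exact: measurable_funB].
have m2 := @measurable_boolr R (fun u => (u < e)%R).
apply: (measurableT_comp (m2 _) m1).
exact: measurable_fun_ltr.
Qed.

Lemma integral_right_near e S : (0 < e <= 1)%R ->
  \int[lam]_(y in torus) ((right_near e y S)%:R)%:E = e%:E.
Proof.
move=> /andP[e0 e1].
rewrite -(@torus_translation _ (fun y => ((right_near e y S)%:R)%:E) S); last 2 first.
- by apply: measurable_right_near => //; exact: measurable_cst.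
- by move=> y; rewrite lee_fin.
have le : lam `[0%R, e[%classic = e%:E.
  by rewrite lebesgue_measure_itv/= lte_fin e0 sube0.
rewrite -[RHS]le -(setIidl (_ : `[0%R, e[%classic `<=` torus)); last first.
  by move=> y; rewrite /torus/= !in_itv/=; lra.
rewrite -integral_indic//; last exact: measurable_torus.
apply: eq_integral => y; rewrite inE torusE => y01; rewrite indicE.
rewrite /right_near mod1Dl addrAC subrr add0r mod1_id//.
congr ((nat_of_bool _)%:R%:E); apply/idP/idP => [ye|/set_mem/=].
  by apply/mem_set; rewrite /= in_itv/= ye; case/andP: y01 => ->.
by rewrite in_itv/= => /andP[].
Qed.

(** Two arcs of length [e] with a common point start at points at distance at most
    [e]; hence the energy bounds the square of the averaged densities. *)
Lemma right_near2 e y S S' : right_near e y S -> right_near e y S' ->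
  (tnorm (S - S') <= e)%R.
Proof.
move=> h h'; apply: (le_trans (tnorm_le _ (Num.floor (y - S') - Num.floor (y - S)))).
have -> : (S - S' - (Num.floor (y - S') - Num.floor (y - S))%:~R =
    mod1 (y - S') - mod1 (y - S))%R.
  by rewrite intrB /mod1; ring.
have := mod1_ge0 (y - S); have := mod1_ge0 (y - S').
move: h h'; rewrite /right_near ler_norml => *; apply/andP; split; lra.
Qed.

Lemma integral_right_near2 e S S' : (0 < e <= 1)%R ->
  \int[lam]_(y in torus) (((right_near e y S)%:R)%:E * ((right_near e y S')%:R)%:E)
    <= e%:E * ((tnorm (S - S') <= e)%R%:R)%:E.
Proof.
move=> e01; have [SS|SS] := boolP (tnorm (S - S') <= e)%R.
  rewrite mule1 -(integral_right_near S e01).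
  apply: ge0_le_integral_nonmeas => y _; first by rewrite mule_ge0.
  by rewrite -EFinM lee_fin; case: (right_near e y S'); rewrite ?mulr1 ?mulr0.
rewrite mule0 integral0_eq// => y _.
case: (boolP (right_near e y S)) => [h|_]; last by rewrite mul0e.
case: (boolP (right_near e y S')) => [h'|_]; last by rewrite mule0.
by rewrite (right_near2 h h') in SS.
Qed.

Lemma lincomb_balanced d (s : seq R) : size s = d.*2.+2 ->
  lincomb (balanced d) s =
  (\sum_(t <- take d.+1 s) t - \sum_(t <- drop d.+1 s) t)%R.
Proof.
have H c k (u : seq R) : size u = k ->
    lincomb (nseq k c) u = (c%:~R * \sum_(t <- u) t)%R.
  move=> <-; elim: u => [|t u IH]; first by rewrite /lincomb !big_nil mulr0.
  by rewrite /lincomb /= !big_cons -/(lincomb _ _) IH mulrDr.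
move=> sd; have st : size (take d.+1 s) = d.+1 by rewrite size_takel// sd; lia.
have sdr : size (drop d.+1 s) = d.+1 by rewrite size_drop sd; lia.
rewrite -[in LHS](cat_take_drop d.+1 s) /lincomb /balanced zip_cat ?size_nseq ?st//.
rewrite big_cat -/(lincomb (nseq d.+1 1%Z) _) -/(lincomb (nseq d.+1 (-1)%Z) _).
by rewrite !H// mul1r mulN1r.
Qed.

Variable l : nat -> R.
Hypothesis l01 : forall n, (1 <= n)%N -> (0 < l n < 1)%R.
Variable x : nat -> R.
Implicit Types g h : R -> R.

Let M n t := dvoretzky_density l x n t.

Let prodM_ge0 n (s : seq R) : 0 <= (\prod_(t <- s) M n t)%R%:E.
Proof. by rewrite lee_fin; apply: prodr_ge0 => t _; exact: dvoretzky_density_ge0. Qed.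

Let mseq_prodM q n d (T : measurableType d) :
  mseq q (fun (_ : T) s => (\prod_(t <- s) M n t)%R%:E).
Proof.
apply: (@mseq_post _ _ _ _ _ mR _ _ EFin); first exact: EFin_measurable.
apply: mseq_big_seq; first exact: measurable_funM.
exact: (measurableT_comp (@measurable_dvoretzky_density R l x n) measurable_snd).
Qed.

Let Q e n (y : mR) (s : seq R) : \bar R :=
  ((right_near e y (\sum_(t <- s) t)%R)%:R)%:E * (\prod_(t <- s) M n t)%R%:E.

Let Q0 e n y s : 0 <= Q e n y s.
Proof. by rewrite mule_ge0// lee_fin. Qed.

Let mseq_near q e :
  mseq q (fun (y : mR) s => ((right_near e y (\sum_(t <- s) t)%R)%:R)%:E : \bar R).
Proof.
apply: (mseq_op2 (op := fun u v : mR => ((right_near e u v)%:R)%:E : \bar R)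
  (F := fun (y : mR) _ => y) (G := fun _ s => (\sum_(t <- s) t)%R : mR)).
- exact: measurable_right_near.
- exact: (mseq_param q (@measurable_id _ mR setT)).
- by apply: mseq_big_seq; [exact: measurable_funD|exact: measurable_snd].
Qed.

Let mseq_Q q e n : mseq q (Q e n).
Proof.
apply: (mseq_op2 (op := fun u v : \bar R => u * v)).
- exact: emeasurable_funM.
- exact: mseq_near.
- exact: mseq_prodM.
Qed.

(** Up to the factor [1 / e], the density at [y] of the convolution of the
    approximations averaged over arcs of length [e]. *)
Let D d e n (y : mR) : \bar R := torus_integral d.+1 (Q e n y).

Let D0 d e n y : 0 <= D d e n y.
Proof. exact: torus_integral_ge0. Qed.

Let mD d e n : measurable_fun setT (D d e n).
Proof. exact: measurable_torus_integral. Qed.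

Let mask_b d := nseq d.+1 true ++ nseq d.+1 false.

(** The square is an integral over pairs of families of points, both sums of which
    are within [e] before [y]; integrating in [y] first leaves the constraint of
    the energy. *)
Lemma integral_sqr_le_energy d e n : (0 < e <= 1)%R ->
  \int[lam]_(y in torus) (D d e n y * D d e n y) <= e%:E * energy l d x n e.
Proof.
move=> e01; have /andP[e0 e1] := e01.
have cb : count id (mask_b d) = d.+1.
  by rewrite count_cat !count_nseq /= mul1n mul0n addn0.
have cnb : count negb (mask_b d) = d.+1.
  by rewrite count_cat !count_nseq /= mul1n mul0n.
have sb : size (mask_b d) = d.*2.+2 by rewrite size_cat !size_nseq; lia.
pose G y s := Q e n y (mask (mask_b d) s) * Q e n y (mask (map negb (mask_b d)) s).
have G0 y s : 0 <= G y s by rewrite mule_ge0.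
have mG : mseq d.*2.+2 G.
  apply: (mseq_op2 (op := fun u v : \bar R => u * v)).
  - exact: emeasurable_funM.
  - by rewrite -sb; apply: mseq_mask; rewrite cb; exact: mseq_Q.
  - by rewrite -sb -(size_map negb); apply: mseq_mask; exact: mseq_Q.
rewrite (eq_integral (fun y : mR => torus_integral d.*2.+2 (G y))); last first.
  move=> y _; rewrite -sb (torus_integral_mask y (Q0 e n) (Q0 e n)).
  - by rewrite cb cnb.
  - by rewrite cb; exact: mseq_Q.
  - by rewrite cnb; exact: mseq_Q.
rewrite torus_integral_swap_torus// /energy -ge0_torus_integralZl; last 3 first.
- by move=> s; rewrite mule_ge0// lee_fin.
- apply: (mseq_op2 (op := fun u v : \bar R => u * v)).
  + exact: emeasurable_funM.
  + exact: mseq_prodM.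
  + apply: (@mseq_post _ _ _ _ _ mR _ _ EFin); first exact: EFin_measurable.
    by apply: mseq_near_integer; exact: size_balanced.
- by rewrite lee_fin ltW.
apply: (le_torus_integral _ _).1 => s ss sT; first exact: integral_ge0.
have st : size (take d.+1 s) = d.+1 by rewrite size_takel// ss; lia.
have sdr : size (drop d.+1 s) = d.+1 by rewrite size_drop ss; lia.
have m1 : mask (mask_b d) s = take d.+1 s.
  rewrite -[in LHS](cat_take_drop d.+1 s) mask_cat ?size_nseq ?st//.
  by rewrite mask_false cats0 mask_true// st.
have m2 : mask (map negb (mask_b d)) s = drop d.+1 s.
  rewrite -[in LHS](cat_take_drop d.+1 s) /mask_b map_cat !map_nseq.
  by rewrite mask_cat ?size_nseq ?st// mask_false mask_true// sdr.
set S := (\sum_(t <- take d.+1 s) t)%R; set S' := (\sum_(t <- drop d.+1 s) t)%R.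
have -> : (\prod_(t <- s) dvoretzky_density l x n t)%R%:E =
    (\prod_(t <- take d.+1 s) M n t)%R%:E * (\prod_(t <- drop d.+1 s) M n t)%R%:E.
  by rewrite -EFinM -big_cat cat_take_drop.
rewrite (eq_integral (fun y : mR =>
    ((\prod_(t <- take d.+1 s) M n t)%R%:E * (\prod_(t <- drop d.+1 s) M n t)%R%:E) *
    (((right_near e y S)%:R)%:E * ((right_near e y S')%:R)%:E))); last first.
  by move=> y _; rewrite /G /Q m1 m2 muleACA muleC.
rewrite ge0_integralZl//.
- rewrite lincomb_balanced// muleCA; apply: lee_wpmul2l; first exact: mule_ge0.
  exact: integral_right_near2.
- exact: measurable_torus.
- apply: measurable_funTS; apply: emeasurable_funM;
    by apply: measurable_right_near => //; exact: measurable_cst.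
- exact: mule_ge0.
Qed.

(** If [g] oscillates by at most [c] at scale [e], then [g S] is at most the average
    of [g + c] on the arc of length [e] that starts at [S], so that the integral
    of [g] is at most that of [(g + c) * D / e]. Young's inequality then separates
    [g] from [D]. *)
Lemma conv_integral_le_energy d n g (e eta c b : R) :
  test_function g -> (0 < e <= 1)%R -> (0 < eta)%R -> (0 <= c)%R ->
  (forall u v, `|u - v| < e -> g u <= g v + c)%R ->
  mass l x n <= b%:E ->
  conv_integral l x d n g <= (c * b ^+ d.+1)%:E +
    ((eta / 2)%:E * \int[lam]_(y in torus) (g y ^+ 2)%:E +
     ((2 * eta * e)^-1)%:E * energy l d x n e).
Proof.
move=> tg e01 eta0 c0 osc nb; have /andP[e0 e1] := e01.
have mg : measurable_fun setT (fun y : mR => (g y)%:E).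
  by apply/measurable_EFinP; exact: measurable_test.
pose a (y : mR) : R := (e^-1 * (g y + c))%R.
have a0 y : (0 <= a y)%R.
  by rewrite mulr_ge0 ?invr_ge0 ?(ltW e0)// addr_ge0// test_ge0.
have ma : measurable_fun setT (fun y => (a y)%:E).
  apply/measurable_EFinP; apply: measurable_funM => //.
  by apply: measurable_funD => //; exact: measurable_test.
have smooth S : (g S)%:E <=
    \int[lam]_(y in torus) ((a y)%:E * ((right_near e y S)%:R)%:E).
  have -> : (g S)%:E = \int[lam]_(y in torus)
      ((e^-1 * g S)%:E * ((right_near e y S)%:R)%:E).
    rewrite ge0_integralZl//; last 3 first.
    - exact: measurable_torus.
    - apply: measurable_funTS.
      by apply: measurable_right_near => //; exact: measurable_cst.
    - by rewrite lee_fin mulr_ge0 ?(test_ge0 tg)// invr_ge0 ltW.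
    by rewrite integral_right_near// -EFinM mulrAC mulVf ?mul1r// gt_eqF.
  apply: ge0_le_integral_nonmeas => y _.
    by rewrite mule_ge0// lee_fin mulr_ge0 ?(test_ge0 tg)// invr_ge0 ltW.
  case: (boolP (right_near e y S)) => [|_]; last by rewrite !mule0.
  rewrite !mule1 /right_near lee_fin ler_pM2l ?invr_gt0// => h.
  rewrite -(test_periodicz (- Num.floor (y - S)) y tg); apply: osc.
  rewrite mulrNz (_ : _ - _ = - mod1 (y - S))%R; last by rewrite /mod1; ring.
  by rewrite normrN ger0_norm// mod1_ge0.
have aQ0 y s : 0 <= (a y)%:E * Q e n y s by rewrite mule_ge0// lee_fin.
have maQ : mseq d.+1 (fun y s => (a y)%:E * Q e n y s).
  apply: (mseq_op2 (op := fun u v : \bar R => u * v) (F := fun (y : mR) _ => (a y)%:E)).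
  - exact: emeasurable_funM.
  - exact: mseq_param.
  - exact: mseq_Q.
have step1 : conv_integral l x d n g <= \int[lam]_(y in torus) ((a y)%:E * D d e n y).
  rewrite (eq_integral (fun y : mR => torus_integral d.+1 (fun s => (a y)%:E * Q e n y s))); last first.
    move=> y _; rewrite ge0_torus_integralZl//.
      by apply: (mseq_reparam (phi := fun _ : unit => y) _ (mseq_Q _ _ _)).
    by rewrite lee_fin.
  rewrite (torus_integral_swap_torus aQ0 maQ).
  apply: (le_torus_integral _ _).1 => s _ _.
    by rewrite mule_ge0// lee_fin test_ge0.
  have := lee_wpmul2r (prodM_ge0 n s) (smooth (\sum_(t <- s) t)%R) => /le_trans; apply.
  rewrite -ge0_integralZr//; last 3 first.
  - exact: measurable_torus.
  - apply: measurable_funTS; apply: emeasurable_funM => //.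
    by apply: measurable_right_near => //; exact: measurable_cst.
  - by move=> y _; rewrite mule_ge0// lee_fin.
  by under eq_integral do rewrite -muleA.
have intD : \int[lam]_(y in torus) D d e n y <= e%:E * (b ^+ d.+1)%:E.
  rewrite /D torus_integral_swap_torus//.
  have -> : torus_integral d.+1 (fun s => \int[lam]_(y in torus) Q e n y s) =
      e%:E * torus_integral d.+1 (fun s => (\prod_(t <- s) M n t)%R%:E).
    rewrite -(@ge0_torus_integralZl _ d.+1 _ e%:E (prodM_ge0 n) (@mseq_prodM d.+1 n _ unit)).
      apply: eq_torus_integral => s _ _; rewrite ge0_integralZr//.
      - by rewrite integral_right_near.
      - exact: measurable_torus.
      - apply: measurable_funTS.
        by apply: measurable_right_near => //; exact: measurable_cst.
    by rewrite lee_fin ltW.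
  apply: lee_wpmul2l; first by rewrite lee_fin ltW.
  exact: total_mass_le.
apply: (le_trans step1).
pose k : R := ((2 * eta * e ^+ 2)^-1)%R.
have k0 : (0 <= k)%R by rewrite invr_ge0 !mulr_ge0 ?exprn_ge0 ?ltW.
apply: (@le_trans _ _ (\int[lam]_(y in torus) ((e^-1 * c)%:E * D d e n y +
    ((eta / 2)%:E * (g y ^+ 2)%:E + k%:E * (D d e n y * D d e n y))))).
  apply: ge0_le_integral_nonmeas => y _; first by rewrite mule_ge0// lee_fin.
  rewrite /a mulrDr EFinD ge0_muleDl; last 2 first.
  - by rewrite lee_fin mulr_ge0 ?(test_ge0 tg)// invr_ge0 ltW.
  - by rewrite lee_fin mulr_ge0// invr_ge0 ltW.
  rewrite addeC; apply: leeD => //.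
  have := D0 d e n y; case: (D d e n y) => [r r0| _ |//]; last first.
    have kp : (0 < k)%R by rewrite invr_gt0 !mulr_gt0 ?exprn_gt0.
    by rewrite mulyy (@gt0_muley _ k%:E) ?lte_fin// addey// leey.
  rewrite -!EFinM -EFinD lee_fin -subr_ge0.
  (* Young's inequality, as a square. *)
  rewrite (_ : _ - _ = (eta * g y - e^-1 * r) ^+ 2 / (2 * eta))%R.
    by apply: divr_ge0; [exact: sqr_ge0|apply: mulr_ge0 => //; exact: ltW].
  by rewrite /k; field; rewrite !gt_eqF.
have mD' : measurable_fun (torus : set mR) (D d e n).
  by apply: measurable_funTS; exact: mD.
have mDD : measurable_fun (torus : set mR) (fun y => D d e n y * D d e n y).
  exact: emeasurable_funM.
have mg2 : measurable_fun (torus : set mR) (fun y : mR => (g y ^+ 2)%:E).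
  apply: measurable_funTS; apply/measurable_EFinP; apply: measurable_funX.
  exact: measurable_test.
have g20 y : 0 <= (g y ^+ 2)%:E :> \bar R by rewrite lee_fin sqr_ge0.
have DD0 y : 0 <= D d e n y * D d e n y by exact: mule_ge0.
have ec0 : (0 <= e^-1 * c)%R by rewrite mulr_ge0// invr_ge0 ltW.
have eta20 : (0 <= eta / 2)%R by rewrite divr_ge0// ltW.
have mZ (f : mR -> \bar R) (r : R) : measurable_fun (torus : set mR) f ->
    measurable_fun (torus : set mR) (fun y => r%:E * f y).
  by move=> mf; apply: emeasurable_funM.
have p1 y : 0 <= (e^-1 * c)%:E * D d e n y by rewrite mule_ge0// lee_fin.
have p2 y : 0 <= (eta / 2)%:E * (g y ^+ 2)%:E by rewrite mule_ge0// lee_fin.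
have p3 y : 0 <= k%:E * (D d e n y * D d e n y) by rewrite mule_ge0// lee_fin.
have mt := @measurable_torus R.
rewrite ge0_integralD//; [|exact: mZ|by move=> y _; exact: adde_ge0
  |by apply: emeasurable_funD; exact: mZ].
apply: leeD.
  rewrite ge0_integralZl//.
  apply: le_trans (lee_wpmul2l _ intD) _; first by rewrite lee_fin.
  by rewrite -!EFinM lee_fin mulrA [(_ * e)%R]mulrAC mulVf ?mul1r// gt_eqF.
rewrite ge0_integralD//; [|exact: mZ|exact: mZ].
apply: leeD; first by rewrite ge0_integralZl.
rewrite ge0_integralZl//.
apply: le_trans (lee_wpmul2l _ (integral_sqr_le_energy d n e01)) _.
  by rewrite lee_fin.
rewrite muleA -EFinM; apply: lee_wpmul2r; first exact: energy_ge0.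
rewrite lee_fin /k le_eqVlt; apply/orP; left; apply/eqP.
by field; rewrite !gt_eqF.
Qed.

End energy_controls_the_convolution.

(** * Absolute continuity *)

Section absolute_continuity.
Context {R : realType}.
Local Notation mR := (measurableTypeR R).
Local Notation lam := (@lebesgue_measure R).

Lemma null_cover (N : set mR) (e : R) : lam N = 0%E -> 0 < e ->
  exists c r : nat -> R, [/\ forall n, 0 <= r n,
    N `<=` \bigcup_n [set t | `|t - c n| <= r n] &
    forall k, \sum_(0 <= n < k) (2 * r n) <= e].
Proof.
move=> N0 e0.
have /ereal_inf_lt[z [/= A [mA NA] Az ze]] : (lam N < e%:E)%E.
  by rewrite N0 lte_fin.
have H n : exists p : R * R, [/\ 0 <= p.2, A n `<=` [set t | `|t - p.1| <= p.2] &
    (2 * p.2)%:E = wlength idfun (A n)].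
  have /ocitvP[->|[[a b] /= ab ->]] := mA n.
    exists (0, 0) => /=; split=> //.
    by rewrite mulr0 wlength0.
  exists ((a + b) / 2, (b - a) / 2) => /=; split.
  - by rewrite divr_ge0// subr_ge0 ltW.
  - by move=> t /=; rewrite in_itv/= ler_norml => /andP[at_ tb]; apply/andP; split; lra.
  - rewrite wlength_itv/= lte_fin ab -EFinD; congr EFin; lra.
have [p Hp] := choice H.
exists (fst \o p), (snd \o p); split.
- by move=> n; have [] := Hp n.
- apply: (subset_trans NA); apply: subset_bigcup => n _.
  by have [] := Hp n.
- move=> k; rewrite -lee_fin (le_trans _ (ltW ze))// -Az -sumEFin.
  rewrite (eq_bigr (fun n => wlength idfun (A n))); last first.
    by move=> n _; have [_ _ <-] := Hp n.
  apply: nneseries_lim_ge => n _ _; exact: wlength_ge0.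
Qed.

(** Equal to [1] on the arc of centre [c] and radius [r], to [0] outside the arc
    of radius [r + s], and affine in between. *)
Definition tent (c r s t : R) : R :=
  Num.max 0 (Num.min 1 (1 - (tnorm (t - c) - r) / s)).

Lemma tnorm_lipschitz (u v : R) : tnorm u <= tnorm v + `|u - v|.
Proof.
rewrite -lerBlDr; apply: lb_le_inf; first by exists `|v - 0%:~R|, 0.
move=> _ [n _ <-]; rewrite lerBlDr; apply: (le_trans (tnorm_le _ n)).
by rewrite [leRHS]addrC; exact: ler_distD.
Qed.

Lemma tent_ge0 c r s t : 0 <= tent c r s t.
Proof. by rewrite le_max lexx. Qed.

Lemma tent_eq1 c r s t : 0 < s -> tnorm (t - c) <= r -> tent c r s t = 1.
Proof.
move=> s0 tr; rewrite /tent min_l ?max_r// lerDl oppr_ge0.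
by rewrite pmulr_lle0 ?invr_gt0// subr_le0.
Qed.

Lemma tent_le c r s t : 0 < s -> tent c r s t <= (tnorm (t - c) <= r + s)%R%:R.
Proof.
move=> s0; rewrite /tent; have [h|h] := boolP (_ <= r + s).
  by rewrite ge_max ler01 ge_min lexx.
rewrite ge_max lexx ge_min; apply/orP; right.
rewrite -ltNge in h; rewrite subr_le0 ler_pdivlMr// mul1r; lra.
Qed.

Lemma tent_lipschitz c r s t u : 0 < s ->
  tent c r s t <= tent c r s u + `|t - u| / s.
Proof.
move=> s0; have d0 : 0 <= `|t - u| / s by rewrite divr_ge0// ltW.
have := tnorm_lipschitz (u - c) (t - c).
rewrite opprB addrA subrK distrC => H.
rewrite /tent ge_max; apply/andP; split.
  by rewrite addr_ge0// le_max lexx.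
rewrite addr_maxl le_max; apply/orP; right.
rewrite addr_minl le_min; apply/andP; split.
  by rewrite ge_min; apply/orP; left; rewrite lerDl.
rewrite ge_min; apply/orP; right.
have : (tnorm (u - c) - r) / s <= (tnorm (t - c) - r) / s + `|t - u| / s.
  by rewrite -mulrDl ler_pM2r ?invr_gt0//; lra.
lra.
Qed.

Lemma tent_periodic c r s t : tent c r s (t + 1) = tent c r s t.
Proof. by rewrite /tent addrAC -[1]/(1%:~R) tnormDz. Qed.

(** A continuous substitute for the indicator function of a finite union of arcs;
    the truncation at [1] makes its square at most the sum of the tents. *)
Definition tents (c r s : nat -> R) (k : nat) (t : R) : R :=
  Num.min 1 (\sum_(0 <= n < k) tent (c n) (r n) (s n) t).

Lemma sum_tents_ge0 c r s k t : 0 <= \sum_(0 <= n < k) tent (c n) (r n) (s n) t.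
Proof. by apply: sumr_ge0 => n _; exact: tent_ge0. Qed.

Lemma test_tents c r s k : (forall n, 0 < s n) -> test_function (tents c r s k).
Proof.
move=> s0; split.
- by move=> t; rewrite le_min ler01 sum_tents_ge0.
- by move=> t; rewrite /tents; under eq_bigr do rewrite tent_periodic.
- by exists 1 => // t; rewrite ge_min lexx.
- move=> e e0; pose L := \sum_(0 <= n < k) (s n)^-1.
  have L0 : 0 <= L by apply: sumr_ge0 => n _; rewrite invr_ge0 ltW.
  exists (e / (L + 1)); first by rewrite divr_gt0// ltr_wpDl.
  move=> t u tu; rewrite /tents addr_minl le_min; apply/andP; split.
    by rewrite ge_min lerDl (ltW e0).
  rewrite ge_min; apply/orP; right.
  apply: (@le_trans _ _ (\sum_(0 <= n < k)
      (tent (c n) (r n) (s n) u + `|t - u| * (s n)^-1))).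
    by apply: ler_sum => n _; exact: tent_lipschitz.
  rewrite big_split/= lerD2l -mulr_sumr -/L.
  rewrite ltr_pdivlMr ?ltr_wpDl// in tu.
  apply: le_trans (ltW tu); rewrite ler_wpM2l// lerDl//.
Qed.

Local Open Scope ereal_scope.

Lemma integral_tents_sqr c r s k : (forall n, 0 <= r n)%R -> (forall n, 0 < s n)%R ->
  \int[lam]_(t in torus) (tents c r s k t ^+ 2)%:E <=
  (\sum_(0 <= n < k) 6 * (r n + s n))%R%:E.
Proof.
move=> r0 s0.
apply: (@le_trans _ _ (\int[lam]_(t in torus) \sum_(0 <= n < k)
    ((tnorm (t - c n) <= r n + s n)%R%:R)%:E)).
  apply: ge0_le_integral_nonmeas => t _; first by rewrite lee_fin sqr_ge0.
  have f0 := test_ge0 (test_tents c r k s0) t.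
  rewrite sumEFin lee_fin; apply: (@le_trans _ _ (tents c r s k t)).
    by rewrite expr2 ler_piMl// ge_min lexx.
  apply: (@le_trans _ _ (\sum_(0 <= n < k) tent (c n) (r n) (s n) t)%R).
    by rewrite ge_min lexx orbT.
  by apply: ler_sum => n _; exact: tent_le.
rewrite ge0_integral_sum//; last 2 first.
- exact: measurable_torus.
- move=> n; apply: measurable_funTS; apply: measurable_boolr.
  apply: measurable_fun_ler => //.
  by apply: measurableT_comp; [exact: measurable_tnorm|exact: measurable_funB].
rewrite -sumEFin; apply: lee_sum => n _.
apply: (@integral_affine_near_integer _ 1 (fun t => t - c n)%R) => //.
  by exists (- c n)%R => t; exists 0%R; rewrite mul1r addr0 addrC.
by rewrite ltr_wpDl.
Qed.

(** A Lebesgue-null set is covered by arcs of total length at most [1 / eta ^ 2];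
    then both terms of the hypothesis, for tents supported near finitely many of
    these arcs, are of order [1 / eta], and [eta] is arbitrary. *)
Lemma energy_absolutely_continuous
    (nu : {finite_measure set mR -> \bar R}) (Z : R) :
  nu (~` torus) = 0 -> (0 <= Z)%R ->
  (forall g eta, test_function g -> (0 < eta)%R ->
    \int[nu]_t (g t)%:E <=
    (eta / 2)%:E * \int[lam]_(t in torus) (g t ^+ 2)%:E + (Z / (2 * eta))%:E) ->
  nu `<< torus_lebesgue.
Proof.
move=> nuT Z0 H; apply/null_content_dominatesP => A mA A0.
(* Neither measure charges the complement of the circle. *)
pose N := A `&` (torus : set mR).
have mN : measurable N by apply: measurableI => //; exact: measurable_torus.
have N0 : lam N = 0 by exact: A0.
have AN : nu A <= nu N.
  rewrite (measureDI nu mA measurable_torus) [X in X + _](_ : _ = 0) ?add0e//.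
  apply/eqP; rewrite eq_le measure_ge0 andbT -nuT le_measure// ?inE.
  - by apply: measurableD => //; exact: measurable_torus.
  - by apply: measurableC; exact: measurable_torus.
apply/eqP; rewrite eq_le measure_ge0 andbT; apply: (le_trans AN).
suff bound (eta : R) : (0 < eta)%R -> nu N <= ((6 + Z) / eta)%:E.
  apply/lee_addgt0Pr => d d0; rewrite add0e.
  have eta0 : (0 < (6 + Z) / d)%R by rewrite divr_gt0// ltr_pwDl.
  apply: (le_trans (bound _ eta0)); rewrite lee_fin invf_div mulrCA divff ?mulr1//.
  by rewrite gt_eqF// ltr_pwDl.
move=> eta0; pose e := ((eta ^+ 2)^-1)%R.
have e0 : (0 < e)%R by rewrite invr_gt0 exprn_gt0.
have [c [r [r0 NU rs]]] := null_cover N0 e0.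
(* Each interval of the cover is widened by s n, of total at most e. *)
pose s (n : nat) : R := (e / (2 ^ n.+1)%:R)%R.
have s0 n : (0 < s n)%R by rewrite divr_gt0// ltr0n expn_gt0.
have ss k : (\sum_(0 <= n < k) s n <= e)%R.
  rewrite -lee_fin -sumEFin.
  apply: le_trans (epsilon_trick0 xpredT (ltW e0)).
  by apply: nneseries_lim_ge => n _ _; rewrite lee_fin ltW.
pose B n : set mR := [set t | `|t - c n| <= r n]%R.
have mB n : measurable (B n).
  rewrite (_ : B n = `[(c n - r n)%R, (c n + r n)%R]%classic); first exact: measurable_itv.
  by apply/seteqP; split => t; rewrite /B/= in_itv/= ler_distl.
have mUB k : measurable (\big[setU/set0]_(n < k) B n).
  by apply: bigsetU_measurable.
have finU k : nu (\big[setU/set0]_(n < k) B n) <= ((6 + Z) / eta)%:E.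
  apply: (@le_trans _ _ (\int[nu]_t (tents c r s k t)%:E)).
    rewrite -[leLHS]mul1e -integral_cst// integral_mkcond.
    apply: ge0_le_integral_nonmeas => t _; rewrite patchE.
      by case: ifP.
    case: ifP => [|_]; last by rewrite lee_fin (test_ge0 (test_tents c r k s0)).
    rewrite inE -bigcup_mkord => -[n /= nk Bt]; rewrite lee_fin le_min lexx/=.
    rewrite big_mkord (bigD1 (Ordinal nk))//= tent_eq1 ?lerDl ?sumr_ge0// => [i _|].
      exact: tent_ge0.
    by apply: le_trans (tnorm_le_norm _) _.
  apply: (le_trans (H _ _ (test_tents c r k s0) eta0)).
  apply: (@le_trans _ _ ((eta / 2)%:E * (12 * e)%:E + (Z / (2 * eta))%:E)).
    rewrite leeD2r//; apply: lee_wpmul2l; first by rewrite lee_fin divr_ge0// ltW.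
    apply: (le_trans (integral_tents_sqr c k r0 s0)); rewrite lee_fin.
    have -> : (\sum_(0 <= n < k) 6 * (r n + s n) =
        3 * \sum_(0 <= n < k) (2 * r n) + 6 * \sum_(0 <= n < k) s n)%R.
      by rewrite !mulr_sumr -big_split/=; apply: eq_bigr => n _; ring.
    have := rs k; have := ss k; lra.
  rewrite -EFinM -EFinD lee_fin.
  have -> : (eta / 2 * (12 * e) + Z / (2 * eta) = (6 + Z / 2) / eta)%R.
    by rewrite /e; field; rewrite gt_eqF.
  rewrite ler_pM2r ?invr_gt0// lerD2l ler_pdivrMr//; lra.
apply: (@le_trans _ _ (nu (\bigcup_n B n))).
  by apply: le_measure; rewrite ?inE//; exact: bigcup_measurable.
rewrite -bigcup_bigsetU_bigcup.
have cv := @nondecreasing_cvg_mu _ _ _ nu (fun k => \big[setU/set0]_(n < k.+1) B n).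
apply: (cvge_to_le (cv _ _ _)).
- by move=> k; exact: mUB.
- by apply: bigcup_measurable => k _; exact: mUB.
- by move=> a b ab; apply/subsetPset; exact: (subset_bigsetU (F := B) _).
- by apply: nearW => k; exact: finU.
Qed.

End absolute_continuity.

(** * Passage to the limit *)

Section fatou.
Local Open Scope ereal_scope.
Context d (T : measurableType d) {R : realType} (mu : {measure set T -> \bar R}).

(** Fatou's lemma read pointwise: [Z] is the lower limit of the sequence, which is
    finite almost everywhere because its integral is. *)
Lemma bounded_integral_liminf (f : nat -> T -> \bar R) (C : R) :
  (forall n, measurable_fun setT (f n)) -> (forall n x, 0 <= f n x) ->
  (forall n, \int[mu]_x f n x <= C%:E) ->
  {ae mu, forall x, exists2 Z : R, (0 <= Z)%R & forall n0 e, (0 < e)%R ->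
    exists2 n, (n0 <= n)%N & f n x <= (Z + e)%:E}.
Proof.
move=> mf f0 fC; pose L x := limn_einf (f ^~ x).
have einfs0 x n : 0 <= einfs (f ^~ x) n.
  by apply: le_ereal_inf_tmp => _ [m /= _ <-].
have L0 x : 0 <= L x.
  rewrite /L limn_einf_lim; apply: lime_ge; first exact: is_cvg_einfs.
  exact: nearW.
have mL : measurable_fun setT L.
  apply: (emeasurable_fun_cvg (fun n x => einfs (f ^~ x) n)).
    exact: measurable_fun_einfs.
  move=> x _; rewrite /L limn_einf_lim; exact: is_cvg_einfs.
have LC : \int[mu]_x L x <= C%:E.
  apply: le_trans (fatou mu measurableT mf (fun n x _ => f0 n x)) _.
  rewrite limn_einf_lim; apply: lime_le; first exact: is_cvg_einfs.
  apply: nearW => n; apply: le_trans (fC n).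
  by apply: ereal_inf_lbound; exists n => /=.
have iL : mu.-integrable setT L.
  apply/integrableP; split => //.
  under eq_integral do rewrite gee0_abs//.
  exact: le_lt_trans LC (ltry _).
apply: filterS (integrable_ae measurableT iL) => x /(_ I) Lfin.
exists (fine (L x)); first exact: fine_ge0.
move=> n0 e e0.
have : einfs (f ^~ x) n0 < (fine (L x) + e)%:E.
  apply: (@le_lt_trans _ _ (L x)).
    rewrite /L limn_einf_lim; apply: lime_ge; first exact: is_cvg_einfs.
    by exists n0 => // n /= n0n; exact: nondecreasing_einfs.
  by rewrite EFinD fineK// lteDl// lte_fin.
move=> /ereal_inf_lt[_ [n /= n0n <-]] fn; exists n => //; exact: ltW.
Qed.

End fatou.

Lemma torus_conv_pow_torus (R : realType) d
    (mu : {finite_measure set (measurableTypeR R) -> \bar R}) :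
  (1 <= d)%N -> torus_conv_pow d mu (~` torus) = 0%E.
Proof.
case: d => // d _; rewrite /torus_conv_pow iterS /=.
rewrite /torus_conv /pushforward (_ : _ @^-1` _ = set0) ?measure0//.
by apply/seteqP; split => // p /=; case; exact: mod1_torus.
Qed.

Theorem theorem1p1 (R : realType)
    (dO : measure_display) (Omega : measurableType dO) (P : probability Omega R)
    (omega : nat -> {RV P >-> R})
    (omega_indep : mutually_independent [set n | (1 <= n)%N] omega)
    (omega_unif : forall n, (1 <= n)%N -> forall A : set R, measurable A ->
      distribution P (omega n) A = torus_lebesgue A)
    (l : nat -> R)
    (l01 : forall n, (1 <= n)%N -> 0 < l n < 1)
    (l_decr : forall n, (1 <= n)%N -> l n.+1 <= l n)
    (l_cvg0 : l n @[n --> \oo] --> 0)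
    (l_sum : (\sum_(1 <= n <oo) (l n)%:E = +oo)%E)
    (l_exp_sum : (\sum_(1 <= n <oo)
      ((l n - l n.+1) * expR (\sum_(1 <= k < n.+1) l k))%:E < +oo)%E)
    (muD : Omega -> {finite_measure set (measurableTypeR R) -> \bar R})
    (muD_torus : forall w, muD w (~` torus) = 0%E)
    (muD_cvg : {ae P, forall w,
      weak_cvg_torus (dvoretzky_approx (fun k => omega k w) l01) (muD w)})
    (d : nat) (d_ge1 : (1 <= d)%N)
    (K_int : (torus_integral d (fun s =>
      (\prod_(t <- s) dvoretzky_kernel l t)
        * dvoretzky_kernel l (- \sum_(t <- s) t)%R) < +oo)%E) :
  {ae P, forall w, torus_conv_pow d (muD w) `<< torus_lebesgue}.
Proof.
have [C C0 EC] := expected_energy_le l01 l_decr omega_indep omega_unif l_cvg0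
  l_exp_sum d_ge1 K_int.
pose f n w := (n.+1%:R%:E * energy l d (omega ^~ w) n.+1 n.+1%:R^-1)%E.
have f0 n w : (0 <= f n w)%E by rewrite mule_ge0// energy_ge0.
have mf n : measurable_fun setT (f n).
  by apply: measurable_funeM; exact: measurable_energy.
have fC n : (\int[P]_w f n w <= C%:E)%E.
  rewrite ge0_integralZl//; last 2 first.
  - exact: measurable_energy.
  - by move=> w _; exact: energy_ge0.
  have n0 : (0 < n.+1%:R^-1 :> R) by rewrite invr_gt0.
  have -> : (C%:E = n.+1%:R%:E * (C * n.+1%:R^-1)%:E)%E.
    by rewrite -EFinM mulrCA divff ?mulr1.
  by apply: lee_wpmul2l; [rewrite lee_fin|exact: EC].
(* The set of full measure on which the approximations converge and the
   rescaled energies have a finite lower limit Z. *)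
have := bounded_integral_liminf mf f0 fC.
apply: filterS2 muD_cvg => w cvgw [Z Z0 HZ].
apply: (energy_absolutely_continuous (torus_conv_pow_torus _ d_ge1) Z0).
move=> g eta tg eta0; apply/lee_addgt0Pr => e e0.
have [b b0 massb] := mass_eventually (muD_torus w) cvgw.
have bd0 : 0 <= b ^+ d.+1 by rewrite exprn_ge0.
(* The error e is shared between the oscillation of g, the weak convergence
   (e / 4 each) and the excess of the energy (e / 2). *)
pose c := e / 4 / (b ^+ d.+1 + 1).
have c0 : 0 < c by rewrite !divr_gt0// ltr_wpDl.
have cb : c * b ^+ d.+1 <= e / 4.
  by rewrite /c mulrAC ler_pdivrMr ?ltr_wpDl// ler_wpM2l ?lerDl// divr_ge0// ltW.
have [r r0 gr] := test_uniform tg c0.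
have e40 : 0 < e / 4 by rewrite divr_gt0.
have [n1 H1] := eventually_nat_and massb
  (conv_pow_eventually (muD_torus w) cvgw d tg e40).
(* An index beyond the thresholds of the weak convergence, with 1 / (n + 1)
   below the modulus r, and where the rescaled energy is almost Z. *)
have [n n2n En] := HZ (maxn n1 (Num.truncn r^-1)) _ (mulr_gt0 eta0 e0).
move: n2n; rewrite geq_max => /andP[n1n rn].
have [nb cvn] := H1 n.+1 (leqW n1n).
pose N : R := n.+1%:R.
have N0 : 0 < N by rewrite ltr0n.
have rN : N^-1 <= r.
  rewrite -[leRHS]invrK lef_pV2 ?posrE ?invr_gt0//.
  by rewrite ltW// (lt_le_trans (truncnS_gt _))// ler_nat ltnS.
have N01 : 0 < N^-1 <= 1.
  by rewrite invr_gt0 N0/= invf_le1// ler1n.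
have gN u v : `|u - v| < N^-1 -> g u <= g v + c.
  by move=> uv; apply: gr; exact: lt_le_trans rN.
have := conv_integral_le_energy l01 d tg N01 eta0 (ltW c0) gN nb.
move: cvn; move: (conv_integral l _ d _ g) => CI cvn CIle; apply: (le_trans cvn).
apply: (le_trans (leeD CIle (lexx (e / 4)%:E))).
set I := (_ * \int[_]_(_ in _) _)%E.
have EE : ((2 * eta * N^-1)^-1%:E * energy l d (omega ^~ w) n.+1 N^-1 <=
    (Z / (2 * eta) + e / 2)%:E)%E.
  have -> : ((2 * eta * N^-1)^-1 = (2 * eta)^-1 * N).
    by field; rewrite !gt_eqF.
  rewrite EFinM -muleA; apply: (@le_trans _ _ ((2 * eta)^-1%:E * (Z + eta * e)%:E)%E).
    by apply: lee_wpmul2l => //; rewrite lee_fin invr_ge0 mulr_ge0// ltW.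
  rewrite -EFinM lee_fin le_eqVlt; apply/orP; left; apply/eqP.
  by field; rewrite gt_eqF.
apply: (@le_trans _ _ ((e / 4)%:E + (I + (Z / (2 * eta) + e / 2)%:E) + (e / 4)%:E)%E).
  rewrite leeD2r//; apply: leeD; first by rewrite lee_fin.
  by rewrite leeD2l.
rewrite addeAC -EFinD addeCA -addeA leeD2l// -!EFinD lee_fin; lra.
Qed.
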